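(* Let $\mathcal{L}$ be a real line arrangement in $\mathbb{CP}^2$ with $t$ non-collinear multiple points $P_1,\dots,P_t$ ($t\ge 1$), and let $k_i+1$ be the multiplicity of $P_i$ for $1\le i\le t$. Then $$\pi_1(\mathbb{CP}^2-\mathcal{L})\cong\Big(\bigoplus_{i=1}^t\mathbb{F}^{k_i}\Big)\oplus\mathbb{Z}^{t-1}.$$
   Context: A real line arrangement is a finite union of distinct projective lines in $\mathbb{CP}^2$, each of which can be defined by a linear equation with real coefficients; $\mathcal{L}$ denotes both the set of lines and their union. A simple point is a point where exactly two lines of the arrangement meet; a multiple point is a point where more than two lines meet; the multiplicity of a point is the number of lines of the arrangement passing through it. An arrangement with $t$ non-collinear multiple points is an arrangement with exactly $t$ multiple points in which no line of the arrangement contains two multiple points, and which can be divided into $t$ subsets of lines such that all the lines in each subset intersect in a single multiple point (so every line passes through exactly one multiple point, and lines from different subsets meet in simple points only). $\mathbb{F}^k$ denotes the free group on $k$ generators, and $\oplus$ denotes the direct product of groups. *)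

(* Defs.v *)
From HB Require Import structures.
From mathcomp Require Import all_boot all_order all_algebra generic_quotient.
From mathcomp Require Import finmap complex lra.
From mathcomp Require Import boolp classical_sets functions cardinality.
From mathcomp Require Import set_interval reals topology normedtype homotopy.

Set Implicit Arguments.
Unset Strict Implicit.
Unset Printing Implicit Defensive.

Import Order.TTheory GRing.Theory Num.Theory.
Import numFieldNormedType.Exports.

Local Open Scope classical_set_scope.
Local Open Scope ring_scope.
Local Open Scope quotient_scope.

Definition isomorphic (G H : groupType) : Prop :=
  exists f : {multiplicative G -> H}, bijective f.

Section DirectProduct.
Variables (I : Type) (G : I -> groupType).

Definition direct_product : Type := forall i, G i.

HB.instance Definition _ := Choice.on direct_product.

Let one : direct_product := fun i => 1%g.
Let inv (f : direct_product) : direct_product := fun i => (f i)^-1%g.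
Let mul (f g : direct_product) : direct_product := fun i => (f i * g i)%g.

Let mulA : associative mul.
Proof.
by move=> f g h; apply: functional_extensionality_dep => i; exact: mulgA.
Qed.

Let mul1 : left_id one mul.
Proof. by move=> f; apply: functional_extensionality_dep => i; exact: mul1g. Qed.

Let mulr1 : right_id one mul.
Proof. by move=> f; apply: functional_extensionality_dep => i; exact: mulg1. Qed.

Let mulV : left_inverse one inv mul.
Proof. by move=> f; apply: functional_extensionality_dep => i; exact: mulVg. Qed.

Let mulrV : right_inverse one inv mul.
Proof. by move=> f; apply: functional_extensionality_dep => i; exact: mulgV. Qed.

HB.instance Definition _ :=
  isGroup.Build direct_product mulA mul1 mulr1 mulV mulrV.

End DirectProduct.

Definition Zpow (n : nat) : groupType := Algebra.to_multiplicative 'rV[int]_n.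

(** The letter [(x, true)] stands for the generator [x] and [(x, false)] for
    its inverse; words are taken modulo insertion and deletion of pairs of
    adjacent mutually inverse letters. *)
Section FreeGroup.
Variable T : choiceType.

Definition word : Type := seq (T * bool).

Inductive word_eq : word -> word -> Prop :=
| word_eq_refl w : word_eq w w
| word_eq_sym w1 w2 : word_eq w1 w2 -> word_eq w2 w1
| word_eq_trans w1 w2 w3 : word_eq w1 w2 -> word_eq w2 w3 -> word_eq w1 w3
| word_eq_cancel (u v : word) x b :
    word_eq (u ++ [:: (x, b), (x, ~~ b) & v]) (u ++ v).

Let word_rel (w1 w2 : word) := `[< word_eq w1 w2 >].

Let word_rel_refl : reflexive word_rel.
Proof. by move=> w; apply/asboolP; exact: word_eq_refl. Qed.

Let word_rel_sym : symmetric word_rel.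
Proof.
by move=> u v; apply/asboolP/asboolP; exact: word_eq_sym.
Qed.

Let word_rel_trans : transitive word_rel.
Proof.
move=> v u w /asboolP uv /asboolP vw; apply/asboolP.
exact: word_eq_trans uv vw.
Qed.

Definition word_equiv := EquivRel _ word_rel_refl word_rel_sym word_rel_trans.

Definition free_group : Type := {eq_quot word_equiv}.

HB.instance Definition _ := Choice.on free_group.
HB.instance Definition _ := Quotient.on free_group.

Definition word_inv (w : word) : word :=
  rev [seq (a.1, ~~ a.2) | a <- w].

Lemma word_eq_catl (u w1 w2 : word) :
  word_eq w1 w2 -> word_eq (u ++ w1) (u ++ w2).
Proof.
elim=> [w|{}w1 {}w2 _|{}w1 {}w2 w3 _ IH1 _ IH2|v w x b].
- exact: word_eq_refl.
- exact: word_eq_sym.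
- exact: word_eq_trans IH1 IH2.
- by rewrite !catA; exact: word_eq_cancel.
Qed.

Lemma word_eq_catr (u w1 w2 : word) :
  word_eq w1 w2 -> word_eq (w1 ++ u) (w2 ++ u).
Proof.
elim=> [w|{}w1 {}w2 _|{}w1 {}w2 w3 _ IH1 _ IH2|v w x b].
- exact: word_eq_refl.
- exact: word_eq_sym.
- exact: word_eq_trans IH1 IH2.
- by rewrite -!catA /=; exact: word_eq_cancel.
Qed.

Lemma word_eq_cat (u1 u2 w1 w2 : word) :
  word_eq u1 u2 -> word_eq w1 w2 -> word_eq (u1 ++ w1) (u2 ++ w2).
Proof.
move=> u12 w12; apply: (word_eq_trans (word_eq_catr _ u12)).
exact: word_eq_catl.
Qed.

Lemma word_inv_cat (u v : word) : word_inv (u ++ v) = word_inv v ++ word_inv u.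
Proof. by rewrite /word_inv map_cat rev_cat. Qed.

Lemma word_invK : involutive word_inv.
Proof.
move=> w; rewrite /word_inv map_rev revK -map_comp -[RHS]map_id.
by apply: eq_map => -[x b] /=; rewrite negbK.
Qed.

Lemma word_eq_inv (w1 w2 : word) :
  word_eq w1 w2 -> word_eq (word_inv w1) (word_inv w2).
Proof.
elim=> [w|{}w1 {}w2 _|{}w1 {}w2 w3 _ IH1 _ IH2|v w x b].
- exact: word_eq_refl.
- exact: word_eq_sym.
- exact: word_eq_trans IH1 IH2.
- rewrite (word_inv_cat _ (_ :: _)) word_inv_cat.
  rewrite (word_inv_cat [:: (x, b); (x, ~~ b)] w) -catA /= /word_inv /= negbK.
  exact: word_eq_cancel.
Qed.

Lemma word_eq_mulV (w : word) : word_eq (w ++ word_inv w) [::].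
Proof.
elim/last_ind: w => [|w [x b] IH]; first exact: word_eq_refl.
rewrite -cats1 word_inv_cat -catA /=.
exact: word_eq_trans (word_eq_cancel w (word_inv w) x b) IH.
Qed.

Let piP (u v : word) : word_eq u v -> \pi_free_group u = \pi_free_group v.
Proof. by move=> uv; apply/eqmodP/asboolP. Qed.

Let reprP (u : word) : word_eq (repr (\pi_free_group u)) u.
Proof.
suff /eqmodP/asboolP : repr (\pi_free_group u) = u %[mod free_group] by [].
by rewrite reprK.
Qed.

Let piW (P : free_group -> Prop) :
  (forall u, P (\pi_free_group u)) -> forall a, P a.
Proof. by move=> Pu a; rewrite -[a]reprK. Qed.

Let one : free_group := \pi_free_group [::].
Let mul (a b : free_group) : free_group :=
  \pi_free_group (repr a ++ repr b : word).
Let inv (a : free_group) : free_group := \pi_free_group (word_inv (repr a)).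

Let mulE (u v : word) :
  mul (\pi_free_group u) (\pi_free_group v) = \pi_free_group (u ++ v).
Proof. by apply: piP; apply: word_eq_cat; exact: reprP. Qed.

Let invE (u : word) : inv (\pi_free_group u) = \pi_free_group (word_inv u).
Proof. by apply: piP; apply: word_eq_inv; exact: reprP. Qed.

Let mulA : associative mul.
Proof. by elim/piW=> u; elim/piW=> v; elim/piW=> w; rewrite !mulE catA. Qed.

Let mul1 : left_id one mul.
Proof. by elim/piW=> u; rewrite mulE. Qed.

Let mulr1 : right_id one mul.
Proof. by elim/piW=> u; rewrite mulE cats0. Qed.

Let mulrV : right_inverse one inv mul.
Proof. by elim/piW=> u; rewrite invE mulE; exact: piP (word_eq_mulV u). Qed.

Let mulV : left_inverse one inv mul.
Proof.
elim/piW=> u; rewrite invE mulE; apply: piP.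
by rewrite -[X in _ ++ X]word_invK; exact: word_eq_mulV.
Qed.

HB.instance Definition _ :=
  isGroup.Build free_group mulA mul1 mulr1 mulV mulrV.

End FreeGroup.

Section UnitInterval.
Variable R : realType.

Definition unit_itv : Type := set_type `[0 : R, 1].

HB.instance Definition _ := Topological.copy unit_itv (set_type `[0 : R, 1]).

Definition itv_val (s : unit_itv) : R := \val s.

Let clamp_subproof (r : R) : Num.max 0 (Num.min 1 r) \in `[0 : R, 1]%classic.
Proof.
rewrite inE/= in_itv/= le_max lexx/= ge_max ler01/=.
by rewrite ge_min lexx.
Qed.

Definition clamp (r : R) : unit_itv := SigSub (clamp_subproof r).

Lemma itv_val_itv (s : unit_itv) : 0 <= itv_val s <= 1.
Proof. by case: s => r /=; rewrite /itv_val/= inE/= in_itv. Qed.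

Lemma itv_val_inj : injective itv_val.
Proof. exact: val_inj. Qed.

Lemma clampK (r : R) : 0 <= r <= 1 -> itv_val (clamp r) = r.
Proof.
by move=> /andP[r0 r1]; rewrite /itv_val/= (min_idPr r1) (max_idPr r0).
Qed.

Lemma itv_valK : cancel itv_val clamp.
Proof.
by move=> s; apply: itv_val_inj; rewrite clampK//; exact: itv_val_itv.
Qed.

Lemma itv_val_continuous : continuous itv_val.
Proof.
have := @initial_continuous (set_type `[0 : R, 1]) R set_val.
by rewrite set_valE.
Qed.

Lemma clamp_continuous : continuous clamp.
Proof.
apply: (@continuous_comp_initial (set_type `[0 : R, 1]) R R set_val clamp).
rewrite set_valE.
move=> r; apply: (@continuous_max R R (cst 0) (Num.min 1)).
  exact: cst_continuous.
by apply: (@continuous_min R R (cst 1) id) => //; exact: cst_continuous.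
Qed.

Let zero_one_neq : clamp 0 != clamp 1.
Proof.
apply/eqP => /(congr1 itv_val); rewrite !clampK ?lexx ?ler01//.
by move/eqP; rewrite eq_sym oner_eq0.
Qed.

HB.instance Definition _ := isBiPointed.Build unit_itv zero_one_neq.

Lemma itv_val0 : itv_val zero = 0.
Proof. by rewrite clampK// lexx ler01. Qed.

Lemma itv_val1 : itv_val one = 1.
Proof. by rewrite clampK// lexx ler01. Qed.

End UnitInterval.

Lemma continuous_if_le (R : realType) (Y Z : topologicalType) (h : Y -> R)
    (a : R) (F G : Y -> Z) :
  continuous h -> continuous F -> continuous G ->
  (forall y, h y = a -> F y = G y) ->
  continuous (fun y => if h y <= a then F y else G y).
Proof.
move=> ch cF cG FG; set K := fun y => _.
have UT : [set y | h y <= a] `|` [set y | a <= h y] = setT.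
  rewrite -subTset => y _ /=.
  by have /orP[] := le_total (h y) a; [left|right].
apply/continuous_subspace_setT; rewrite -UT; apply: withinU_continuous.
- exact: ((continuous_closedP h).1 ch _ (@closed_le _ a)).
- exact: ((continuous_closedP h).1 ch _ (@closed_ge _ a)).
- apply: (@subspace_eq_continuous _ _ _ F) (continuous_subspaceT cF).
  by move=> y; rewrite inE /= => ya; rewrite /from_subspace /K ya.
- apply: (@subspace_eq_continuous _ _ _ G) (continuous_subspaceT cG).
  move=> y; rewrite inE /= => ahy; rewrite /from_subspace /K; case: ifPn => // hya.
  by apply/esym/FG/le_anti; rewrite hya.
Qed.

Section Paths.
Variables (R : realType) (X : topologicalType).
Local Notation I := (unit_itv R).
Implicit Types x y z : X.

Definition path_homotopic x y (f g : {path I from x to y}) : Prop :=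
  exists H : I * I -> X, [/\ continuous H,
    forall s, H (s, zero) = f s, forall s, H (s, one) = g s,
    forall u, H (zero, u) = x & forall u, H (one, u) = y].

Lemma comp_clamp_continuous (Y : topologicalType) (f : I -> X) (h : Y -> R) :
  continuous f -> continuous h -> continuous (fun v => f (clamp (h v))).
Proof.
move=> cf ch v; apply: (@continuous_comp _ _ _ (fun v => clamp (h v)) f).
  by apply: continuous_comp; [exact: ch|exact: clamp_continuous].
exact: cf.
Qed.

Let cval (Y : topologicalType) (h : Y -> I) :
  continuous h -> continuous (fun v => itv_val (h v)).
Proof.
by move=> ch v; apply: continuous_comp; [exact: ch|exact: itv_val_continuous].
Qed.

Let caffine (Y : topologicalType) (h : Y -> R) (a b : R) :
  continuous h -> continuous (fun v => a * h v + b).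
Proof.
move=> ch v; apply: cvgD; last exact: cvg_cst.
by apply: cvgM; [exact: cvg_cst|exact: ch].
Qed.

Let cscale (Y : topologicalType) (h : Y -> R) (a : R) :
  continuous h -> continuous (fun v => a * h v).
Proof. by move=> ch v; apply: cvgM; [exact: cvg_cst|exact: ch]. Qed.

Let connem (Y : topologicalType) (h : Y -> R) :
  continuous h -> continuous (fun v => 1 - h v).
Proof. by move=> ch v; apply: cvgB; [exact: cvg_cst|exact: ch]. Qed.

Definition path_cat_fun (f g : I -> X) (s : I) : X :=
  if itv_val s <= 1 / 2 then f (clamp (2 * itv_val s))
  else g (clamp (2 * itv_val s - 1)).

Section Cat.
Variables (x y z : X).
Variables (f : {path I from x to y}) (g : {path I from y to z}).

Let cat_continuous : continuous (path_cat_fun f g).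
Proof.
apply: continuous_if_le; first exact: itv_val_continuous.
- apply: comp_clamp_continuous; first exact: cts_fun.
  exact: cscale (@itv_val_continuous R).
- apply: comp_clamp_continuous; first exact: cts_fun.
  exact: caffine (@itv_val_continuous R).
- move=> s ->; rewrite (_ : 2 * (1 / 2) = 1 :> R); last by lra.
  by rewrite subrr path_one path_zero.
Qed.

Let cat_zero : path_cat_fun f g zero = x.
Proof.
rewrite /path_cat_fun itv_val0 mulr0 ifT; last by lra.
exact: path_zero.
Qed.

Let cat_one : path_cat_fun f g one = z.
Proof.
rewrite /path_cat_fun itv_val1 ifF; last by apply/negbTE; lra.
by rewrite (_ : 2 * 1 - 1 = 1 :> R) ?path_one//; lra.
Qed.

Definition path_cat : {path I from x to z} :=
  mk_path cat_continuous cat_zero cat_one.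

End Cat.

Section Rev.
Variables (x y : X) (f : {path I from x to y}).

Definition path_rev_fun (s : I) : X := f (clamp (1 - itv_val s)).

Let rev_continuous : continuous path_rev_fun.
Proof.
apply: comp_clamp_continuous; first exact: cts_fun.
exact: connem (@itv_val_continuous R).
Qed.

Let rev_zero : path_rev_fun zero = y.
Proof. by rewrite /path_rev_fun itv_val0 subr0; exact: path_one. Qed.

Let rev_one : path_rev_fun one = x.
Proof. by rewrite /path_rev_fun itv_val1 subrr; exact: path_zero. Qed.

Definition path_rev : {path I from y to x} :=
  mk_path rev_continuous rev_zero rev_one.

End Rev.

Let cfst : continuous (fun su : I * I => su.1).
Proof. by move=> su; exact: cvg_fst. Qed.

Let csnd : continuous (fun su : I * I => su.2).
Proof. by move=> su; exact: cvg_snd. Qed.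

Let cclamp (Y : topologicalType) (h : Y -> R) :
  continuous h -> continuous (fun v => clamp (h v)).
Proof.
by move=> ch v; apply: continuous_comp; [exact: ch|exact: clamp_continuous].
Qed.

Let cpair (Y : topologicalType) (K : I * I -> X) (a b : Y -> I) :
  continuous K -> continuous a -> continuous b ->
  continuous (fun v => K (a v, b v)).
Proof.
move=> cK ca cb v; apply: (@continuous_comp _ _ _ (fun v => (a v, b v)) K).
  exact: (cvg_pair (ca v) (cb v)).
exact: cK.
Qed.

Section HomotopyEquiv.
Variables (x y : X).
Implicit Types f g h : {path I from x to y}.

Lemma path_homotopic_refl f : path_homotopic f f.
Proof.
exists (fun su => f su.1); split=> //= [|u|u]; rewrite ?path_zero ?path_one//.
move=> su; apply: (@continuous_comp _ _ _ fst f); first exact: cvg_fst.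
exact: cts_fun.
Qed.

Lemma path_homotopic_sym f g : path_homotopic f g -> path_homotopic g f.
Proof.
move=> [H [cH H0 H1 Hx Hy]].
exists (fun su => H (su.1, clamp (1 - itv_val su.2))); split=> //= [|s|s].
- by apply: (cpair cH cfst); apply: cclamp; apply: connem; exact: cval csnd.
- by rewrite itv_val0 subr0; exact: H1.
- by rewrite itv_val1 subrr; exact: H0.
Qed.

Lemma path_homotopic_trans f g h :
  path_homotopic f g -> path_homotopic g h -> path_homotopic f h.
Proof.
move=> [H [cH H0 H1 Hx Hy]] [K [cK K0 K1 Kx Ky]].
exists (fun su => if itv_val su.2 <= 1 / 2
  then H (su.1, clamp (2 * itv_val su.2))
  else K (su.1, clamp (2 * itv_val su.2 - 1))); split=> /= [|s|s|u|u].
- apply: continuous_if_le; first exact: cval csnd.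
  + by apply: (cpair cH cfst); apply: cclamp; apply: cscale; exact: cval csnd.
  + by apply: (cpair cK cfst); apply: cclamp; apply: caffine; exact: cval csnd.
  + move=> [s u] /= ->; rewrite (_ : 2 * (1 / 2) = 1 :> R); last by lra.
    by rewrite subrr; exact: etrans (H1 s) (esym (K0 s)).
- by rewrite itv_val0 mulr0 ifT ?H0//; lra.
- rewrite itv_val1 ifF; last by apply/negbTE; lra.
  by rewrite (_ : 2 * 1 - 1 = 1 :> R) ?K1//; lra.
- by rewrite Hx Kx if_same.
- by rewrite Hy Ky if_same.
Qed.

Lemma reparam_homotopic (z t : X) (p : {path I from z to t}) f g
    (a b : I -> R) :
  continuous a -> continuous b -> a zero = b zero -> a one = b one ->
  (forall s, f s = p (clamp (a s))) -> (forall s, g s = p (clamp (b s))) ->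
  path_homotopic f g.
Proof.
move=> ca cb ab0 ab1 fa gb.
exists (fun su => p (clamp ((1 - itv_val su.2) * a su.1
                            + itv_val su.2 * b su.1))).
split=> /= [|s|s|u|u].
- apply: comp_clamp_continuous; first exact: cts_fun.
  have cu : continuous (fun su : I * I => itv_val su.2) by exact: cval csnd.
  have ca1 : continuous (fun su : I * I => a su.1).
    by move=> su; apply: (@continuous_comp _ _ _ fst a); [exact: cvg_fst|exact: ca].
  have cb1 : continuous (fun su : I * I => b su.1).
    by move=> su; apply: (@continuous_comp _ _ _ fst b); [exact: cvg_fst|exact: cb].
  move=> su; apply: cvgD; last exact: (cvgM (cu su) (cb1 su)).
  exact: (cvgM (@connem _ _ cu su) (ca1 su)).
- by rewrite itv_val0 subr0 mul1r mul0r addr0 fa.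
- by rewrite itv_val1 subrr mul1r mul0r add0r gb.
- by rewrite -ab0 -mulrDl subrK mul1r -fa path_zero.
- by rewrite -ab1 -mulrDl subrK mul1r -fa path_one.
Qed.

End HomotopyEquiv.

Lemma path_cat_homotopic x y z (f f' : {path I from x to y})
    (g g' : {path I from y to z}) :
  path_homotopic f f' -> path_homotopic g g' ->
  path_homotopic (path_cat f g) (path_cat f' g').
Proof.
move=> [H [cH H0 H1 Hx Hy]] [K [cK K0 K1 Ky Kz]].
exists (fun su => if itv_val su.1 <= 1 / 2
  then H (clamp (2 * itv_val su.1), su.2)
  else K (clamp (2 * itv_val su.1 - 1), su.2)); split=> /= [|s|s|u|u].
- apply: continuous_if_le; first exact: cval cfst.
  + apply: (cpair cH _ csnd); apply: cclamp; apply: cscale; exact: cval cfst.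
  + apply: (cpair cK _ csnd); apply: cclamp; apply: caffine; exact: cval cfst.
  + move=> [s u] /= ->; rewrite (_ : 2 * (1 / 2) = 1 :> R); last by lra.
    by rewrite subrr; exact: etrans (Hy u) (esym (Ky u)).
- by rewrite H0 K0.
- by rewrite H1 K1.
- by rewrite itv_val0 mulr0 ifT ?Hx//; lra.
- rewrite itv_val1 ifF; last by apply/negbTE; lra.
  by rewrite (_ : 2 * 1 - 1 = 1 :> R) ?Kz//; lra.
Qed.

Lemma path_rev_homotopic x y (f g : {path I from x to y}) :
  path_homotopic f g -> path_homotopic (path_rev f) (path_rev g).
Proof.
move=> [H [cH H0 H1 Hx Hy]].
exists (fun su => H (clamp (1 - itv_val su.1), su.2)); split=> /= [|s|s|u|u].
- by apply: (cpair cH _ csnd); apply: cclamp; apply: connem; exact: cval cfst.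
- by rewrite H0.
- by rewrite H1.
- by rewrite itv_val0 subr0; exact: Hy.
- by rewrite itv_val1 subrr; exact: Hx.
Qed.

Lemma path_catE x y z (f : {path I from x to y}) (g : {path I from y to z}) s :
  path_cat f g s = if itv_val s <= 1 / 2 then f (clamp (2 * itv_val s))
                   else g (clamp (2 * itv_val s - 1)).
Proof. by []. Qed.

Lemma path_revE x y (f : {path I from x to y}) s :
  path_rev f s = f (clamp (1 - itv_val s)).
Proof. by []. Qed.

Lemma path_cat_clampl x y z (f : {path I from x to y})
    (g : {path I from y to z}) (r : R) :
  0 <= r <= 1 / 2 -> path_cat f g (clamp r) = f (clamp (2 * r)).
Proof.
move=> r01; rewrite path_catE clampK; last by lra.
by rewrite ifT//; lra.
Qed.

Lemma path_cat_clampr x y z (f : {path I from x to y})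
    (g : {path I from y to z}) (r : R) :
  1 / 2 <= r <= 1 -> path_cat f g (clamp r) = g (clamp (2 * r - 1)).
Proof.
move=> r01; rewrite path_catE clampK; last by lra.
case: ifPn => // r2; rewrite (_ : r = 1 / 2); last by lra.
rewrite (_ : 2 * (1 / 2) = 1 :> R); last by lra.
by rewrite subrr [LHS]path_one [RHS]path_zero.
Qed.

Let min3 (a b c : R) : Num.min a (Num.min b c) =
  if b <= c then (if a <= b then a else b) else (if a <= c then a else c).
Proof. by case: (leP b c) => _; rewrite minEle. Qed.

Lemma path_catA x y z w (f : {path I from x to y}) (g : {path I from y to z})
    (h : {path I from z to w}) :
  path_homotopic (path_cat (path_cat f g) h) (path_cat f (path_cat g h)).
Proof.
pose a (s : I) := Num.min (2 * itv_val s)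
  (Num.min (1 * itv_val s + 1 / 4) (1 / 2 * itv_val s + 1 / 2)).
apply: (@reparam_homotopic _ _ _ _ (path_cat f (path_cat g h)) _ _ a
  (@itv_val R)).
- move=> s; apply: (@continuous_min R I (fun s => 2 * itv_val s)).
    exact: cscale (@itv_val_continuous R) s.
  apply: (@continuous_min R I (fun s => 1 * itv_val s + 1 / 4)).
    exact: caffine (@itv_val_continuous R) s.
  exact: caffine (@itv_val_continuous R) s.
- exact: itv_val_continuous.
- by rewrite /a itv_val0 min3; case: ifPn => ?; case: ifPn => ?; lra.
- by rewrite /a itv_val1 min3; case: ifPn => ?; case: ifPn => ?; lra.
- move=> s; rewrite -{1}(itv_valK s) /a; have := itv_val_itv s.
  move: (itv_val s) => r r01.
  have [r2|r2] := leP r (1 / 2); last first.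
    rewrite path_cat_clampr; last by lra.
    rewrite (_ : Num.min _ (Num.min _ _) = 1 / 2 * r + 1 / 2); last first.
      by rewrite min3; case: ifPn => ?; case: ifPn => ?; lra.
    rewrite path_cat_clampr; last by lra.
    rewrite path_cat_clampr; last by lra.
    by congr (h (clamp _)); lra.
  rewrite path_cat_clampl; last by lra.
  have [r4|r4] := leP r (1 / 4).
    rewrite path_cat_clampl; last by lra.
    rewrite (_ : Num.min _ (Num.min _ _) = 2 * r); last first.
      by rewrite min3; case: ifPn => ?; case: ifPn => ?; lra.
    by rewrite path_cat_clampl//; lra.
  rewrite path_cat_clampr; last by lra.
  rewrite (_ : Num.min _ (Num.min _ _) = r + 1 / 4); last first.
    by rewrite min3; case: ifPn => ?; case: ifPn => ?; lra.
  rewrite path_cat_clampr; last by lra.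
  rewrite path_cat_clampl; last by lra.
  by congr (g (clamp _)); lra.
- by move=> s; rewrite itv_valK.
Qed.

Lemma path_cat_cstl x y (f : {path I from x to y}) :
  path_homotopic (path_cat (cst x : {path I from x to x}) f) f.
Proof.
apply: (@reparam_homotopic _ _ _ _ f _ _
  (fun s => Num.max 0 (2 * itv_val s - 1)) (@itv_val R)).
- move=> s; apply: (@continuous_max R I (cst 0)); first exact: cst_continuous.
  exact: caffine (@itv_val_continuous R) s.
- exact: itv_val_continuous.
- by rewrite itv_val0 maxEle; case: ifPn; lra.
- by rewrite itv_val1 maxEle; case: ifPn; lra.
- move=> s; rewrite -{1}(itv_valK s); have := itv_val_itv s.
  move: (itv_val s) => r r01; have [r2|r2] := leP r (1 / 2).
    rewrite path_cat_clampl; last by lra.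
    rewrite (_ : Num.max _ _ = 0) ?path_zero//.
    by rewrite maxEle; case: ifPn; lra.
  rewrite path_cat_clampr; last by lra.
  by congr (f (clamp _)); rewrite maxEle; case: ifPn; lra.
- by move=> s; rewrite itv_valK.
Qed.

Lemma path_cat_cstr x y (f : {path I from x to y}) :
  path_homotopic (path_cat f (cst y : {path I from y to y})) f.
Proof.
apply: (@reparam_homotopic _ _ _ _ f _ _
  (fun s => Num.min 1 (2 * itv_val s)) (@itv_val R)).
- move=> s; apply: (@continuous_min R I (cst 1)); first exact: cst_continuous.
  exact: cscale (@itv_val_continuous R) s.
- exact: itv_val_continuous.
- by rewrite itv_val0 minEle; case: ifPn; lra.
- by rewrite itv_val1 minEle; case: ifPn; lra.
- move=> s; rewrite -{1}(itv_valK s); have := itv_val_itv s.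
  move: (itv_val s) => r r01; have [r2|r2] := leP r (1 / 2).
    rewrite path_cat_clampl; last by lra.
    by congr (f (clamp _)); rewrite minEle; case: ifPn; lra.
  rewrite path_cat_clampr; last by lra.
  rewrite (_ : Num.min _ _ = 1) ?path_one//.
  by rewrite minEle; case: ifPn; lra.
- by move=> s; rewrite itv_valK.
Qed.

Lemma path_cat_revr x y (f : {path I from x to y}) :
  path_homotopic (path_cat f (path_rev f)) (cst x : {path I from x to x}).
Proof.
apply: (@reparam_homotopic _ _ _ _ f _ _
  (fun s => Num.min (2 * itv_val s) (-2 * itv_val s + 2)) (fun=> 0)).
- move=> s; apply: (@continuous_min R I (fun s => 2 * itv_val s)).
    exact: cscale (@itv_val_continuous R) s.
  exact: caffine (@itv_val_continuous R) s.
- exact: cst_continuous.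
- by rewrite itv_val0 minEle /=; case: ifPn; lra.
- by rewrite itv_val1 minEle /=; case: ifPn; lra.
- move=> s; rewrite -{1}(itv_valK s); have := itv_val_itv s.
  move: (itv_val s) => r r01; have [r2|r2] := leP r (1 / 2).
    rewrite path_cat_clampl; last by lra.
    by congr (f (clamp _)); rewrite minEle; case: ifPn; lra.
  rewrite path_cat_clampr; last by lra.
  rewrite path_revE clampK; last by lra.
  by congr (f (clamp _)); rewrite minEle; case: ifPn; lra.
- by move=> s /=; rewrite path_zero.
Qed.

Lemma path_cat_revl x y (f : {path I from x to y}) :
  path_homotopic (path_cat (path_rev f) f) (cst y : {path I from y to y}).
Proof.
apply: (@reparam_homotopic _ _ _ _ f _ _
  (fun s => Num.max (-2 * itv_val s + 1) (2 * itv_val s - 1)) (fun=> 1)).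
- move=> s; apply: (@continuous_max R I (fun s => -2 * itv_val s + 1)).
    exact: caffine (@itv_val_continuous R) s.
  exact: caffine (@itv_val_continuous R) s.
- exact: cst_continuous.
- by rewrite itv_val0 maxEle /=; case: ifPn; lra.
- by rewrite itv_val1 maxEle /=; case: ifPn; lra.
- move=> s; rewrite -{1}(itv_valK s); have := itv_val_itv s.
  move: (itv_val s) => r r01; have [r2|r2] := leP r (1 / 2).
    rewrite path_cat_clampl; last by lra.
    rewrite path_revE clampK; last by lra.
    by congr (f (clamp _)); rewrite maxEle; case: ifPn; lra.
  rewrite path_cat_clampr; last by lra.
  by congr (f (clamp _)); rewrite maxEle; case: ifPn; lra.
- by move=> s /=; rewrite path_one.
Qed.

End Paths.

Section FundamentalGroup.
Variables (R : realType) (X : topologicalType) (x : X).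
Local Notation I := (unit_itv R).
Local Notation loop := {path I from x to x}.

Let loop_rel (f g : loop) := `[< path_homotopic f g >].

Let loop_rel_refl : reflexive loop_rel.
Proof. by move=> f; apply/asboolP; exact: path_homotopic_refl. Qed.

Let loop_rel_sym : symmetric loop_rel.
Proof. by move=> f g; apply/asboolP/asboolP; exact: path_homotopic_sym. Qed.

Let loop_rel_trans : transitive loop_rel.
Proof.
move=> g f h /asboolP fg /asboolP gh; apply/asboolP.
exact: path_homotopic_trans fg gh.
Qed.

Definition loop_equiv := EquivRel _ loop_rel_refl loop_rel_sym loop_rel_trans.

Definition pi1 : Type := {eq_quot loop_equiv}.

HB.instance Definition _ := Choice.on pi1.
HB.instance Definition _ := Quotient.on pi1.

Let piP (f g : loop) : path_homotopic f g -> \pi_pi1 f = \pi_pi1 g.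
Proof. by move=> fg; apply/eqmodP/asboolP. Qed.

Let reprP (f : loop) : path_homotopic (repr (\pi_pi1 f)) f.
Proof.
suff /eqmodP/asboolP : repr (\pi_pi1 f) = f %[mod pi1] by [].
by rewrite reprK.
Qed.

Let piW (P : pi1 -> Prop) : (forall f, P (\pi_pi1 f)) -> forall a, P a.
Proof. by move=> Pf a; rewrite -[a]reprK. Qed.

Let one : pi1 := \pi_pi1 (cst x : loop).
Let mul (a b : pi1) : pi1 := \pi_pi1 (path_cat (repr a) (repr b)).
Let inv (a : pi1) : pi1 := \pi_pi1 (path_rev (repr a)).

Let mulE (f g : loop) : mul (\pi_pi1 f) (\pi_pi1 g) = \pi_pi1 (path_cat f g).
Proof. by apply: piP; apply: path_cat_homotopic; exact: reprP. Qed.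

Let invE (f : loop) : inv (\pi_pi1 f) = \pi_pi1 (path_rev f).
Proof. by apply: piP; apply: path_rev_homotopic; exact: reprP. Qed.

Let mulA : associative mul.
Proof.
elim/piW=> f; elim/piW=> g; elim/piW=> h; rewrite !mulE.
by apply/esym/piP; exact: path_catA.
Qed.

Let mul1 : left_id one mul.
Proof. by elim/piW=> f; rewrite mulE; apply: piP; exact: path_cat_cstl. Qed.

Let mulr1 : right_id one mul.
Proof. by elim/piW=> f; rewrite mulE; apply: piP; exact: path_cat_cstr. Qed.

Let mulV : left_inverse one inv mul.
Proof.
by elim/piW=> f; rewrite invE mulE; apply: piP; exact: path_cat_revl.
Qed.

Let mulrV : right_inverse one inv mul.
Proof.
by elim/piW=> f; rewrite invE mulE; apply: piP; exact: path_cat_revr.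
Qed.

HB.instance Definition _ := isGroup.Build pi1 mulA mul1 mulr1 mulV mulrV.

End FundamentalGroup.

(** The ascription makes the topology attached to any [numFieldType] available
    on [R[i]]. *)
Definition C (R : realType) : numClosedFieldType := R[i].

Section ProjectiveSpace.
Variables (R : realType) (n : nat).

Definition punctured : set 'rV[C R]_n.+1 := [set v | v != 0].

Let proj_rel (v w : punctured) :=
  `[< exists2 c : C R, c != 0 & \val w = c *: \val v >].

Let proj_rel_refl : reflexive proj_rel.
Proof. by move=> v; apply/asboolP; exists 1; rewrite ?oner_eq0 ?scale1r. Qed.

Let proj_rel_sym : symmetric proj_rel.
Proof.
by move=> v w; apply/asboolP/asboolP => -[c c0 ->]; exists c^-1;
  rewrite ?invr_eq0// scalerA mulVf ?scale1r.
Qed.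

Let proj_rel_trans : transitive proj_rel.
Proof.
move=> w v u /asboolP[c c0 wv] /asboolP[d d0 uw]; apply/asboolP.
by exists (d * c); rewrite ?mulf_neq0// uw wv scalerA.
Qed.

Definition proj_equiv := EquivRel _ proj_rel_refl proj_rel_sym proj_rel_trans.

Definition CP : Type := quotient_topology {eq_quot proj_equiv}.

HB.instance Definition _ := Topological.on CP.
HB.instance Definition _ := Quotient.on CP.

Definition hyperplane (a : 'rV[C R]_n.+1) : set CP :=
  [set \pi_CP v | v in [set v : punctured | \sum_i a 0 i * (\val v) 0 i = 0]].

End ProjectiveSpace.

Section LineArrangements.
Variable R : realType.
Local Notation CP2 := (CP R 2).

Definition real_line (l : set CP2) : Prop :=
  exists2 a : 'rV[R]_3, a != 0 & l = hyperplane (map_mx (real_complex R) a).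

Definition real_line_arrangement (L : {fset set CP2}) : Prop :=
  forall l, l \in L -> real_line l.

Definition arrangement_complement (L : {fset set CP2}) : set CP2 :=
  ~` \bigcup_(l in [set` L]) l.

Definition multiplicity (L : {fset set CP2}) (p : CP2) : nat :=
  #|` [fset l in L | p \in l]%fset |.

Definition multiple_point (L : {fset set CP2}) (p : CP2) : Prop :=
  (2 < multiplicity L p)%N.

(** The blocks of the division of [L] are indexed by their common points:
    disjoint blocks covering [L] with a common multiple point each are
    necessarily in bijection with the [t] multiple points, since the lines
    through a multiple point contain no other one. *)
Definition noncollinear_multiple_points (L : {fset set CP2}) (t : nat)
    (P : 'I_t -> CP2) : Prop :=
  [/\ injective P,
      forall p, multiple_point L p <-> exists i, p = P i,
      forall l, l \in L -> forall i j, l (P i) -> l (P j) -> i = j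
    & exists S : 'I_t -> {fset set CP2},
        [/\ forall l, (l \in L) = [exists i, l \in S i],
            forall i j, i != j -> [disjoint S i & S j]%fset
          & forall i l, l \in S i -> l (P i)]].

End LineArrangements.

(* Main.v *)
(* With a line of the first pencil at infinity and suitable real coordinates,
   the complement becomes the set of pairs [(x, y)] of points of the real plane
   (real and imaginary part) such that for every other line [c] the affine form
   [lform c x] or its linear part [dform c y] is nonzero. When [y] is generic, [x]
   moves freely, and vice versa; so the group is generated by the moves of [x]
   across the lines at generic heights [y], that is, by meridians attached to the
   edges of the real picture. Comparing the two ways around a vertex shows that
   the meridian of a line changes only at the multiple point on that line, by a
   conjugation inside its pencil, that meridians of different pencils commute,
   and that the product of the meridians of an affine pencil is central. Hence
   [k i] meridians for each pencil and the [t - 1] central products generate.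
   No presentation is needed to see that they satisfy no further relation:
   cutting the complement along a hypersurface [s = 0] and giving a weight to each
   piece of the cut defines a morphism out of the group, and suitable cuts give
   the projections to the free groups and to [Z]. *)

From HB Require Import structures.
From mathcomp Require Import all_boot all_order all_algebra generic_quotient.
From mathcomp Require Import finmap complex ring lra zify.
From mathcomp Require Import boolp classical_sets functions.
From mathcomp Require Import reals interval_inference topology.
From mathcomp Require Import normedtype homotopy realfun.
Require Import Defs.

Set Implicit Arguments.
Unset Strict Implicit.
Unset Printing Implicit Defensive.

Import Order.TTheory GRing.Theory Num.Theory.
Import numFieldNormedType.Exports.

Local Open Scope classical_set_scope.
Local Open Scope ring_scope.
Local Open Scope quotient_scope.

(** * Generated subgroups and free groups *)

Section Subgroups.
Variable G : groupType.
Implicit Types (S A B : set G) (g h : G).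
Local Open Scope group_scope.

(** A line carries two meridians, one on each side of its multiple point, and the crossing of two
    lines from different pencils yields a commutation for only one of the four combinations. This is
    the main obstacle; it is overcome by using right-hand meridians as normal form and writing each
    left-hand one as a conjugate by right-hand meridians of smaller slope, so that an induction on
    slopes applies. An affine pencil with [k i + 1] lines trades its steepest meridian for the
    central product. The pencil at infinity has already given up one line, so it keeps its [k i]
    parallel lines and has no central product: hence the exponent [t - 1]. The cuts come from maps
    to a complex line: [X2 - m0 * X1] for the parallel pencil, the slope of the line to [P i] for
    the others; the cut is where the value is real. The steepest line serves as infinity, which is
    why its meridian goes to the inverse of the product of the letters. The exponents of the central
    products are read off as winding numbers around the steepest lines. *)

Definition is_subgroup S : Prop :=
  [/\ S 1, forall g h, S g -> S h -> S (g * h) & forall g, S g -> S g^-1].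

Definition gen A : set G := [set g | forall S, is_subgroup S -> A `<=` S -> S g].

Lemma gen_subgroup A : is_subgroup (gen A).
Proof.
split=> [S [S1 _ _] _ //|g h gA hA S sS AS|g gA S sS AS].
  by case: (sS) => _ SM _; apply: SM; [exact: gA|exact: hA].
by case: (sS) => _ _ SV; apply: SV; exact: gA.
Qed.

Lemma sub_gen A : A `<=` gen A.
Proof. by move=> g Ag S _; apply. Qed.

Lemma gen_min A S : is_subgroup S -> A `<=` S -> gen A `<=` S.
Proof. by move=> sS AS g; apply. Qed.

Lemma gen1 A : gen A 1. Proof. by case: (gen_subgroup A). Qed.

Lemma genM A g h : gen A g -> gen A h -> gen A (g * h).
Proof. by case: (gen_subgroup A) => _ + _; apply. Qed.

Lemma genV A g : gen A g -> gen A g^-1.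
Proof. by case: (gen_subgroup A) => _ _; apply. Qed.

Lemma gen_sub A B : A `<=` gen B -> gen A `<=` gen B.
Proof. by move=> AB; apply: gen_min AB; exact: gen_subgroup. Qed.

Lemma gen_prod A (I : Type) (r : seq I) (P : pred I) (F : I -> G) :
  (forall i, P i -> gen A (F i)) -> gen A (\prod_(i <- r | P i) F i).
Proof. by move=> FA; elim/big_ind: _ => //; [exact: gen1|exact: genM]. Qed.

Lemma centraliser_subgroup A : is_subgroup [set g | forall h, A h -> commute g h].
Proof.
split=> [h _|g g' gA gA' h Ah|g gA h Ah]; apply: commute_sym.
- exact: commute1.
- by apply: commuteM; apply: commute_sym; [exact: gA|exact: gA'].
- by apply: commuteV; apply: commute_sym; exact: gA.
Qed.

Lemma gen_commutel A B :
  (forall g h, A g -> B h -> commute g h) ->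
  forall g h, gen A g -> B h -> commute g h.
Proof.
move=> AB g h gA Bh; apply: (gen_min (centraliser_subgroup B) _ gA) => //.
by move=> g' Ag' h' Bh'; exact: AB.
Qed.

Lemma gen_commute A B :
  (forall g h, A g -> B h -> commute g h) ->
  forall g h, gen A g -> gen B h -> commute g h.
Proof.
move=> AB g h gA hB; apply: commute_sym; apply: (gen_commutel _ hB gA).
move=> h' g' Bh' gA'; apply: commute_sym; exact: gen_commutel gA' Bh'.
Qed.

Lemma commuteJ (g h x : G) :
  commute g x -> commute g (x * h * x^-1) -> commute g h.
Proof.
move=> gx gxh.
have -> : h = x^-1 * (x * h * x^-1) * x by rewrite !mulgA mulgVK mulVg mul1g.
by apply: commuteM => //; apply: commuteM => //; exact: commuteV.
Qed.

Definition zpow (g : G) (z : int) : G :=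
  match z with Posz n => g ^+ n | Negz n => g ^- n.+1 end.

Lemma zpowS g z : zpow g (z + 1)%R = zpow g z * g.
Proof.
case: z => n; first by rewrite -PoszD addn1 /= expgSr.
case: n => [|n] /=; first by rewrite expg1 mulVg.
by rewrite (expgS g n.+1) invgM mulgVK subn1.
Qed.

Lemma zpowD g y z : zpow g (y + z)%R = zpow g y * zpow g z.
Proof.
have zpowP z' : zpow g (z' - 1)%R = zpow g z' * g^-1.
  by rewrite -[in RHS](subrK 1%R z') zpowS mulgK.
elim/int_rec: z => [|n IH|n IH]; first by rewrite addr0 /= mulg1.
  by rewrite -addn1 PoszD addrA !zpowS IH mulgA.
by rewrite -addn1 PoszD opprD addrA !zpowP IH mulgA.
Qed.

Lemma zpow_commute g h z : commute g h -> commute (zpow g z) h.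
Proof.
move=> gh; apply: commute_sym; case: z => n /=.
  by apply: commuteX; exact: commute_sym.
by apply: commuteV; apply: commuteX; exact: commute_sym.
Qed.

End Subgroups.

Section Morphisms.
Variables (G H : groupType) (f : G -> H).
Hypothesis fM : {morph f : x y / (x * y)%g}.
Local Open Scope group_scope.

Lemma morph1g : f 1 = 1.
Proof. by apply: (@mulgI _ (f 1)); rewrite -fM !mulg1. Qed.

Lemma morphVg x : f x^-1 = (f x)^-1.
Proof. by apply: (@mulgI _ (f x)); rewrite -fM !mulgV morph1g. Qed.

Lemma morph_prodg (I : Type) (r : seq I) (P : pred I) (F : I -> G) :
  f (\prod_(i <- r | P i) F i) = \prod_(i <- r | P i) f (F i).
Proof. by apply: (big_morph f fM); exact: morph1g. Qed.

Lemma morph_zpow x z : f (zpow x z) = zpow (f x) z.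
Proof.
have fX n : f (x ^+ n) = f x ^+ n.
  by elim: n => [|n IH]; rewrite ?expg0 ?morph1g // !expgS fM IH.
by case: z => n /=; rewrite ?morphVg fX.
Qed.

Lemma morph_eq_gen (f' : G -> H) (A : set G) :
  {morph f' : x y / x * y} -> (forall g, A g -> f g = f' g) ->
  forall g, gen A g -> f g = f' g.
Proof.
move=> f'M ff' g gA.
have f'1 : f' 1 = 1 by apply: (@mulgI _ (f' 1)); rewrite -f'M !mulg1.
apply: (gA [set g | f g = f' g]) => //; split=> [|x y /= fx fy|x /= fx].
- by rewrite /= morph1g f'1.
- by rewrite fM f'M fx fy.
- rewrite morphVg fx; apply: (@mulgI _ (f' x)).
  by rewrite -f'M !mulgV f'1.
Qed.

End Morphisms.

Section FreeGroupUniversal.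
Variable T : choiceType.
Local Open Scope group_scope.

Definition fgen (x : T) : free_group T := \pi_(free_group T) [:: (x, true)].

Lemma free_groupM (u v : word T) :
  \pi_(free_group T) u * \pi_(free_group T) v = \pi_(free_group T) (u ++ v) :> free_group T.
Proof.
have rP (w : word T) : word_eq (repr (\pi_(free_group T) w)) w.
  suff /eqmodP/asboolP : repr (\pi_(free_group T) w) = w %[mod free_group T] by [].
  by rewrite reprK.
by apply/eqmodP/asboolP; exact: word_eq_cat.
Qed.

Lemma fgenV (x : T) : (fgen x)^-1 = \pi_(free_group T) [:: (x, false)].
Proof.
apply: (@mulgI _ (fgen x)); rewrite mulgV free_groupM; apply/eqmodP/asboolP.
by apply: word_eq_sym; exact: (word_eq_cancel [::] [::] x true).
Qed.

Lemma free_group_gen (g : free_group T) : gen (range fgen) g.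
Proof.
rewrite -[g]reprK; elim: (repr g) => [|[x b] w IH]; first exact: gen1.
rewrite -cat1s -free_groupM; apply: genM IH.
have xg : gen (range fgen) (fgen x) by apply: sub_gen; exists x.
by case: b => //; rewrite -fgenV; exact: genV.
Qed.

Variables (G : groupType) (f : T -> G).

Definition flift_word (w : word T) : G :=
  \prod_(a <- w) (if a.2 then f a.1 else (f a.1)^-1).

Definition flift (g : free_group T) : G := flift_word (repr g).

Lemma flift_pi (w : word T) : flift (\pi_(free_group T) w) = flift_word w.
Proof.
have : repr (\pi_(free_group T) w) = w %[mod free_group T] by rewrite reprK.
move=> /eqmodP/asboolP; rewrite /flift; move: (repr _) => r.
elim=> [//|w1 w2 _ ->//|w1 w2 w3 _ -> _ ->//|u v x b].
rewrite /flift_word !big_cat /= !big_cons /=; congr (_ * _).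
by case: b; rewrite /= mulgA ?mulgV ?mulVg mul1g.
Qed.

Lemma fliftM : {morph flift : g h / g * h}.
Proof.
move=> g h; rewrite -[g]reprK -[h]reprK free_groupM !flift_pi.
by rewrite /flift_word big_cat.
Qed.

Lemma flift_fgen x : flift (fgen x) = f x.
Proof. by rewrite flift_pi /flift_word big_seq1. Qed.

Lemma flift_gen (g : free_group T) : gen (range f) (flift g).
Proof.
apply: gen_prod => -[x b] _ /=.
have xg : gen (range f) (f x) by apply: sub_gen; exists x.
by case: b => //; exact: genV.
Qed.

End FreeGroupUniversal.

(** * Holonomy of local cocycles *)

Section Subdivision.
Variable R : realType.
Local Notation I := (unit_itv R).

Lemma subdiv_itv (n i : nat) (s : R) : (i < n)%N ->
  i%:R / n%:R <= s <= i.+1%:R / n%:R -> 0 <= s <= 1.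
Proof.
move=> ltin /andP[is1 si].
have n0 : 0 < n%:R :> R by rewrite ltr0n; case: n ltin {is1 si}.
apply/andP; split; first by apply: le_trans is1; rewrite divr_ge0.
by apply: (le_trans si); rewrite ler_pdivrMr// mul1r ler_nat.
Qed.

(** The Lebesgue number lemma for the unit square: compactness, in its near-covering form, gives one
    mesh for all points. *)
Lemma square_subdivision (Z : topologicalType) (K : R * R -> Z)
    (C : set (set Z)) :
  continuous K -> (forall z : Z, exists2 N : set Z, C N & nbhs z N) ->
  exists2 n : nat, (0 < n)%N & forall i j, (i < n)%N -> (j < n)%N ->
    exists2 N : set Z, C N & forall s u,
      i%:R / n%:R <= s <= i.+1%:R / n%:R ->
      j%:R / n%:R <= u <= j.+1%:R / n%:R -> N (K (s, u)).
Proof.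
move=> cK Ccov.
have cpt : compact (`[0 : R, 1] `*` `[0 : R, 1]).
  by apply: compact_setX; exact: segment_compact.
pose P (n : nat) (x : R * R) := exists2 N : set Z, C N & forall s u,
  `|s - x.1| <= n.+1%:R^-1 -> `|u - x.2| <= n.+1%:R^-1 -> N (K (s, u)).
have [x _|n _ /(_ n (leqnn n)) Pn] :=
  (compact_near_coveringP _).1 cpt nat \oo P _.
  have [N CN nN] := Ccov (K x).
  have /nbhs_ballP[/= r r0 xrN] := cK x _ nN.
  have r20 : 0 < r / 2 by rewrite divr_gt0.
  exists (ball x (r / 2), [set n : nat | n.+1%:R^-1 < r / 2]) => /=.
    split; first exact: nbhsx_ballx.
    exact: near_infty_natSinv_lt (PosNum r20).
  move=> [x' n] /= [] [xx'1 xx'2] /= nr; exists N => // s u sx ux; apply: xrN.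
  have sub2 (a b c : R) : `|a - b| < r / 2 -> `|c - b| <= n.+1%:R^-1 -> `|a - c| < r.
    move=> ab cb; rewrite (_ : a - c = (a - b) - (c - b)); last by ring.
    apply: le_lt_trans (ler_normB _ _) _.
    by rewrite [r]splitr ltrD //; exact: le_lt_trans cb nr.
  by split; rewrite /ball /=; [apply: sub2 xx'1 sx|apply: sub2 xx'2 ux].
exists n.+1 => // i j ltin ltjn.
have gridP (k : nat) : (k < n.+1)%N -> `[0 : R, 1]%classic (k%:R / n.+1%:R).
  move=> kn; rewrite /= in_itv /=; apply: (@subdiv_itv n.+1 k) => //.
  by rewrite lexx ler_pM2r ?invr_gt0 ?ltr0n // ler_nat leqnSn.
have [|N CN HN] := Pn (i%:R / n.+1%:R, j%:R / n.+1%:R).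
  by split; exact: gridP.
exists N => // s u.
have aux (k : nat) (r : R) : k%:R / n.+1%:R <= r <= k.+1%:R / n.+1%:R ->
    `|r - k%:R / n.+1%:R| <= n.+1%:R^-1.
  move=> /andP[kr rk]; rewrite ger0_norm ?subr_ge0// lerBlDl.
  by rewrite -[X in _ + X]mul1r -mulrDl natr1.
by move=> /aux sx /aux ux; exact: HN.
Qed.

Lemma path_subdivision (Z : topologicalType) (f : I -> Z) (C : set (set Z)) :
  continuous f -> (forall z : Z, exists2 N : set Z, C N & nbhs z N) ->
  exists2 n : nat, (0 < n)%N & forall i, (i < n)%N ->
    exists2 N : set Z, C N & forall s, i%:R / n%:R <= s <= i.+1%:R / n%:R ->
      N (f (clamp s)).
Proof.
move=> cf Ccov.
have cK : continuous (fun su : R * R => f (clamp su.1)).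
  by apply: comp_clamp_continuous => // su; exact: cvg_fst.
have [n n0 Hn] := square_subdivision cK Ccov.
exists n => // i ltin; have [N CN HN] := Hn i 0 ltin n0.
exists N => // s sn; apply: (HN s 0 sn); rewrite mul0r lexx /=.
by rewrite divr_ge0.
Qed.

End Subdivision.

Section Holonomy.
Variables (R : realType) (Z : topologicalType) (G : groupType).
Variable q : Z -> Z -> G.
Local Notation I := (unit_itv R).
Implicit Types (f g : I -> Z) (N : set Z).

(** [q] is defined for all pairs but is multiplicative only on small sets, like the transport of a
    flat connection; [hol] measures its global failure to be a cocycle. *)
Definition cocycle_on N : Prop :=
  forall a b c, N a -> N b -> N c -> (q a b * q b c = q a c)%g.

Definition fine f (n : nat) : Prop :=
  forall i, (i < n)%N -> exists2 N : set Z, cocycle_on N &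
    forall s, i%:R / n%:R <= s <= i.+1%:R / n%:R -> N (f (clamp s)).

Definition grid f (n j : nat) : Z := f (clamp (j%:R / n%:R)).

Definition hprod (u : nat -> Z) (n : nat) : G :=
  (\prod_(0 <= j < n) q (u j) (u j.+1))%g.

(* The holonomy of [q] along [f], read off any subdivision so fine that [q] is
   a cocycle along each piece. *)
Definition hol f : G :=
  let n := xget 1 [set n : nat | (0 < n)%N /\ fine f n] in hprod (grid f n) n.

Lemma cocycle_on1 N a : cocycle_on N -> N a -> q a a = 1%g.
Proof.
by move=> qN Na; apply: (@mulgI _ (q a a)); rewrite (qN a a a) // mulg1.
Qed.

Lemma cocycle_prod N (u : nat -> Z) (a b : nat) : cocycle_on N -> (a <= b)%N ->
  (forall j, (a <= j <= b)%N -> N (u j)) ->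
  (\prod_(a <= j < b) q (u j) (u j.+1))%g = q (u a) (u b).
Proof.
move=> qN ab; have [k ->] : exists k, b = (a + k)%N by exists (b - a)%N; rewrite subnKC.
elim: k => [|k IH] Nu.
  rewrite addn0 big_geq // (cocycle_on1 qN) //.
  by apply: Nu; rewrite addn0 leqnn.
rewrite addnS big_nat_recr /= ?leq_addr // IH; last first.
  move=> j /andP[aj jk]; apply: Nu; rewrite aj /=.
  by apply: leq_trans jk _; rewrite leq_add2l.
by apply: qN; apply: Nu; lia.
Qed.

Lemma fine_refine f n k : (0 < n)%N -> (0 < k)%N -> fine f n -> fine f (n * k).
Proof.
move=> n0 k0 fn i ink.
have [] := fn (i %/ k)%N; first by rewrite ltn_divLR.
move=> N qN HN; exists N => // s /andP[is1 si]; apply: HN.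
have nR : 0 < n%:R :> R by rewrite ltr0n.
have kR : 0 < k%:R :> R by rewrite ltr0n.
rewrite natrM in is1 si; apply/andP; split.
  apply: le_trans is1; rewrite ler_pdivlMr ?mulr_gt0 // mulrA divfK ?gt_eqF //.
  by rewrite -natrM ler_nat leq_divM.
apply: (le_trans si); rewrite ler_pdivrMr ?mulr_gt0 // mulrA divfK ?gt_eqF //.
by rewrite -natrM ler_nat -ltn_divLR.
Qed.

Lemma hprod_refine f n k : (0 < n)%N -> (0 < k)%N -> fine f n ->
  hprod (grid f (n * k)) (n * k) = hprod (grid f n) n.
Proof.
move=> n0 k0 fn.
have nR : 0 < n%:R :> R by rewrite ltr0n.
have kR : 0 < k%:R :> R by rewrite ltr0n.
suff H m : (m <= n)%N -> hprod (grid f (n * k)) (m * k) = hprod (grid f n) m.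
  exact: H.
have gridM j : grid f (n * k) (j * k) = grid f n j.
  by rewrite /grid !natrM -mulf_div divff ?gt_eqF // mulr1.
elim: m => [|m IH] mn; first by rewrite mul0n /hprod !big_geq.
rewrite /hprod (@big_cat_nat _ _ _ (m * k)) //=; last by rewrite leq_mul2r leqnSn orbT.
rewrite big_nat_recr //= -[in RHS]/(hprod _ _) -IH 1?ltnW //; congr (_ * _)%g.
have [N qN HN] := fn m mn.
rewrite (cocycle_prod qN) ?leq_mul2r ?leqnSn ?orbT // ?gridM // => j /andP[mj jm].
apply: HN; rewrite natrM; apply/andP; split.
  rewrite ler_pdivlMr ?mulr_gt0 // mulrA divfK ?gt_eqF //.
  by rewrite -natrM ler_nat.
rewrite ler_pdivrMr ?mulr_gt0 // mulrA divfK ?gt_eqF //.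
by rewrite -natrM ler_nat.
Qed.

(** Subdivisions into [n] and into [m] pieces are both compared with the one into [n * m] pieces. *)
Lemma holE f n : (0 < n)%N -> fine f n -> hol f = hprod (grid f n) n.
Proof.
move=> n0 fn; rewrite /hol; case: xgetP => [m _ [m0 fm]|/(_ n)]; last by case.
by rewrite -(hprod_refine n0 m0 fn) mulnC hprod_refine.
Qed.

Hypothesis qloc : forall z : Z, exists2 N : set Z, cocycle_on N & nbhs z N.

Lemma fine_exists f : continuous f -> exists2 n, (0 < n)%N & fine f n.
Proof.
by move=> cf; have [n n0 fn] := path_subdivision cf qloc; exists n.
Qed.

Lemma hol_cst z : hol (cst z) = 1%g.
Proof.
have [N qN /nbhs_singleton Nz] := qloc z.
rewrite (@holE _ 1) //; first by rewrite /hprod big_nat1 (cocycle_on1 qN).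
by move=> i _; exists N.
Qed.

(** The square is cut into cells on which [q] is a cocycle, so a row can be pushed across one strip
    of cells; the vertical sides contribute nothing because the homotopy fixes the end points. *)
Lemma hol_homotopic x y (f g : {path I from x to y}) :
  path_homotopic f g -> hol f = hol g.
Proof.
move=> [H [cH H0 H1 Hx Hy]].
pose K (su : R * R) := H (clamp su.1, clamp su.2).
have c1 : continuous (fun su : R * R => clamp su.1).
  by move=> su; apply: continuous_comp; [exact: cvg_fst|exact: clamp_continuous].
have c2 : continuous (fun su : R * R => clamp su.2).
  by move=> su; apply: continuous_comp; [exact: cvg_snd|exact: clamp_continuous].
have cK : continuous K.
  move=> su; apply: (@continuous_comp _ _ _ (fun su : R * R => (clamp su.1, clamp su.2)) H).
    exact: (cvg_pair (c1 su) (c2 su)).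
  exact: cH.
have [n n0 Kn] := square_subdivision cK qloc.
have nn : n%:R / n%:R = 1 :> R by rewrite divff // pnatr_eq0 -lt0n.
have z0 : clamp 0 = zero :> I by [].
have z1 : clamp 1 = one :> I by [].
have rown (b : nat) : forall j, K (j%:R / n%:R, b%:R / n%:R) = grid (fun s => H (s, clamp (b%:R / n%:R))) n j.
  by [].
have le_self (i : nat) : (i%:R / n%:R : R) <= i.+1%:R / n%:R.
  by rewrite ler_pM2r ?invr_gt0 ?ltr0n // ler_nat.
have finef : fine f n.
  move=> i ltin; have [N qN HN] := Kn i 0 ltin n0; exists N => // s sn.
  have := HN s 0 sn; rewrite mul0r lexx divr_ge0 //= => /(_ isT).
  by rewrite /K /= z0 H0.
have fineg : fine g n.
  move=> i ltin; have := Kn i n.-1 ltin; rewrite prednK // => /(_ (leqnn n)).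
  move=> [N qN HN]; exists N => // s sn.
  have b1 : n.-1%:R / n%:R <= (1 : R) <= n%:R / n%:R.
    by rewrite nn lexx andbT ler_pdivrMr ?ltr0n // mul1r ler_nat leq_pred.
  have := HN s 1 sn b1.
  by rewrite /K /= z1 H1.
rewrite (holE n0 finef) (holE n0 fineg).
pose z (a b : nat) := K (a%:R / n%:R, b%:R / n%:R).
(* The two ways around a strip of [a] cells: along row [b] and then up, or up and then along row
   [b.+1]. *)
have step a b : (b < n)%N -> (a <= n)%N ->
    (hprod (z ^~ b) a * q (z a b) (z a b.+1) =
     q (z 0%N b) (z 0%N b.+1) * hprod (z ^~ b.+1) a)%g.
  move=> bn; elim: a => [|a IH] an; first by rewrite /hprod !big_geq // mul1g mulg1.
  have [N qN HN] := Kn a b an bn.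
  have Nz c d : (c = a \/ c = a.+1) -> (d = b \/ d = b.+1) -> N (z c d).
    by move=> ca db; apply: HN; [case: ca => ->|case: db => ->]; rewrite lexx le_self.
  rewrite /hprod !big_nat_recr //= -!/(hprod _ _) mulgA -IH 1?ltnW // -!mulgA.
  congr (_ * _)%g; rewrite (qN (z a b)) ?(qN (z a b)) //; apply: Nz; by [left|right].
have zx b : z 0%N b = x by rewrite /z /K /= mul0r z0 Hx.
have zy b : z n b = y by rewrite /z /K /= nn z1 Hy.
have qq w : q w w = 1%g.
  by have [N qN /nbhs_singleton Nw] := qloc w; exact: cocycle_on1 qN Nw.
have rows b : (b <= n)%N -> hprod (z ^~ b) n = hprod (z ^~ 0%N) n.
  elim: b => // b IH bn; rewrite -IH 1?ltnW //.
  by have := step n b bn (leqnn n); rewrite !zx !zy !qq mulg1 mul1g.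
have -> : hprod (grid f n) n = hprod (z ^~ 0%N) n.
  by apply: eq_bigr => j _; rewrite /z /K /= mul0r z0 !H0.
have -> : hprod (grid g n) n = hprod (z ^~ n) n.
  by apply: eq_bigr => j _; rewrite /z /K /= nn z1 !H1.
by rewrite rows.
Qed.

(** Both paths are first refined to the same number [n] of pieces; the [2 * n] pieces of the
    concatenation then split at its midpoint. *)
Lemma hol_cat x y z (f : {path I from x to y}) (g : {path I from y to z}) :
  hol (path_cat f g) = (hol f * hol g)%g.
Proof.
have [n1 n10 fn1] := fine_exists (@cts_fun _ _ f).
have [n2 n20 gn2] := fine_exists (@cts_fun _ _ g).
pose n := (n1 * n2)%N.
have n0 : (0 < n)%N by rewrite muln_gt0 n10.
have fn : fine f n by exact: fine_refine.
have gn : fine g n by rewrite /n mulnC; exact: fine_refine.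
have nR : 0 < n%:R :> R by rewrite ltr0n.
have nn : n%:R / n%:R = 1 :> R by rewrite divff // gt_eqF.
have half (a : R) : a / (2 * n)%:R = a / n%:R / 2.
  by rewrite natrM invfM (mulrC 2^-1) mulrA.
have cfg : fine (path_cat f g) (2 * n).
  move=> i i2n; have [ltin|leni] := ltnP i n.
    have [N qN HN] := fn i ltin; exists N => // s; rewrite !half => /andP[is1 si].
    have /subdiv_itv : i%:R / n%:R <= 2 * s <= i.+1%:R / n%:R by apply/andP; lra.
    move=> /(_ ltin) s01; rewrite path_cat_clampl; last by apply/andP; lra.
    by apply: HN; apply/andP; lra.
  have ltin : (i - n < n)%N by rewrite ltn_subLR // addnn -mul2n.
  have [N qN HN] := gn _ ltin; exists N => // s; rewrite !half => /andP[is1 si].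
  have eA : i%:R / n%:R = (i - n)%:R / n%:R + 1 :> R by rewrite natrB // mulrBl nn subrK.
  have eB : i.+1%:R / n%:R = (i - n).+1%:R / n%:R + 1 :> R.
    by rewrite -[in LHS](subnK leni) -addSn natrD mulrDl nn.
  have /subdiv_itv : (i - n)%:R / n%:R <= 2 * s - 1 <= (i - n).+1%:R / n%:R by apply/andP; lra.
  move=> /(_ ltin) s01; rewrite path_cat_clampr; last by apply/andP; lra.
  by apply: HN; apply/andP; lra.
have n20' : (0 < 2 * n)%N by rewrite muln_gt0.
rewrite (holE n20' cfg) (holE n0 fn) (holE n0 gn).
rewrite /hprod (@big_cat_nat _ _ _ n) //=; last by rewrite mul2n -addnn leq_addr.
have gridl j : (j <= n)%N -> grid (path_cat f g) (2 * n) j = grid f n j.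
  move=> jn; have j0 : 0 <= j%:R / n%:R :> R by rewrite divr_ge0.
  have j1 : j%:R / n%:R <= 1 :> R by rewrite ler_pdivrMr // mul1r ler_nat.
  rewrite /grid half path_cat_clampl; last by apply/andP; lra.
  by congr (f (clamp _)); lra.
have gridr j : (j <= n)%N -> grid (path_cat f g) (2 * n) (n + j) = grid g n j.
  move=> jn; have j0 : 0 <= j%:R / n%:R :> R by rewrite divr_ge0.
  have j1 : j%:R / n%:R <= 1 :> R by rewrite ler_pdivrMr // mul1r ler_nat.
  rewrite /grid half natrD mulrDl nn path_cat_clampr; last by apply/andP; lra.
  by congr (g (clamp _)); lra.
congr (_ * _)%g.
  by apply: eq_big_nat => j /andP[_ jn]; rewrite !gridl // ltnW.
move: (grid (path_cat f g) (2 * n)) gridr => u gridr {gridl}.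
rewrite -[X in \big[_/_]_(X <= _ < _) _](add0n n) mul2n -addnn big_addn addnK.
by apply: eq_big_nat => j /andP[_ jn]; rewrite -addSn -!(addnC n) !gridr // ltnW.
Qed.

Lemma hol_rev x y (f : {path I from x to y}) : hol (path_rev f) = (hol f)^-1%g.
Proof.
apply: (@mulgI _ (hol f)); rewrite mulgV -hol_cat -(hol_cst x).
by apply: hol_homotopic; exact: path_cat_revr.
Qed.

End Holonomy.

Section Pi1.
Variables (R : realType) (X : topologicalType).
Local Notation I := (unit_itv R).

Lemma pi1_eq (x : X) (f g : {path I from x to x}) :
  path_homotopic f g -> \pi_(pi1 R x) f = \pi_(pi1 R x) g.
Proof. by move=> fg; apply/eqmodP/asboolP. Qed.

Lemma pi1_repr (x : X) (f : {path I from x to x}) :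
  path_homotopic (repr (\pi_(pi1 R x) f)) f.
Proof.
suff /eqmodP/asboolP : repr (\pi_(pi1 R x) f) = f %[mod pi1 R x] by [].
by rewrite reprK.
Qed.

Lemma pi1M (x : X) (f g : {path I from x to x}) :
  (\pi_(pi1 R x) f * \pi_(pi1 R x) g)%g = \pi_(pi1 R x) (path_cat f g) :> pi1 R x.
Proof. by apply: pi1_eq; apply: path_cat_homotopic; exact: pi1_repr. Qed.

Variables (z : X) (conn : forall a, {path I from z to a}).

(** A functor from the fundamental groupoid to a single group, so that paths with different ends can
    be multiplied there; no continuity of [conn a] in [a] is assumed. *)
Definition kpath a b (f : {path I from a to b}) : pi1 R z :=
  \pi_(pi1 R z) (path_cat (path_cat (conn a) f) (path_rev (conn b))).

Lemma kpath_homotopic a b (f g : {path I from a to b}) :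
  path_homotopic f g -> kpath f = kpath g.
Proof.
move=> fg; apply: pi1_eq; apply: path_cat_homotopic; last exact: path_homotopic_refl.
by apply: path_cat_homotopic fg; exact: path_homotopic_refl.
Qed.

Lemma kpath_cat a b c (f : {path I from a to b}) (g : {path I from b to c}) :
  kpath (path_cat f g) = (kpath f * kpath g)%g.
Proof.
rewrite pi1M; apply: pi1_eq.
have refl := @path_homotopic_refl R X.
have tr := @path_homotopic_trans R X.
have cong := @path_cat_homotopic R X.
have sy := @path_homotopic_sym R X.
apply: (tr) (sy _ _ _ _ (path_catA _ _ _)).
have e : path_homotopic (path_cat (path_rev (conn b)) (path_cat (conn b) g)) g.
  apply: (tr) (sy _ _ _ _ (path_catA _ _ _)) _.
  apply: (tr) (cong _ _ _ _ _ _ _ (path_cat_revl _) (refl _ _ _)) _.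
  exact: path_cat_cstl.
apply: (tr) _ (cong _ _ _ _ _ _ _ (refl _ _ _) (path_catA _ _ _)).
apply: (tr) _ (path_catA _ _ _); apply: (cong) (refl _ _ _).
apply: (tr) (sy _ _ _ _ (path_catA _ _ _)) _.
by apply: (cong) (refl _ _ _) _; exact: sy.
Qed.

(** The class of a constant path is idempotent. *)
Lemma kpath_const a b (f : {path I from a to b}) :
  (forall s, f s = a) -> kpath f = 1%g.
Proof.
move=> fa; have e : b = a by rewrite -(@path_one _ _ _ _ f) fa.
subst b; have -> : f = cst a :> {path I from a to a} by apply/path_eqP.
apply: (@mulIg _ (kpath (cst a : {path I from a to a}))).
by rewrite mul1g -kpath_cat; apply: kpath_homotopic; exact: path_cat_cstl.
Qed.

Lemma kpath_ext a b a' b' (f : {path I from a to b}) (g : {path I from a' to b'}) :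
  f =1 g -> kpath f = kpath g.
Proof.
move=> fg; have e : a = a' by rewrite -(@path_zero _ _ _ _ f) -(@path_zero _ _ _ _ g).
have e' : b = b' by rewrite -(@path_one _ _ _ _ f) -(@path_one _ _ _ _ g).
by subst a' b'; congr kpath; apply/path_eqP.
Qed.

(** [conn z] may be any loop, so the class of a loop is recovered only up to a conjugation. *)
Lemma kpath_loop (f : {path I from z to z}) :
  kpath f = (\pi_(pi1 R z) (conn z) * \pi_(pi1 R z) f * (\pi_(pi1 R z) (conn z))^-1)%g.
Proof.
apply: (canRL (mulgK _)); rewrite !pi1M; apply: pi1_eq.
apply: path_homotopic_trans (path_catA _ _ _) _.
apply: path_homotopic_trans (path_cat_homotopic (path_homotopic_refl _) (path_cat_revl _)) _.
exact: path_cat_cstr.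
Qed.

Section HolonomyMorphism.
Variables (G : groupType) (q : X -> X -> G).
Hypothesis qloc : forall x : X, exists2 N : set X, cocycle_on q N & nbhs x N.

Definition holpi (g : pi1 R z) : G := hol q (repr g).

Lemma holpiM : {morph holpi : g h / (g * h)%g}.
Proof.
move=> g h; rewrite -[g]reprK -[h]reprK pi1M /holpi -(hol_cat qloc).
by apply: (hol_homotopic qloc); rewrite !reprK; exact: pi1_repr.
Qed.

Lemma holpi_kpath a b (f : {path I from a to b}) :
  holpi (kpath f) = (hol q (conn a) * hol q f * (hol q (conn b))^-1)%g.
Proof.
rewrite /holpi (hol_homotopic qloc (pi1_repr _)) (hol_cat qloc).
by rewrite (hol_cat qloc) (hol_rev qloc).
Qed.

End HolonomyMorphism.

End Pi1.

(** * Segments and generators of the fundamental group *)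

Section RealContinuity.
Variables (R : realType) (Y : topologicalType).
Implicit Types f g : Y -> R.

Lemma continuous_add f g :
  continuous f -> continuous g -> continuous (fun y => f y + g y).
Proof. by move=> cf cg y; apply: cvgD; [exact: cf|exact: cg]. Qed.

Lemma continuous_sub f g :
  continuous f -> continuous g -> continuous (fun y => f y - g y).
Proof. by move=> cf cg y; apply: cvgB; [exact: cf|exact: cg]. Qed.

Lemma continuous_mul f g :
  continuous f -> continuous g -> continuous (fun y => f y * g y).
Proof. by move=> cf cg y; apply: cvgM; [exact: cf|exact: cg]. Qed.

Lemma continuous_const (r : R) : continuous (fun _ : Y => r).
Proof. by move=> y; exact: cvg_cst. Qed.

End RealContinuity.

Section SetType.
Variables (V : topologicalType) (O : set V).
Local Notation Z := (set_type O).

Lemma set_type_continuous (Y : topologicalType) (f : Y -> Z) :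
  continuous (fun y => \val (f y)) -> continuous f.
Proof.
move=> cf; apply: (@continuous_comp_initial (set_type O) Y V set_val f).
by rewrite set_valE.
Qed.

Lemma set_type_valP (a : Z) : O (\val a).
Proof. by case: a => a /= /set_mem. Qed.

Definition pt (a : V) (Oa : O a) : Z := SigSub (mem_set Oa).

Lemma val_continuous : continuous (fun a : Z => \val a).
Proof. by have := @initial_continuous (set_type O) V set_val; rewrite set_valE. Qed.

End SetType.

Section Segments.
Variables (R : realType) (V : normedModType R) (O : set V).
Local Notation I := (unit_itv R).
Local Notation Z := (set_type O).

Definition segment_convex (N : set V) : Prop :=
  forall (a b : V) (t : R), N a -> N b -> 0 <= t <= 1 -> N ((1 - t) *: a + t *: b).

Lemma comb_continuous (Y : topologicalType) (h : Y -> R) (f g : Y -> V) :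
  continuous h -> continuous f -> continuous g ->
  continuous (fun y => (1 - h y) *: f y + h y *: g y).
Proof.
move=> ch cf cg y; apply: cvgD; apply: cvgZ; [|exact: cf|exact: ch|exact: cg].
by apply: cvgB; [exact: cvg_cst|exact: ch].
Qed.

Lemma straight_homotopic (a b : Z) (f g : {path I from a to b}) (N : I -> set V) :
  (forall s, segment_convex (N s)) -> (forall s, N s `<=` O) ->
  (forall s, N s (\val (f s))) -> (forall s, N s (\val (g s))) ->
  path_homotopic f g.
Proof.
move=> Nc NO Nf Ng.
pose K (su : I * I) : V :=
  (1 - itv_val su.2) *: \val (f su.1) + itv_val su.2 *: \val (g su.1).
have OK su : O (K su) by apply: NO (Nc su.1 _ _ _ _ _ _) => //; exact: itv_val_itv.
have c1 (h : {path I from a to b}) : continuous (fun su : I * I => \val (h su.1)).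
  move=> su; apply: (@continuous_comp _ _ _ (fun su : I * I => h su.1) (fun a : Z => \val a)).
    by apply: (@continuous_comp _ _ _ fst h); [exact: cvg_fst|exact: cts_fun].
  exact: val_continuous.
exists (fun su => pt (OK su)); split=> [|s|s|u|u]; try apply: val_inj; rewrite /= /K /=.
- apply: set_type_continuous; apply: comb_continuous; [|exact: c1|exact: c1].
  by move=> su; apply: continuous_comp; [exact: cvg_snd|exact: itv_val_continuous].
- by rewrite itv_val0 subr0 scale1r scale0r addr0.
- by rewrite itv_val1 subrr scale1r scale0r add0r.
- by rewrite !path_zero -scalerDl subrK scale1r.
- by rewrite !path_one -scalerDl subrK scale1r.
Qed.

Definition segment_in (a b : V) : Prop :=
  forall t : R, 0 <= t <= 1 -> O ((1 - t) *: a + t *: b).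

Section SegmentPath.
Variables (a b : Z) (H : segment_in (\val a) (\val b)).

Definition seg_fun (s : I) : Z := pt (H (itv_val_itv s)).

Lemma seg_continuous : continuous seg_fun.
Proof.
apply: set_type_continuous; apply: comb_continuous.
- exact: itv_val_continuous.
- exact: cst_continuous.
- exact: cst_continuous.
Qed.

Lemma seg_zero : seg_fun zero = a.
Proof. by apply: val_inj; rewrite /= itv_val0 subr0 scale1r scale0r addr0. Qed.

Lemma seg_one : seg_fun one = b.
Proof. by apply: val_inj; rewrite /= itv_val1 subrr scale1r scale0r add0r. Qed.

Definition seg_path : {path I from a to b} :=
  mk_path seg_continuous seg_zero seg_one.

Lemma seg_pathE s :
  \val (seg_path s) = (1 - itv_val s) *: \val a + itv_val s *: \val b.
Proof. by []. Qed.

End SegmentPath.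

Lemma convex_segment_in N a b :
  segment_convex N -> N `<=` O -> N a -> N b -> segment_in a b.
Proof. by move=> Nc NO Na Nb t t01; apply: NO; exact: Nc. Qed.

Variables (z : Z) (conn : forall a, {path I from z to a}).

(* The class of [conn a], then the segment from [a] to [b], then [conn b]
   reversed; a junk value unless the segment lies in [O]. *)
Definition kap (a b : V) : pi1 R z :=
  if pselect (O a) is left Oa then
    if pselect (O b) is left Ob then
      if pselect (segment_in a b) is left H then
        kpath conn (@seg_path (pt Oa) (pt Ob) H)
      else 1%g
    else 1%g
  else 1%g.

Lemma kapE (a b : Z) (H : segment_in (\val a) (\val b)) :
  kap (\val a) (\val b) = kpath conn (seg_path H).
Proof.
rewrite /kap; case: pselect => [Oa|/(_ (set_type_valP a)) //].
case: pselect => [Ob|/(_ (set_type_valP b)) //].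
by case: pselect => [H'|//]; apply: kpath_ext => s; apply: val_inj.
Qed.

(** Both sides come from paths in the convex set [N], which a straight-line homotopy joins: [kap] is
    a cocycle on the convex parts of [O]. *)
Lemma kapM N a b c : segment_convex N -> N `<=` O ->
  N a -> N b -> N c -> (kap a b * kap b c)%g = kap a c.
Proof.
move=> Nc NO Na Nb Nc'.
have [Oa Ob Oc] : [/\ O a, O b & O c] by split; apply: NO.
have Hab := convex_segment_in Nc NO Na Nb.
have Hbc := convex_segment_in Nc NO Nb Nc'.
have Hac := convex_segment_in Nc NO Na Nc'.
rewrite (@kapE (pt Oa) (pt Ob) Hab) (@kapE (pt Ob) (pt Oc) Hbc).
rewrite (@kapE (pt Oa) (pt Oc) Hac) -kpath_cat; apply: kpath_homotopic.
apply: (@straight_homotopic _ _ _ _ (fun=> N)) => // s.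
  by rewrite path_catE; case: ifP => _; rewrite seg_pathE; apply: Nc => //; exact: itv_val_itv.
by rewrite seg_pathE; apply: Nc => //; exact: itv_val_itv.
Qed.

Lemma kap_refl a : kap a a = 1%g.
Proof.
have [Oa|nOa] := pselect (O a); last by rewrite /kap; case: pselect.
have Haa : segment_in a a by move=> t _; rewrite -scalerDl subrK scale1r.
rewrite (@kapE (pt Oa) (pt Oa) Haa); apply: kpath_const => s; apply: val_inj.
by rewrite seg_pathE -scalerDl subrK scale1r.
Qed.

Lemma kapV N a b : segment_convex N -> N `<=` O -> N a -> N b ->
  kap b a = (kap a b)^-1%g.
Proof.
move=> Nc NO Na Nb; apply: (@mulgI _ (kap a b)).
by rewrite (kapM Nc) // kap_refl mulgV.
Qed.

Section Subpath.
Variables (a b : Z) (f : {path I from a to b}).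

Definition mid_fun (t1 t2 : R) (s : I) : Z := f (clamp (t1 + itv_val s * (t2 - t1))).

Lemma mid_continuous t1 t2 : continuous (mid_fun t1 t2).
Proof.
apply: comp_clamp_continuous; first exact: cts_fun.
apply: continuous_add; first exact: continuous_const.
by apply: continuous_mul; [exact: itv_val_continuous|exact: continuous_const].
Qed.

Lemma mid_zero t1 t2 : mid_fun t1 t2 zero = f (clamp t1).
Proof. by rewrite /mid_fun itv_val0 mul0r addr0. Qed.

Lemma mid_one t1 t2 : mid_fun t1 t2 one = f (clamp t2).
Proof. by rewrite /mid_fun itv_val1 mul1r addrC subrK. Qed.

Definition mid_path t1 t2 : {path I from f (clamp t1) to f (clamp t2)} :=
  mk_path (@mid_continuous t1 t2) (mid_zero t1 t2) (mid_one t1 t2).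

Lemma mid_pathE t1 t2 s : mid_path t1 t2 s = f (clamp (t1 + itv_val s * (t2 - t1))).
Proof. by []. Qed.

Lemma mid_cat t1 t2 : 
  path_homotopic (path_cat (mid_path 0 t1) (mid_path t1 t2)) (mid_path 0 t2).
Proof.
pose h (s : I) := if itv_val s <= 1 / 2 then t1 * (2 * itv_val s)
                  else t1 + (2 * itv_val s - 1) * (t2 - t1).
have cv := @itv_val_continuous R.
have c2 : continuous (fun s : I => 2 * itv_val s).
  by apply: continuous_mul; [exact: continuous_const|exact: cv].
apply: (@reparam_homotopic _ _ _ _ _ _ f _ _ h (fun s => itv_val s * t2)).
- apply: continuous_if_le => //.
  + by apply: continuous_mul => //; exact: continuous_const.
  + apply: continuous_add; first exact: continuous_const.
    apply: continuous_mul; last exact: continuous_const.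
    by apply: continuous_sub => //; exact: continuous_const.
  + by move=> s ->; lra.
- by apply: continuous_mul => //; exact: continuous_const.
- by rewrite /h itv_val0 mulr0 ifT; lra.
- by rewrite /h itv_val1 ifF; [lra|apply/negbTE; lra].
- move=> s; rewrite path_catE /h; have := itv_val_itv s.
  by case: ifPn => s2 s01; rewrite mid_pathE clampK; try (congr (f (clamp _))); lra.
- by move=> s; rewrite mid_pathE; congr (f (clamp _)); lra.
Qed.

(** Each piece of the path is homotopic, inside a convex set, to its chord; so the path may be
    replaced by an inscribed polygon. *)
Lemma kpath_chain n : (0 < n)%N ->
  (forall i, (i < n)%N -> exists2 N : set V, segment_convex N /\ N `<=` O &
     forall s, i%:R / n%:R <= s <= i.+1%:R / n%:R -> N (\val (f (clamp s)))) ->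
  kpath conn f = (\prod_(0 <= i < n) kap (\val (grid f n i)) (\val (grid f n i.+1)))%g.
Proof.
move=> n0 Hn; have nR : 0 < n%:R :> R by rewrite ltr0n.
have f1 : kpath conn f = kpath conn (mid_path 0 (n%:R / n%:R)).
  apply: kpath_ext => s; rewrite mid_pathE divff ?gt_eqF // subr0 mulr1 add0r.
  by rewrite itv_valK.
rewrite f1; suff H m : (m <= n)%N -> kpath conn (mid_path 0 (m%:R / n%:R)) =
    (\prod_(0 <= i < m) kap (\val (grid f n i)) (\val (grid f n i.+1)))%g.
  exact: H.
elim: m => [|m IH] mn.
  rewrite big_geq //; apply: kpath_const => s.
  by rewrite mid_pathE mul0r subrr mulr0 addr0.
rewrite big_nat_recr //= -IH 1?ltnW //.
have [N [Nc NO] HN] := Hn m mn.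
have mm : m%:R / n%:R <= m.+1%:R / n%:R :> R.
  by rewrite ler_pM2r ?invr_gt0 // ler_nat.
have Nm : N (\val (grid f n m)) by apply: HN; rewrite lexx mm.
have Nm1 : N (\val (grid f n m.+1)) by apply: HN; rewrite lexx mm.
rewrite (kapE (convex_segment_in Nc NO Nm Nm1)) -kpath_cat.
rewrite -(kpath_homotopic conn (mid_cat (m%:R / n%:R) _)) !kpath_cat; congr (_ * _)%g.
apply: kpath_homotopic; apply: (@straight_homotopic _ _ _ _ (fun=> N)) => // s.
  rewrite mid_pathE; apply: HN; have := itv_val_itv s.
  move: (itv_val s) => r /andP[r0 r1]; apply/andP; split.
    by rewrite lerDl mulr_ge0 // subr_ge0.
  by rewrite -lerBrDl ler_piMl // subr_ge0.
by rewrite seg_pathE; apply: Nc => //; exact: itv_val_itv.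
Qed.

End Subpath.

End Segments.

Section Generation.
Variables (R : realType) (V : normedModType R) (O : set V).
Local Notation I := (unit_itv R).
Local Notation Z := (set_type O).
Variables (z : Z) (conn : forall a, {path I from z to a}).
Local Notation kap := (kap conn).
Local Open Scope group_scope.

Variables (B : set (set V)) (D : set V).
Hypothesis Bopen : forall N, B N -> open N.
Hypothesis Bconvex : forall N, B N -> segment_convex N.
Hypothesis Bsub : forall N, B N -> N `<=` O.
Hypothesis Bcover : forall a, O a -> exists2 N, B N & N a.
Hypothesis Ddense : forall N, open N -> N `&` O !=set0 -> exists2 a, D a & N a.

(* The gauge [c] need only be given on the dense set [D]: the vertices of a
   fine polygon are moved into [D] inside the pieces of the cover. *)
Lemma pi1_generated (S : set (pi1 R z)) (c : V -> pi1 R z) :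
  is_subgroup S ->
  (forall N a b, B N -> N a -> N b -> D a -> D b ->
     S (c a * kap a b * (c b)^-1)) ->
  exists t, forall g, S (t * g * t^-1).
Proof.
move=> [S1 SM SV] Sc.
have [B0 BB0 B0z] := Bcover (set_type_valP z).
have [a0 Da0 B0a0] : exists2 a, D a & B0 a.
  by apply: Ddense; [exact: Bopen|exists (\val z); split=> //; exact: set_type_valP].
(* [t0] compares the gauge at a generic point [a0] near the base point with the base point itself;
   [k0] corrects for [conn z] not being constant. *)
pose t0 := c a0 * kap a0 (\val z).
pose k0 : pi1 R z := \pi_(pi1 R z) (conn z).
exists (t0 * k0) => g; rewrite -[g]reprK; set f := repr g.
have Ccov (a : Z) : exists2 N : set Z,
    [set N : set Z | exists2 M, B M & N = [set x | M (\val x)]] N & nbhs a N.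
  have [M BM Ma] := Bcover (set_type_valP a).
  exists [set x | M (\val x)]; first by exists M.
  by apply: (@val_continuous _ O); apply: open_nbhs_nbhs; split=> //; exact: Bopen.
have [n n0 fn] := path_subdivision (@cts_fun _ _ f) Ccov.
pose u i : V := \val (grid f n i).
have u0 : u 0%N = \val z by rewrite /u /grid mul0r; congr (\val _); exact: (@path_zero _ _ _ _ f).
have un : u n = \val z.
  rewrite /u /grid divff; first by congr (\val _); exact: (@path_one _ _ _ _ f).
  by rewrite pnatr_eq0 -lt0n.
have Nu i : (i < n)%N -> exists2 N, B N & N (u i) /\ N (u i.+1).
  move=> ltin; have [_ [N BN ->] HN] := fn i ltin; exists N => //.
  have le_i : (i%:R / n%:R <= i.+1%:R / n%:R :> R)%R.
    by rewrite ler_pM2r ?invr_gt0 ?ltr0n // ler_nat.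
  by split; apply: HN; rewrite lexx le_i.
have fE : kpath conn f = \prod_(0 <= i < n) kap (u i) (u i.+1).
  apply: kpath_chain => // i ltin; have [_ [N BN ->] HN] := fn i ltin.
  by exists N => //; split; [exact: Bconvex|exact: Bsub].
have kM N a b d : B N -> N a -> N b -> N d -> kap a b * kap b d = kap a d.
  by move=> BN; apply: kapM; [exact: Bconvex|exact: Bsub].
(* The vertex [x] need not lie in [D]: the path from [a] to [b] is rerouted through a point [d] of
   [D] common to the two pieces. *)
have chain N N' x a b : B N -> B N' -> N x -> N' x -> N a -> D a -> N' b -> D b ->
    S (c a * kap a x * kap x b * (c b)^-1).
  move=> BN BN' Nx Nx' Na Da Nb Db.
  have [d Dd [Nd Nd']] : exists2 d, D d & (N `&` N') d.
    apply: Ddense; first by apply: openI; exact: Bopen.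
    by exists x; split=> //; exact: Bsub Nx.
  rewrite -(kM _ _ _ _ BN' Nx' Nd' Nb) -(kM _ _ _ _ BN Na Nd Nx).
  have -> : c a * (kap a d * kap d x) * (kap x d * kap d b) * (c b)^-1 =
      (c a * kap a d * (c d)^-1) * (c d * kap d b * (c b)^-1).
    rewrite !mulgA mulgVK; congr (_ * _ * _).
    by rewrite -(mulgA _ (kap d x)) (kM _ _ _ _ BN) // kap_refl mulg1.
  by apply: SM; [apply: (Sc N)|apply: (Sc N')].
(* The product up to the vertex [u m] falls into [S] once it is continued to a point of [D] in a
   piece containing that vertex. *)
have main m : (m <= n)%N -> forall N a, B N -> N (u m) -> N a -> D a ->
    S (t0 * \prod_(0 <= i < m) kap (u i) (u i.+1) * kap (u m) a * (c a)^-1).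
  elim: m => [|m IH] mn N a BN Num Na Da.
    by rewrite big_geq // mulg1 u0; apply: (chain B0 N) => //; rewrite -u0.
  have [N' BN' [Nm' Nm1']] := Nu m mn.
  have [d Dd [Nd Nd']] : exists2 d, D d & (N `&` N') d.
    apply: Ddense; first by apply: openI; exact: Bopen.
    by exists (u m.+1); split=> //; exact: Bsub Num.
  have := SM _ _ (IH (ltnW mn) N' d BN' Nm' Nd' Dd) (Sc N d a BN Nd Na Dd Da).
  rewrite big_nat_recr //=; congr S.
  rewrite -!mulgA; congr (_ * (_ * _)); rewrite mulKg !mulgA; congr (_ * _).
  by rewrite -(kM _ _ _ _ BN' Nm' Nm1' Nd') -!mulgA (kM _ _ _ _ BN).
have := main n (leqnn n) B0 a0 BB0; rewrite un => /(_ B0z B0a0 Da0).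
rewrite -fE kpath_loop -/k0; congr S.
rewrite (kapV conn (Bconvex BB0) (@Bsub _ BB0) B0a0 B0z).
by rewrite reprK invgM /t0 invgM !mulgA.
Qed.

End Generation.

(** * The complement of a complexified real affine arrangement *)

Lemma near_forall_fin (T : finType) (V : Type) (F : set_system V)
    (P : T -> V -> Prop) : Filter F ->
  (forall c, \forall v \near F, P c v) -> \forall v \near F, forall c, P c v.
Proof.
move=> FF FP; suff H (s : seq T) : \forall v \near F, forall c, c \in s -> P c v.
  by apply: filterS (H (enum T)) => v Pv c; apply: Pv; rewrite mem_enum.
elim: s => [|c s IH]; first by apply: nearW.
apply: filterS2 (FP c) IH => v Pcv Psv d; rewrite inE => /orP[/eqP ->//|].
exact: Psv.
Qed.

Lemma segment_convex_ball (R : realType) (V : normedModType R) (x : V) (r : R) :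
  segment_convex (ball x r).
Proof.
move=> a b t; rewrite -!ball_normE /ball_ /= => xa xb /andP[t0 t1].
have -> : x - ((1 - t) *: a + t *: b) = (1 - t) *: (x - a) + t *: (x - b).
  by rewrite !scalerBr addrACA -scalerDl subrK scale1r opprD.
apply: le_lt_trans (ler_normD _ _) _; rewrite !normrZ !ger0_norm ?subr_ge0 //.
move: xa xb; set u := `|x - a|; set v := `|x - b| => xa xb.
have [->|tn0] := eqVneq t 0; first by rewrite subr0 mul1r mul0r addr0.
have tp : 0 < t by rewrite lt_neqAle eq_sym tn0.
have h1 : (1 - t) * u <= (1 - t) * r by rewrite ler_wpM2l ?subr_ge0 // ltW.
have h2 : t * v < t * r by rewrite ltr_pM2l.
by apply: (lt_le_trans (ler_ltD h1 h2)); rewrite -mulrDl subrK mul1r.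
Qed.

Section RealArrangement.
Variables (R : realType) (T : finType) (m q : T -> R).
Local Notation V := ((R * R) * (R * R))%type.
Implicit Types (x y : R * R) (c : T).

Definition lform c x : R := x.2 - m c * x.1 - q c.
Definition dform c y : R := y.2 - m c * y.1.

(* [(x, y)] stands for the point of [C^2] with real part [x] and imaginary
   part [y]; the line [c] is [X2 = m c * X1 + q c]. *)
Definition arrangement_space : set V :=
  [set z | forall c, (lform c z.1 != 0) || (dform c z.2 != 0)].
Local Notation O := arrangement_space.

Definition genx x : Prop := forall c, lform c x != 0.
Definition geny y : Prop := forall c, dform c y != 0.

Lemma lform_comb c (t : R) x x' :
  lform c ((1 - t) *: x + t *: x') = (1 - t) * lform c x + t * lform c x'.
Proof. by rewrite /lform /= /GRing.scale /=; ring. Qed.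

Lemma dform_comb c (t : R) y y' :
  dform c ((1 - t) *: y + t *: y') = (1 - t) * dform c y + t * dform c y'.
Proof. by rewrite /dform /= /GRing.scale /=; ring. Qed.

Lemma coordinates_continuous : [/\ continuous (fun z : V => z.1.1),
  continuous (fun z : V => z.1.2), continuous (fun z : V => z.2.1) &
  continuous (fun z : V => z.2.2)].
Proof.
have f1 : continuous (fun z : V => z.1) by move=> z; exact: cvg_fst.
have f2 : continuous (fun z : V => z.2) by move=> z; exact: cvg_snd.
have g1 : continuous (fun x : R * R => x.1) by move=> x; exact: cvg_fst.
have g2 : continuous (fun x : R * R => x.2) by move=> x; exact: cvg_snd.
split=> z.
- exact: (continuous_comp (f1 z) (g1 z.1)).
- exact: (continuous_comp (f1 z) (g2 z.1)).
- exact: (continuous_comp (f2 z) (g1 z.2)).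
- exact: (continuous_comp (f2 z) (g2 z.2)).
Qed.

Lemma lform_continuous c : continuous (fun z : V => lform c z.1).
Proof.
have [c1 c2 _ _] := coordinates_continuous.
apply: continuous_sub; last exact: continuous_const.
by apply: continuous_sub => //; apply: continuous_mul => //; exact: continuous_const.
Qed.

Lemma dform_continuous c : continuous (fun z : V => dform c z.2).
Proof.
have [_ _ c1 c2] := coordinates_continuous.
by apply: continuous_sub => //; apply: continuous_mul => //; exact: continuous_const.
Qed.

Lemma near_neq0 (X : topologicalType) (f : X -> R) (a : X) :
  continuous f -> f a != 0 -> \forall b \near a, f b != 0.
Proof.
by move=> cf fa; apply: (cf a [set r | r != 0]); apply: open_nbhs_nbhs; split=> //.
Qed.

Lemma arrangement_space_open : open O.
Proof.
rewrite openE => z Oz.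
apply: (@near_forall_fin T V (nbhs z)
  (fun c w => (lform c w.1 != 0) || (dform c w.2 != 0))) => c.
have /orP[lz|dz] := Oz c.
  by apply: filterS (near_neq0 (@lform_continuous c) lz) => w ->.
by apply: filterS (near_neq0 (@dform_continuous c) dz) => w ->; rewrite orbT.
Qed.

(** Products are used because with [(x, y)] and [(x', y')] they also contain the corner [(x', y)],
    which splits a segment into a move of the real part and one of the imaginary part. *)
Definition box (N : set V) : Prop := exists A C : set (R * R),
  [/\ N = A `*` C, open A, open C, segment_convex A /\ segment_convex C & N `<=` O].

Lemma box_open N : box N -> open N.
Proof.
move=> [A [C [-> oA oC _ _]]]; rewrite openE => z [Az Cz].
by exists (A, C) => //; split; exact: open_nbhs_nbhs.
Qed.

Lemma segment_convexX (A C : set (R * R)) :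
  segment_convex A -> segment_convex C -> segment_convex (A `*` C).
Proof. by move=> Ac Cc a b t [a1 a2] [b1 b2] t01; split; [exact: Ac|exact: Cc]. Qed.

Lemma box_convex N : box N -> segment_convex N.
Proof. by move=> [A [C [-> _ _ [Ac Cc] _]]]; exact: segment_convexX. Qed.

Lemma box_sub N : box N -> N `<=` O.
Proof. by move=> [A [C []]]. Qed.

Lemma box_cover a : O a -> exists2 N, box N & N a.
Proof.
move=> Oa; have /nbhs_ballP[r /= r0 aO] : nbhs a O.
  by apply: open_nbhs_nbhs; split=> //; exact: arrangement_space_open.
exists (ball a.1 r `*` ball a.2 r); last by split; exact: ballxx.
exists (ball a.1 r), (ball a.2 r); split=> //; try exact: ball_open.
  by split; exact: segment_convex_ball.
Qed.

Definition gen_pt : set V := [set z | genx z.1 /\ geny z.2].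

(** Adding [e] to the second coordinates adds [e] to every [lform] and every [dform], so each form
    excludes at most one value of [e]. *)
Lemma gen_pt_dense N : open N -> N `&` O !=set0 -> exists2 a, gen_pt a & N a.
Proof.
move=> oN [a [Na _]].
pose h (e : R) : V := ((a.1.1, a.1.2 + e), (a.2.1, a.2.2 + e)).
have ch : h e @[e --> (0 : R)] --> h 0.
  have ce (b : R) : (b + e)%R @[e --> (0 : R)] --> b + 0.
    by apply: cvgD; [exact: cvg_cst|exact: cvg_id].
  apply: (@cvg_pair _ _ _ _ (nbhs _) (nbhs _)); apply: (@cvg_pair _ _ _ _ (nbhs _) (nbhs _));
    by [exact: cvg_cst|exact: ce].
have h0 : h 0 = a by rewrite /h !addr0; case: (a) => [[? ?] [? ?]].
have Nh : \forall e \near (0 : R)^'+, N (h e).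
  apply: cvg_at_right_filter ch _ _; rewrite h0; exact: open_nbhs_nbhs.
have shift (b : R) : \forall e \near (0 : R)^'+, b + e != 0.
  have [->|b0] := eqVneq b 0.
    by near=> e; rewrite add0r gt_eqF //.
  apply: cvg_at_right_filter; last by apply: (@near_neq0 _ (fun e => b + e) 0); rewrite ?addr0 // => e; apply: cvgD; [exact: cvg_cst|exact: cvg_id].
  exact: cvg_id.
have gx : \forall e \near (0 : R)^'+, forall c, lform c (h e).1 != 0.
  apply: near_forall_fin => c; apply: filterS (shift (lform c a.1)) => e.
  by rewrite /lform /= !(addrAC _ e).
have gy : \forall e \near (0 : R)^'+, forall c, dform c (h e).2 != 0.
  apply: near_forall_fin => c; apply: filterS (shift (dform c a.2)) => e.
  by rewrite /dform /= (addrAC _ e).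
near (0 : R)^'+ => e; exists (h e).
  by split; near: e.
by near: e.
Unshelve. all: by end_near.
Qed.

End RealArrangement.

Lemma mulg_telescope (G : groupType) (a b c k l : G) :
  (a * k * b^-1 * (b * l * c^-1) = a * (k * l) * c^-1)%g.
Proof. by rewrite !mulgA mulgVK. Qed.

Section ArrangementGroup.
Variables (R : realType) (T : finType) (m q : T -> R).
Local Notation V := ((R * R) * (R * R))%type.
Local Notation I := (unit_itv R).
Local Notation O := (arrangement_space m q).
Local Notation Z := (set_type O).
Local Notation lform := (lform m q).
Local Notation dform := (dform m).
Local Notation genx := (genx m q).
Local Notation geny := (geny m).
Implicit Types (x y : R * R) (c : T).

(** [down] and [up] are imaginary parts at which all [dform] have the same sign; they exist because
    no line is vertical. *)
Definition down : R * R := (0, -1).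
Definition up : R * R := (0, 1).

Lemma dform_down c : dform c down = -1.
Proof. by rewrite /dform /= mulr0 subr0. Qed.

Lemma dform_up c : dform c up = 1.
Proof. by rewrite /dform /= mulr0 subr0. Qed.

Lemma geny_down : geny down.
Proof. by move=> c; rewrite dform_down oppr_eq0 oner_eq0. Qed.

Lemma geny_up : geny up.
Proof. by move=> c; rewrite dform_up oner_eq0. Qed.

Lemma genx_exists : exists x, genx x.
Proof.
have [|a [ga _] _] := @gen_pt_dense R T m q setT openT; last by exists a.1.
by exists ((0, 0), down); split=> // c; rewrite geny_down orbT.
Qed.

Lemma horizontal_sub y : geny y -> setT `*` [set y] `<=` O.
Proof. by move=> gy [x _] [_ /= ->] c; rewrite gy orbT. Qed.

Lemma vertical_sub x : genx x -> [set x] `*` setT `<=` O.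
Proof. by move=> gx [_ y] [/= -> _] c; rewrite gx. Qed.

Lemma segment_convexT : segment_convex (@setT (R * R)).
Proof. by []. Qed.

Lemma segment_convex1 x : segment_convex [set x].
Proof. by move=> _ _ t -> -> _; rewrite /= -scalerDl subrK scale1r. Qed.

Lemma horizontal_convex y : segment_convex (@setT (R * R) `*` [set y]).
Proof. exact: segment_convexX segment_convexT (@segment_convex1 y). Qed.

Lemma vertical_convex x : segment_convex ([set x] `*` @setT (R * R)).
Proof. exact: segment_convexX (@segment_convex1 x) segment_convexT. Qed.

(** Any point reaches a generic one inside a box; from there the imaginary part moves freely to
    [down], and then the real part to [x0]. *)
Lemma arrangement_connected (z a : Z) : exists f : {path I from z to a}, True.
Proof.
have [x0 gx0] := genx_exists.
have Ob : O (x0, down) by move=> c; rewrite gx0.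
suff base (b : Z) : exists f : {path I from b to pt Ob}, True.
  have [f _] := base z; have [g _] := base a.
  by exists (path_cat f (path_rev g)).
have seg (u v : Z) N : segment_convex N -> N `<=` O -> N (\val u) -> N (\val v) ->
    exists f : {path I from u to v}, True.
  by move=> Nc NO Nu Nv; exists (seg_path (convex_segment_in Nc NO Nu Nv)).
have [N bN Nb] := box_cover (set_type_valP b).
have [[x y] [/= gx gy] Nxy] : exists2 d, gen_pt m q d & N d.
  apply: gen_pt_dense; first exact: box_open bN.
  by exists (\val b); split=> //; exact: set_type_valP.
have Oxy : O (x, y) by move=> c; rewrite gx.
have Oxd : O (x, down) by move=> c; rewrite gx.
have [f _] := seg b (pt Oxy) N (box_convex bN) (box_sub bN) Nb Nxy.
have [||g _] := seg (pt Oxy) (pt Oxd) _ (@vertical_convex x) (vertical_sub gx) => //.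
have [||h _] := seg (pt Oxd) (pt Ob) _ (@horizontal_convex down) (horizontal_sub geny_down) => //.
by exists (path_cat f (path_cat g h)).
Qed.

Variable z : Z.

Definition conn (a : Z) : {path I from z to a} :=
  projT1 (cid (arrangement_connected z a)).

Local Notation kap := (kap conn).
Local Notation Gamma := (pi1 R z).
Local Open Scope group_scope.

Lemma kap_horizontal y x x' x'' : geny y ->
  kap (x, y) (x', y) * kap (x', y) (x'', y) = kap (x, y) (x'', y).
Proof. by move=> gy; apply: kapM (@horizontal_convex y) (horizontal_sub gy) _ _ _. Qed.

Lemma kap_vertical x y y' y'' : genx x ->
  kap (x, y) (x, y') * kap (x, y') (x, y'') = kap (x, y) (x, y'').
Proof. by move=> gx; apply: kapM (@vertical_convex x) (vertical_sub gx) _ _ _. Qed.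

Variable x0 : R * R.
Hypothesis gx0 : genx x0.

(** The gauge fed to [pi1_generated]: the real part is placed while the imaginary part is still at
    [down]. *)
Definition access x y : Gamma := kap (x0, down) (x, down) * kap (x, down) (x, y).

(* At a height [y] on no line [dform c = 0] the real part moves freely; the
   result depends only on which lines separate [x] from [x'] and on the signs of
   [dform c y] for these lines, and it is trivial at height [down]. *)
Definition xmove y x x' : Gamma := access x y * kap (x, y) (x', y) * (access x' y)^-1.

Lemma access_vertical x y y' : genx x -> access x y * kap (x, y) (x, y') = access x y'.
Proof. by move=> gx; rewrite /access -mulgA kap_vertical. Qed.

Lemma xmoveM y x x' x'' : geny y -> xmove y x x' * xmove y x' x'' = xmove y x x''.
Proof. by move=> gy; rewrite /xmove mulg_telescope kap_horizontal. Qed.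

Lemma xmove_refl y x : xmove y x x = 1.
Proof. by rewrite /xmove kap_refl mulg1 mulgV. Qed.

Lemma xmoveV y x x' : geny y -> xmove y x' x = (xmove y x x')^-1.
Proof. by move=> gy; apply: (@mulgI _ (xmove y x x')); rewrite xmoveM // xmove_refl mulgV. Qed.

Lemma xmove_down x x' : xmove down x x' = 1.
Proof.
rewrite /xmove /access !kap_refl !mulg1 kap_horizontal ?mulgV //.
exact: geny_down.
Qed.

(** Let [A] fix the side of every line that does not separate [x] from [x'], and [C] the sign of
    [dform] for every line that does. The product of [A] and [C] is convex, avoids all lines and
    contains the four points with real part [x] or [x'] and imaginary part [y] or [y']. *)
Lemma xmove_sep y y' x x' : genx x -> genx x' -> geny y -> geny y' ->
  (forall c, (0 < lform c x) != (0 < lform c x') ->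
     (0 < dform c y) = (0 < dform c y')) ->
  xmove y x x' = xmove y' x x'.
Proof.
move=> gx gx' gy gy' sep.
pose sg c := (0 < lform c x) == (0 < lform c x').
pose A : set (R * R) := [set w | forall c, sg c -> 0 < lform c x * lform c w]%R.
pose C : set (R * R) := [set w | forall c, ~~ sg c -> 0 < dform c y * dform c w]%R.
have pos_comb (t u v : R) : (0 < u -> 0 < v -> 0 <= t <= 1 -> 0 < (1 - t) * u + t * v)%R.
  move=> u0 v0 /andP[t0 t1]; have [->|tn0] := eqVneq t 0%R; first by rewrite subr0 mul1r mul0r addr0.
  apply: ltr_wpDl; first by rewrite mulr_ge0 ?subr_ge0 // ltW.
  by rewrite mulr_gt0 // lt_neqAle eq_sym tn0.
have Ac : segment_convex A.
  move=> a b t Aa Ab t01 c sc; rewrite lform_comb mulrDr !(mulrCA (lform c x)).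
  by apply: pos_comb => //; [exact: Aa|exact: Ab].
have Cc : segment_convex C.
  move=> a b t Aa Ab t01 c sc; rewrite dform_comb mulrDr !(mulrCA (dform c y)).
  by apply: pos_comb => //; [exact: Aa|exact: Ab].
have ACO : A `*` C `<=` O.
  move=> [a b] [/= Aa Cb] c; have [sc|nsc] := boolP (sg c).
    by apply/orP; left; apply: contraTneq (Aa c sc) => ->; rewrite mulr0 ltxx.
  by apply/orP; right; apply: contraTneq (Cb c nsc) => ->; rewrite mulr0 ltxx.
have same (u v : R) : (u != 0 -> v != 0 -> (0 < u) = (0 < v) -> 0 < u * v)%R.
  rewrite !neq_lt => /orP[u0|u0] /orP[v0|v0]; rewrite ?u0 ?v0 ?(lt_gtF u0) ?(lt_gtF v0) // => _.
    by rewrite nmulr_rgt0.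
  by rewrite mulr_gt0.
have Ax : A x by move=> c _; apply: same.
have Ax' : A x' by move=> c /eqP sc; apply: same.
have Cy : C y by move=> c _; apply: same.
have Cy' : C y' by move=> c nsc; apply: same => //; exact: sep.
have k1 a b d : (A `*` C) a -> (A `*` C) b -> (A `*` C) d -> kap a b * kap b d = kap a d.
  exact: kapM (segment_convexX Ac Cc) ACO.
have e : kap (x, y) (x', y) * kap (x', y) (x', y') = kap (x, y) (x, y') * kap (x, y') (x', y').
  by rewrite !k1.
rewrite /xmove -(access_vertical y y' gx) -(access_vertical y y' gx').
move: (access x y) (access x' y) => a b.
by rewrite invgM !mulgA -(mulgA a _ (kap (x, y') _)) -e !mulgA mulgK.
Qed.

Lemma xmove_generated : forall g : Gamma,
  gen [set h | exists y x x', [/\ geny y, genx x, genx x' & h = xmove y x x']] g.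
Proof.
set D := [set h | _] => g.
have Dbox (N : set V) (a b : V) : box m q N -> N a -> N b ->
    gen_pt m q a -> gen_pt m q b ->
    gen D (access a.1 a.2 * kap a b * (access b.1 b.2)^-1).
  case: a b => [x y] [x' y'] bN Nxy Nxy' [/= gx gy] [/= gx' gy'].
  apply: sub_gen; exists y, x, x'; split=> //=.
  (* Through this corner the segment becomes a move of the real part followed by one of the
     imaginary part, and the gauge absorbs the latter. *)
  have Nm : N (x', y) by case: bN Nxy Nxy' => [A [C [-> _ _ _ _]]] [/= ? ?] [].
  have kM a b d := @kapM _ _ _ _ conn N a b d (box_convex bN) (box_sub bN).
  rewrite -(kM _ _ _ Nxy Nm Nxy') -(access_vertical y y' gx') invgM /xmove.
  move: (access x y) (access x' y) => a b.
  by rewrite !mulgA mulgK.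
have [t tP] := pi1_generated (@box_open R T m q) (@box_convex R T m q)
  (@box_sub R T m q) (@box_cover R T m q) (@gen_pt_dense R T m q)
  (gen_subgroup D) Dbox.
(* The conjugation by [t] is undone by applying the result to a conjugate of [g]. *)
by have := tP (t^-1 * g * t); rewrite !mulgA mulgV mul1g mulgK.
Qed.

End ArrangementGroup.

(** * Morphisms defined by cuts *)

Section CutMorphism.
Variables (R : realType) (T : finType) (m q : T -> R).
Local Notation V := ((R * R) * (R * R))%type.
Local Notation I := (unit_itv R).
Local Notation O := (arrangement_space m q).
Local Notation Z := (set_type O).
Local Notation genx := (genx m q).
Local Notation geny := (geny m).
Local Notation down := (down R).
Variables (J : finType) (s : V -> R) (phi : J -> V -> R).
Variables (G : groupType) (h : {set J} -> G).
Hypothesis cs : continuous s.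
Hypothesis cphi : forall j, continuous (phi j).
Hypothesis phi_neq0 : forall a, O a -> s a = 0 -> forall j, phi j a != 0.

Definition cut_label (a : V) : {set J} := [set j | 0 < phi j a].

(* The space is cut along [s = 0], which the nonvanishing functions [phi] divide
   into pieces; crossing the piece labelled [l] contributes [h l]. *)
Definition cut_weight (l : {set J}) (a : V) : G := if s a < 0 then h l else 1%g.

(** The label of [a] serves both end points: near the cut labels are locally constant, and away from
    it, where they may jump, nearby points lie on the same side and the weights cancel. *)
Definition cut_cocycle (a b : Z) : G :=
  ((cut_weight (cut_label (\val a)) (\val a))^-1 *
   cut_weight (cut_label (\val a)) (\val b))%g.
Local Notation qc := cut_cocycle.

Definition cut_small (N : set Z) : Prop :=
  (forall a b, N a -> N b -> (s (\val a) < 0) = (s (\val b) < 0)) \/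
  (forall a b, N a -> N b -> cut_label (\val a) = cut_label (\val b)).

Lemma cut_cocycle_same (a b : Z) :
  (s (\val a) < 0) = (s (\val b) < 0) -> qc a b = 1%g.
Proof. by move=> ab; rewrite /qc /cut_weight ab mulVg. Qed.

Lemma cut_small_cocycle N : cut_small N -> cocycle_on qc N.
Proof.
move=> [Ns|Nl] a b c Na Nb Nc.
  by rewrite !cut_cocycle_same ?mulg1 //; exact: Ns.
by rewrite /qc (Nl b a Nb Na) mulgA mulgK.
Qed.

Lemma near_lt0 (X : topologicalType) (f : X -> R) (a : X) :
  continuous f -> f a < 0 -> \forall b \near a, f b < 0.
Proof.
by move=> cf fa; apply: (cf a [set r | r < 0]); apply: open_nbhs_nbhs; split=> //.
Qed.

Lemma near_gt0 (X : topologicalType) (f : X -> R) (a : X) :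
  continuous f -> 0 < f a -> \forall b \near a, 0 < f b.
Proof.
by move=> cf fa; apply: (cf a [set r | 0 < r]); apply: open_nbhs_nbhs; split=> //.
Qed.

Lemma cut_small_nbhs (a : Z) : exists2 N : set Z, cut_small N & nbhs a N.
Proof.
have cval (f : V -> R) : continuous f -> continuous (fun b : Z => f (\val b)).
  by move=> cf b; apply: continuous_comp; [exact: val_continuous|exact: cf].
have [sa|sa|sa] := ltgtP (s (\val a)) 0.
- exists [set b | s (\val b) < 0]; last exact: near_lt0 (cval _ cs) sa.
  by left=> b c /= -> ->.
- exists [set b | 0 < s (\val b)]; last exact: near_gt0 (cval _ cs) sa.
  by left=> b c /= sb sc; rewrite (lt_gtF sb) (lt_gtF sc).
- exists [set b | cut_label (\val b) = cut_label (\val a)].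
    by right=> b c /= -> ->.
  have H : \forall b \near a, forall j, (0 < phi j (\val b)) = (0 < phi j (\val a)).
    apply: (@near_forall_fin J Z (nbhs a) (fun j b => (0 < phi j (\val b)) = (0 < phi j (\val a)))) => j.
    have := phi_neq0 (set_type_valP a) sa j; rewrite neq_lt => /orP[pa|pa].
      apply: filterS (near_lt0 (cval _ (cphi (j := j))) pa) => b pb.
      by rewrite (lt_gtF pa) (lt_gtF pb).
    by apply: filterS (near_gt0 (cval _ (cphi (j := j))) pa) => b ->; rewrite pa.
  by apply: filterS H => b Hb; apply/setP => j; rewrite !inE Hb.
Qed.

Lemma cut_local (a : Z) : exists2 N : set Z, cocycle_on qc N & nbhs a N.
Proof. by have [N /cut_small_cocycle] := cut_small_nbhs a; exists N. Qed.

Lemma hol_cut (f : I -> Z) (l : {set J}) : continuous f ->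
  (forall t, s (\val (f t)) = 0 -> cut_label (\val (f t)) = l) ->
  hol qc f = ((cut_weight l (\val (f zero)))^-1 * cut_weight l (\val (f one)))%g.
Proof.
move=> cf fl; have [n n0 fn] := path_subdivision cf cut_small_nbhs.
have fine_n : fine qc f n.
  by move=> i ltin; have [N /cut_small_cocycle] := fn i ltin; exists N.
rewrite (holE n0 fine_n) /hprod.
have piece i : (i < n)%N -> qc (grid f n i) (grid f n i.+1) =
    ((cut_weight l (\val (grid f n i)))^-1 * cut_weight l (\val (grid f n i.+1)))%g.
  move=> ltin; have [N sN HN] := fn i ltin.
  have le_i : i%:R / n%:R <= i.+1%:R / n%:R :> R.
    by rewrite ler_pM2r ?invr_gt0 ?ltr0n // ler_nat.
  have Ni : N (grid f n i) by apply: HN; rewrite lexx le_i.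
  have Ni1 : N (grid f n i.+1) by apply: HN; rewrite lexx le_i.
  have same : (s (\val (grid f n i)) < 0) = (s (\val (grid f n i.+1)) < 0) ->
      qc (grid f n i) (grid f n i.+1) =
      ((cut_weight l (\val (grid f n i)))^-1 * cut_weight l (\val (grid f n i.+1)))%g.
    by move=> e; rewrite cut_cocycle_same // /cut_weight e mulVg.
  case: sN => [/(_ _ _ Ni Ni1) /same //|Nl].
  have [/same//|diff] := eqVneq (s (\val (grid f n i)) < 0) (s (\val (grid f n i.+1)) < 0).
  (* The ends lie on different sides, so by the intermediate value theorem the piece meets the cut,
     where the label is [l]; labels being constant on the piece, [l] is also the label at its
     start. *)
  pose k (t : R) := s (\val (f (clamp t))).
  have ck : continuous k.
    move=> t; apply: (@continuous_comp _ _ _ (fun t => \val (f (clamp t))) s); last exact: cs.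
    apply: (@continuous_comp _ _ _ (fun t => f (clamp t)) (fun a : Z => \val a)); last exact: val_continuous.
    by apply: continuous_comp; [exact: clamp_continuous|exact: cf].
  have [||t ti kt] := @IVT R k (i%:R / n%:R) (i.+1%:R / n%:R) 0 le_i.
  - exact: continuous_subspaceT.
  - move: diff; rewrite /grid -!/(k _).
    move: (k (i%:R / n%:R)) (k (i.+1%:R / n%:R)) => u v.
    by case: (ltP u 0) => ?; case: (ltP v 0) => ?; case: (ltP u v) => ? //= _; apply/andP; split; lra.
  have Nt : N (f (clamp t)) by apply: HN; rewrite in_itv in ti.
  by rewrite /qc (Nl _ _ Ni Nt) (fl _ kt).
transitivity (\prod_(0 <= i < n) ((cut_weight l (\val (grid f n i)))^-1 *
    cut_weight l (\val (grid f n i.+1))))%g.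
  by apply: eq_big_nat => i /andP[_]; exact: piece.
have tele k : (\prod_(0 <= i < k) ((cut_weight l (\val (grid f n i)))^-1 *
    cut_weight l (\val (grid f n i.+1))))%g =
    ((cut_weight l (\val (grid f n 0)))^-1 * cut_weight l (\val (grid f n k)))%g.
  elim: k => [|k IH]; first by rewrite big_geq // mulVg.
  by rewrite big_nat_recr //= IH mulgA mulgK.
rewrite tele /grid mul0r divff //.
by rewrite pnatr_eq0 -lt0n.
Qed.

Variables (lamx lamy : R * R -> {set J}).
Hypothesis lamxP : forall x y, genx x -> s (x, y) = 0 -> cut_label (x, y) = lamx x.
Hypothesis lamyP : forall x y, geny y -> s (x, y) = 0 -> cut_label (x, y) = lamy y.

Variables (z : Z) (x0 : R * R).
Local Notation conn := (conn z).
Local Notation kap := (kap conn).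
Local Notation hp := (@holpi R _ z G qc).
Local Open Scope group_scope.

Definition cut_base (a : V) : G :=
  if pselect (O a) is left Oa then hol qc (conn (pt Oa)) else 1.

Lemma cut_kap N (a b : V) (l : {set J}) :
  segment_convex N -> N `<=` O -> N a -> N b ->
  (forall c, N c -> s c = 0 -> cut_label c = l) ->
  hp (kap a b) =
    cut_base a * ((cut_weight l a)^-1 * cut_weight l b) * (cut_base b)^-1.
Proof.
move=> Nc NO Na Nb Nl; have Oa := NO _ Na; have Ob := NO _ Nb.
have H := convex_segment_in Nc NO Na Nb.
rewrite (@kapE _ _ _ _ conn (pt Oa) (pt Ob) H) (holpi_kpath conn cut_local).
have cb c (Oc : O c) : hol qc (conn (pt Oc)) = cut_base c.
  rewrite /cut_base; case: pselect => // Oc'; congr (hol qc (conn _)).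
  exact: val_inj.
rewrite !cb; congr (_ * _ * _).
rewrite (@hol_cut _ l); [| exact: cts_fun |].
  by rewrite path_zero path_one.
by move=> t; rewrite seg_pathE; apply: Nl; apply: Nc => //; exact: itv_val_itv.
Qed.

(** The factor at a corner [(x, y)] of a rectilinear path, where the label changes between [lamx x],
    valid on the vertical slice, and [lamy y], valid on the horizontal one. *)
Definition cut_word (x y : R * R) : G :=
  cut_weight (lamx x) (x, y) * (cut_weight (lamy y) (x, y))^-1.

Lemma cut_morphism : exists2 f : pi1 R z -> G, {morph f : g g' / g * g'} &
  forall y x x', geny y -> genx x -> genx x' ->
    f (xmove z x0 y x x') =
    (cut_word x down)^-1 * cut_word x y * ((cut_word x' y)^-1 * cut_word x' down).
Proof.
(* Conjugating by [t] removes the contribution of [conn] and of the common start [(x0, down)]. *)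
pose t := cut_base (x0, down) * (cut_weight (lamy down) (x0, down))^-1.
exists (fun g => t^-1 * hp g * t) => [g g'|y x x' gy gx gx'].
  rewrite (holpiM cut_local); move: t (hp g) (hp g') => u a b.
  by rewrite !mulgA mulgK.
have hhor y' u v : geny y' -> hp (kap (u, y') (v, y')) = cut_base (u, y') *
    ((cut_weight (lamy y') (u, y'))^-1 * cut_weight (lamy y') (v, y')) *
    (cut_base (v, y'))^-1.
  move=> gy'; apply: (cut_kap (@horizontal_convex R y') (horizontal_sub q gy')) => //.
  by move=> [c1 c2] [_ /= ->]; exact: lamyP.
have hver x1 u v : genx x1 -> hp (kap (x1, u) (x1, v)) = cut_base (x1, u) *
    ((cut_weight (lamx x1) (x1, u))^-1 * cut_weight (lamx x1) (x1, v)) *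
    (cut_base (x1, v))^-1.
  move=> gx1; apply: (cut_kap (@vertical_convex R x1) (vertical_sub gx1)) => //.
  by move=> [c1 c2] [/= -> _]; exact: lamxP.
have hM : {morph hp : g g' / g * g'} := holpiM cut_local.
have hacc x1 : genx x1 -> hp (access z x0 x1 y) =
    t * (cut_word x1 down)^-1 * cut_weight (lamx x1) (x1, y) * (cut_base (x1, y))^-1.
  move=> gx1; rewrite /access hM hhor; last exact: geny_down.
  rewrite hver // /t /cut_word invgM invgK.
  by rewrite !mulgA mulgVK.
rewrite /xmove hM hM (morphVg hM) !hacc // hhor // /cut_word.
move: (t) (cut_base (x, y)) (cut_base (x', y)) => t' a b.
rewrite !invgM !invgK !mulgA !mulgVK.
by rewrite mulVg mul1g.
Qed.

End CutMorphism.

(** * Meridians at the edges of the real picture *)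

Section Edges.
Variables (R : realType) (T : finType) (m q : T -> R).
Local Notation Z := (set_type (arrangement_space m q)).
Local Notation lform := (lform m q).
Local Notation dform := (dform m).
Local Notation genx := (genx m q).
Local Notation geny := (geny m).
Local Notation up := (up R).
Implicit Types (x y P v : R * R) (c d : T) (B : {set T}) (s : seq T).
Variables (z : Z) (x0 : R * R).
Local Notation Gamma := (pi1 R z).
Local Notation xmove := (xmove z x0).

(** For a generic [x] this set names the chamber of [x]; lines through [x] are left out. *)
Definition above x : {set T} := [set c | 0 < lform c x].

Definition realized B : Prop := exists2 x, genx x & above x = B.

Definition sample B : R * R :=
  if pselect (realized B) is left h then projT1 (cid2 h) else x0.

Lemma sampleP B : realized B -> genx (sample B) /\ above (sample B) = B.
Proof. by rewrite /sample; case: pselect => // h _; case: (cid2 h). Qed.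

Lemma xmove_same y x x' : geny y -> genx x -> genx x' ->
  (forall c, (c \in above x) != (c \in above x') -> (0 < dform c y) = false) ->
  xmove y x x' = 1%g.
Proof.
move=> gy gx gx' sep; rewrite -(xmove_down z x0 x x'); apply: xmove_sep => //.
  exact: geny_down.
by move=> c cx; rewrite dform_down oppr_gt0 ltr10 sep // !inE.
Qed.

Lemma xmove_up y x x' : geny y -> genx x -> genx x' ->
  (forall c, (c \in above x) != (c \in above x') -> 0 < dform c y) ->
  xmove y x x' = xmove up x x'.
Proof.
move=> gy gx gx' sep; apply: xmove_sep => //; first exact: geny_up.
by move=> c cx; rewrite dform_up ltr01 sep // !inE.
Qed.

(* The meridian of [c] at an edge of [c] lying above exactly the lines in [B];
   junk unless both [B] and [c |: B] are realized. *)
Definition edge c B : Gamma := xmove up (sample B) (sample (c |: B)).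

(** Moves within a chamber are trivial, so both ends may be replaced by the samples of their
    chambers; after that only the sign of [dform c y] matters. *)
Lemma xmove_cross y x x' c : geny y -> genx x -> genx x' ->
  c \notin above x -> above x' = c |: above x ->
  xmove y x x' = if 0 < dform c y then edge c (above x) else 1%g.
Proof.
move=> gy gx gx' cx ax'.
have [gs as_] := sampleP (ex_intro2 _ _ x gx erefl).
have [gs' as'] : genx (sample (c |: above x)) /\ above (sample (c |: above x)) = c |: above x.
  by apply: sampleP; exists x'.
have e1 : xmove y x (sample (above x)) = 1%g.
  by apply: xmove_same => // d; rewrite as_ eqxx.
have e2 : xmove y (sample (c |: above x)) x' = 1%g.
  by apply: xmove_same => // d; rewrite as' ax' eqxx.
have sepc d : (d \in above x) != (d \in c |: above x) -> d = c.
  by rewrite finset.in_setU1; have [//|_] := eqVneq d c; rewrite eqxx.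
rewrite -(xmoveM _ _ _ (sample (above x)) _ gy) e1 mul1g.
rewrite -(xmoveM _ _ _ (sample (c |: above x)) _ gy) e2 mulg1.
case: ifP => cy; first by apply: xmove_up => // d; rewrite as_ as' => /sepc ->.
by apply: xmove_same => // d; rewrite as_ as' => /sepc ->.
Qed.

(** The product picked up on crossing the lines of [s] upwards, in this order, from the chamber [B].
    An inactive line contributes nothing but is still passed, hence added to [B]. *)
Fixpoint edge_prod (act : pred T) B s : Gamma :=
  if s is c :: s' then
    ((if act c then edge c B else 1) * edge_prod act (c |: B) s')%g
  else 1%g.

Lemma xmove_chain y s x x' : geny y -> genx x -> genx x' -> uniq s ->
  (forall c, c \in s -> c \notin above x) ->
  above x' = above x :|: [set c in s] ->
  (forall s1 s2, s = s1 ++ s2 -> realized (above x :|: [set c in s1])) ->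
  xmove y x x' = edge_prod (fun c => 0 < dform c y) (above x) s.
Proof.
move=> gy; elim: s x => [|c s IH] x gx gx' us sx ax' re /=.
  apply: xmove_same => // d; rewrite ax' finset.in_setU !inE orbF eqxx //.
have [us' cs] : uniq s /\ c \notin s by move: us => /= /andP[].
have set1s (t : seq T) : above x :|: [set d in c :: t] = (c |: above x) :|: [set d in t].
  by apply/setP => d; rewrite !inE orbCA orbA.
have [x1 gx1 ax1] : realized (c |: above x).
  have := re [:: c] s erefl; congr realized.
  by apply/setP => d; rewrite !inE orbC.
have cx : c \notin above x by apply: sx; rewrite mem_head.
rewrite -(xmoveM _ _ _ x1 _ gy) (xmove_cross gy gx gx1 cx ax1); congr (_ * _)%g.
rewrite -ax1; apply: IH => //.
- move=> d ds; rewrite ax1 finset.in_setU1 negb_or sx ?inE ?ds ?orbT // andbT.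
  by apply: contraNneq cs => <-.
- by rewrite ax' set1s ax1.
- by move=> s1 s2 e; rewrite ax1 -set1s; apply: (re _ s2); rewrite e.
Qed.

Lemma edge_prod_cat (act : pred T) B s1 s2 :
  edge_prod act B (s1 ++ s2) =
  (edge_prod act B s1 * edge_prod act (B :|: [set c in s1]) s2)%g.
Proof.
elim: s1 B => [|c s IH] B /=.
  by rewrite mul1g; congr edge_prod; apply/setP => d; rewrite !inE orbF.
rewrite IH mulgA; congr (_ * edge_prod _ _ _)%g.
by apply/setP => d; rewrite !inE [in RHS]orbCA orbA.
Qed.

Lemma edge_prod_inactive (act : pred T) B s :
  (forall c, c \in s -> act c = false) -> edge_prod act B s = 1%g.
Proof.
elim: s B => //= c s IH B as_; rewrite as_ ?mem_head // mul1g IH // => d ds.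
by apply: as_; rewrite inE ds orbT.
Qed.

Lemma edge_prod_active (act : pred T) B s :
  (forall c, c \in s -> act c) -> edge_prod act B s = edge_prod predT B s.
Proof.
elim: s B => //= c s IH B as_; rewrite as_ ?mem_head // IH // => d ds.
by apply: as_; rewrite inE ds orbT.
Qed.

Lemma lform_shift c P v (e : R) :
  lform c (P.1 + e * v.1, P.2 + e * v.2) = lform c P + e * dform c v.
Proof. by rewrite /lform /dform /=; ring. Qed.

Lemma above_near P v : (forall c, lform c P = 0 -> dform c v != 0) ->
  exists e : R, genx (P.1 + e * v.1, P.2 + e * v.2) /\
    above (P.1 + e * v.1, P.2 + e * v.2) =
    [set c | (0 < lform c P) || ((lform c P == 0) && (0 < dform c v))]%SET.
Proof.
move=> vP.
have H c : \forall e \near (0 : R)^'+, lform c P + e * dform c v != 0 /\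
   (0 < lform c P + e * dform c v) =
   (0 < lform c P) || ((lform c P == 0) && (0 < dform c v)).
  have [P0|P0] := eqVneq (lform c P) 0.
    near=> e; have e0 : 0 < e by [].
    by rewrite P0 add0r ltxx mulf_neq0 ?vP ?gt_eqF // pmulr_rgt0.
  have cf : lform c P + e * dform c v @[e --> (0 : R)^'+] --> lform c P.
    rewrite -[X in _ --> X]addr0 -[X in _ --> _ + X](mul0r (dform c v)).
    apply: cvg_at_right_filter; apply: cvgD; first exact: cvg_cst.
    by apply: cvgM; [exact: cvg_id|exact: cvg_cst].
  move: P0; rewrite neq_lt orbF => /orP[P0|P0].
    rewrite (lt_gtF P0); have : \forall e \near (0 : R)^'+, lform c P + e * dform c v < 0.
      by apply: (cf [set r | r < 0]); apply: open_nbhs_nbhs; split=> //.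
    by apply: filterS => e; rewrite neq_lt => e0; rewrite e0 (lt_gtF e0).
  rewrite P0; have : \forall e \near (0 : R)^'+, 0 < lform c P + e * dform c v.
    by apply: (cf [set r | 0 < r]); apply: open_nbhs_nbhs; split=> //.
  by apply: filterS => e; rewrite neq_lt => e0; rewrite e0 orbT.
have [e He] := filter_ex (near_forall_fin _ H).
exists e; split; first by move=> c; rewrite lform_shift; case: (He c).
by apply/setP => c; rewrite !inE lform_shift; case: (He c).
Unshelve. all: by end_near.
Qed.

Lemma realized_near P v : (forall c, lform c P = 0 -> dform c v != 0) ->
  realized [set c | (0 < lform c P) || ((lform c P == 0) && (0 < dform c v))].
Proof. by move=> /above_near[e [ge ae]]; eexists; [exact: ge|exact: ae]. Qed.

End Edges.

Lemma avoid_finite (R : realType) (T : finType) (F : T -> R) (a b : R) :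
  a < b -> exists2 h, a < h < b & forall c, h != F c.
Proof.
move=> ab.
have H c : \forall h \near a^'+, h != F c.
  have [Fa|aF] := leP (F c) a.
    by near=> h; rewrite gt_eqF //; apply: (le_lt_trans Fa).
  near=> h; rewrite lt_eqF //; near: h; exact: nbhs_right_lt.
have [h [hF /andP[ah hb]]] : exists h, (forall c, h != F c) /\ a < h < b.
  apply: (@filter_ex _ a^'+); apply: filterI; first exact: (near_forall_fin _ H).
  by near=> h; apply/andP; split; near: h; [exact: nbhs_right_gt|exact: nbhs_right_lt].
by exists h => //; rewrite ah.
Unshelve. all: by end_near.
Qed.

(** * Relations at a vertex of the real picture *)

Section Vertices.
Variables (R : realType) (T : finType) (m q : T -> R).
Local Notation Z := (set_type (arrangement_space m q)).
Local Notation lform := (lform m q).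
Local Notation dform := (dform m).
Local Notation geny := (geny m).
Local Notation above := (above m q).
Local Notation realized := (realized m q).
Implicit Types (x y P v : R * R) (c d e : T) (B : {set T}) (s : seq T) (u : R).
Variables (z : Z) (x0 : R * R).
Hypothesis mq_inj : forall c d, m c = m d -> q c = q d -> c = d.
Local Notation edge := (edge z x0).
Local Notation edge_prod := (edge_prod z x0).

Definition steeper : rel T := [rel c d | m c < m d].

Lemma slope_gap s1 s2 : pairwise steeper (s1 ++ s2) ->
  exists h, [/\ forall c, c \in s1 -> m c < h, forall c, c \in s2 -> h < m c
              & forall c, h != m c].
Proof.
rewrite pairwise_cat => /and3P[/allrelP s12 p1 p2].
have [lo lo1 lo2] : exists2 lo, (forall c, c \in s1 -> m c <= lo) &
    (forall c, c \in s2 -> lo < m c).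
  case/lastP: s1 s12 p1 => [|s1 a] s12 p1.
    case: s2 s12 p2 => [|b s2] _ /= p2; first by exists 0.
    exists (m b - 1) => // c; rewrite inE => /orP[/eqP ->|cs2]; first lra.
    have /allP/(_ _ cs2) /= := (andP p2).1; rewrite /steeper /= => ?; lra.
  exists (m a) => [c|c cs2]; last by apply: s12; rewrite // mem_rcons mem_head.
  rewrite mem_rcons inE => /orP[/eqP ->//|cs1]; apply/ltW.
  move: p1; rewrite -cats1 pairwise_cat => /and3P[/allrelP p1 _ _].
  by apply: p1 => //; rewrite inE.
have [hi lohi hi2] : exists2 hi, lo < hi & forall c, c \in s2 -> hi <= m c.
  case: s2 p2 lo2 {s12} => [|b s2] /= p2 lo2; first by exists (lo + 1) => //; lra.
  exists (m b); first by apply: lo2; rewrite mem_head.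
  move=> c; rewrite inE => /orP[/eqP ->//|cs2].
  by apply/ltW; have /allP/(_ _ cs2) := (andP p2).1.
have [h /andP[loh hhi] hm] := avoid_finite m lohi.
exists h; split=> // [c /lo1 clo|c /hi2 chi].
  exact: le_lt_trans clo loh.
exact: lt_le_trans hhi chi.
Qed.

Section AtVertex.
Variables (P : R * R) (s : seq T).
Hypothesis ps : pairwise steeper s.
Hypothesis sP : forall c, (c \in s) = (lform c P == 0).
Local Notation B0 := (above P).

Lemma uniq_pencil : uniq s.
Proof.
by apply: pairwise_uniq ps => c /=; rewrite /steeper /= ltxx.
Qed.

Lemma above_pencil c : c \in s -> c \notin B0.
Proof. by rewrite sP inE => /eqP ->; rewrite ltxx. Qed.

(** Of the lines through [P], a point in the direction [(1, h)] lies above those of slope less than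
    [h], and in [realized_left] a point in the direction [(-1, - h)] above those of slope greater
    than [h]. *)
Lemma realized_right s1 s2 : s = s1 ++ s2 -> realized (B0 :|: [set c in s1]).
Proof.
move=> es; have [|h [h1 h2 hm]] := @slope_gap s1 s2; first by rewrite -es.
have dE c : dform c (1, h) = h - m c by rewrite /dform /= mulr1.
have [|x gx ax] := @realized_near R T m q P (1, h).
  by move=> c _; rewrite dE subr_eq0.
exists x => //; rewrite ax; apply/setP => c; rewrite !inE dE (subr_gt0 (m c)).
case: (boolP (lform c P == 0)) => [cP|cP]; last first.
  by move: (cP); rewrite -sP es mem_cat negb_or => /andP[/negPf -> _]; rewrite orbF.
congr (_ || _); apply/idP/idP => [ch|/h1 //].
by move: cP; rewrite -sP es mem_cat => /orP[//|/h2]; rewrite ltNge (ltW ch).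
Qed.

Lemma realized_left s1 s2 : s = s1 ++ s2 -> realized (B0 :|: [set c in s2]).
Proof.
move=> es; have [|h [h1 h2 hm]] := @slope_gap s1 s2; first by rewrite -es.
have dE c : dform c (-1, - h) = m c - h by rewrite /dform /= mulrN mulr1 opprK addrC.
have [|x gx ax] := @realized_near R T m q P (-1, - h).
  by move=> c _; rewrite dE subr_eq0 eq_sym.
exists x => //; rewrite ax; apply/setP => c; rewrite !inE dE (subr_gt0 h).
case: (boolP (lform c P == 0)) => [cP|cP]; last first.
  by move: (cP); rewrite -sP es mem_cat negb_or => /andP[_ /negPf ->]; rewrite orbF.
congr (_ || _); apply/idP/idP => [ch|/h2 //].
by move: cP; rewrite -sP es mem_cat => /orP[/h1|//]; rewrite ltNge (ltW ch).
Qed.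

(** The two ways of passing [P] upwards: on its right the lines through [P] are crossed by
    increasing slope, on its left by decreasing slope. *)
Lemma vertex_relation y : geny y ->
  edge_prod (fun c => 0 < dform c y) B0 s = edge_prod (fun c => 0 < dform c y) B0 (rev s).
Proof.
move=> gy.
have [x gx ax] : realized B0.
  by have := @realized_right [::] s erefl; congr realized; apply/setP => c; rewrite !inE orbF.
have [x' gx' ax'] : realized (B0 :|: [set c in s]).
  by apply: (@realized_right s [::]); rewrite cats0.
rewrite -ax -(@xmove_chain R T m q z x0 y s x x') //.
- rewrite -(@xmove_chain R T m q z x0 y (rev s) x x') //.
  + by rewrite rev_uniq uniq_pencil.
  + by move=> c; rewrite mem_rev ax; exact: above_pencil.
  + by rewrite ax ax'; congr (_ :|: _); apply/setP => c; rewrite !inE mem_rev.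
  + move=> s1 s2 es; rewrite ax.
    have -> : [set c in s1] = [set c in rev s1] by apply/setP => c; rewrite !inE mem_rev.
    by apply: (@realized_left (rev s2)); rewrite -rev_cat -es revK.
- exact: uniq_pencil.
- by move=> c; rewrite ax; exact: above_pencil.
- by rewrite ax.
- by move=> s1 s2 es; rewrite ax; exact: realized_right es.
Qed.

(** At the height [(1, h)], with [h] between the slopes of [s1] and [s2], exactly the lines of [s1]
    are active in [vertex_relation]. For [vertex_suffix] the height is [(-1, - h)], where exactly
    those of [s2] are. *)
Lemma vertex_prefix s1 s2 : s = s1 ++ s2 ->
  edge_prod predT B0 s1 = edge_prod predT (B0 :|: [set c in s2]) (rev s1).
Proof.
move=> es; have [|h [h1 h2 hm]] := @slope_gap s1 s2; first by rewrite -es.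
have dE c : dform c (1, h) = h - m c by rewrite /dform /= mulr1.
have := @vertex_relation (1, h); rewrite es rev_cat !edge_prod_cat.
have a1 c : c \in s1 -> 0 < dform c (1, h) by move=> /h1; rewrite dE subr_gt0.
have a2 c : c \in s2 -> (0 < dform c (1, h)) = false.
  by move=> /h2 ch; rewrite dE subr_gt0 lt_gtF.
rewrite (edge_prod_active _ _ _ a1) (edge_prod_inactive _ _ _ a2).
have a1r c : c \in rev s1 -> 0 < dform c (1, h) by rewrite mem_rev; exact: a1.
have a2r c : c \in rev s2 -> (0 < dform c (1, h)) = false.
  by rewrite mem_rev; exact: a2.
rewrite (edge_prod_active _ _ _ a1r) (edge_prod_inactive _ _ _ a2r).
rewrite mulg1 mul1g => -> //; last by move=> c; rewrite dE subr_eq0.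
by congr (edge_prod _ (_ :|: _) _); apply/setP => c; rewrite !inE mem_rev.
Qed.

Lemma vertex_suffix s1 s2 : s = s1 ++ s2 ->
  edge_prod predT (B0 :|: [set c in s1]) s2 = edge_prod predT B0 (rev s2).
Proof.
move=> es; have [|h [h1 h2 hm]] := @slope_gap s1 s2; first by rewrite -es.
have dE c : dform c (-1, - h) = m c - h by rewrite /dform /= mulrN mulr1 opprK addrC.
have := @vertex_relation (-1, - h); rewrite es rev_cat !edge_prod_cat.
have a2 c : c \in s2 -> 0 < dform c (-1, - h) by move=> /h2; rewrite dE subr_gt0.
have a1 c : c \in s1 -> (0 < dform c (-1, - h)) = false.
  by move=> /h1 ch; rewrite dE subr_gt0 lt_gtF.
rewrite (edge_prod_active _ _ _ a2) (edge_prod_inactive _ _ _ a1).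
have a2r c : c \in rev s2 -> 0 < dform c (-1, - h) by rewrite mem_rev; exact: a2.
have a1r c : c \in rev s1 -> (0 < dform c (-1, - h)) = false.
  by rewrite mem_rev; exact: a1.
rewrite (edge_prod_active _ _ _ a2r) (edge_prod_inactive _ _ _ a1r).
by rewrite mulg1 mul1g => -> // c; rewrite dE subr_eq0 eq_sym.
Qed.

End AtVertex.

(** For two lines the prefix and suffix relations say that each meridian continues unchanged through
    the crossing; the relation for both lines together then becomes a commutation. *)
Lemma double_point P c d : c != d ->
  (forall e, (lform e P == 0) = (e == c) || (e == d)) ->
  [/\ edge c (above P) = edge c (d |: (above P)),
      edge d (above P) = edge d (c |: (above P))
    & commute (edge c (above P)) (edge d (above P))].
Proof.
wlog cd : c d / m c < m d => [H|] cnd eP.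
  have [cd|dc|cd] := ltgtP (m c) (m d); first exact: H.
    have [] := H d c dc; first by rewrite eq_sym.
      by move=> e; rewrite eP orbC.
    by move=> h1 h2 /commute_sym.
  have /eqP := eP c; have /eqP := eP d; rewrite !eqxx orbT /=.
  move=> /eqP/eqP dP /eqP/eqP cP; case/eqP: cnd; apply: mq_inj => //.
  by move: dP cP; rewrite /lform cd => dP cP; lra.
have ps : pairwise steeper [:: c; d] by rewrite /= /steeper /= cd.
have sP e : (e \in [:: c; d]) = (lform e P == 0) by rewrite eP !inE.
have h1 := vertex_prefix ps sP (s1 := [:: c]) (s2 := [:: d]) erefl.
have h2 := vertex_suffix ps sP (s1 := [:: c]) (s2 := [:: d]) erefl.
have h3 := vertex_prefix ps sP (s1 := [:: c; d]) (s2 := [::]) erefl.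
have set1s a (B : {set T}) : B :|: [set e in [:: a]] = a |: B.
  by apply/setP => e; rewrite !inE orbC.
have set0s (B : {set T}) : B :|: [set e in [::]] = B.
  by apply/setP => e; rewrite !inE orbF.
move: h1 h2 h3; rewrite !set1s !set0s /= !mulg1 => h1 h2 h3.
by split=> //; rewrite /commute [in RHS]h1 -h3 h2.
Qed.

End Vertices.

(** * Sign changes of affine functions *)

Section AffineSigns.
Variable R : realType.
Implicit Types k b u v w : R.

Lemma affine_root k b u v : u < v -> k * u + b != 0 -> k * v + b != 0 ->
  (0 < k * u + b) != (0 < k * v + b) -> k != 0 /\ u < - b / k < v.
Proof.
move=> uv u0 v0 sgn; have k0 : k != 0.
  by apply: contraNneq sgn => ->; rewrite !mul0r.
split=> //; have kb : k * (- b / k) = - b by rewrite mulrC divfK.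
move: sgn u0 v0; rewrite !neq_lt; move: (- b / k) kb => r kb.
have [kp|kn] : 0 < k \/ k < 0 by apply/orP; rewrite orbC -neq_lt.
  have kuv : k * u < k * v by rewrite ltr_pM2l.
  rewrite -(ltr_pM2l kp u) -(ltr_pM2l kp _ v) kb.
  by case: (ltgtP 0 (k * u + b)) => // h1; case: (ltgtP 0 (k * v + b)) => // h2 _ _ _;
    apply/andP; split; lra.
have kuv : k * v < k * u by rewrite ltr_nM2l.
rewrite -(ltr_nM2l kn _ u) -(ltr_nM2l kn v) kb.
by case: (ltgtP 0 (k * u + b)) => // h1; case: (ltgtP 0 (k * v + b)) => // h2 _ _ _;
  apply/andP; split; lra.
Qed.

Lemma affine_rightward k b u v w : u < v -> v < w ->
  k * u + b != 0 -> k * v + b != 0 ->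
  (0 < k * u + b) != (0 < k * v + b) ->
  k * w + b != 0 /\ (0 < k * w + b) = (0 < k * v + b).
Proof.
move=> uv vw; rewrite !neq_lt.
by case: (ltgtP 0 (k * u + b)) => // h1; case: (ltgtP 0 (k * v + b)) => // h2 _ _ _;
   case: (ltgtP 0 (k * w + b)) => // h3; nra.
Qed.

Lemma affine_leftward k b u v w : w < u -> u < v ->
  k * u + b != 0 -> k * v + b != 0 ->
  (0 < k * u + b) != (0 < k * v + b) ->
  (0 < k * w + b) = (0 < k * u + b).
Proof.
move=> wu uv; rewrite !neq_lt.
by case: (ltgtP 0 (k * u + b)) => // h1; case: (ltgtP 0 (k * v + b)) => // h2 _ _ _;
   case: (ltP 0 (k * w + b)) => // h3; nra.
Qed.

End AffineSigns.

(** * Meridians along a line *)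

Section AlongLines.
Variables (R : realType) (T : finType) (m q : T -> R).
Local Notation Z := (set_type (arrangement_space m q)).
Local Notation lform := (lform m q).
Local Notation above := (above m q).
Implicit Types (P : R * R) (c d e : T) (B : {set T}) (s : seq T) (u v : R).
Variables (z : Z) (x0 : R * R).
Hypothesis mq_inj : forall c d, m c = m d -> q c = q d -> c = d.
Local Notation edge := (edge z x0).

Definition on_line c u : R * R := (u, m c * u + q c).

Definition clean c u : Prop := forall d, d != c -> lform d (on_line c u) != 0.

Definition line_edge c u := edge c (above (on_line c u)).

Definition doubles c (a b : R) : Prop := forall u d e, a < u < b ->
  d != c -> e != c -> lform d (on_line c u) = 0 -> lform e (on_line c u) = 0 -> d = e.

Lemma lform_on_line d c u : lform d (on_line c u) = (m c - m d) * u + (q c - q d).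
Proof. by rewrite /lform /on_line /=; ring. Qed.

Lemma lform_on_line0 c u : lform c (on_line c u) = 0.
Proof. by rewrite lform_on_line !subrr mul0r addr0. Qed.

Lemma line_stable c u : exists2 r : R, 0 < r & forall v, `|v - u| < r ->
  forall d, lform d (on_line c u) != 0 -> lform d (on_line c v) != 0 /\
    (0 < lform d (on_line c v)) = (0 < lform d (on_line c u)).
Proof.
have cl d : continuous (fun v => lform d (on_line c v)).
  rewrite (_ : (fun v => _) = (fun v => (m c - m d) * v + (q c - q d))); last first.
    by apply/funext => v; rewrite lform_on_line.
  apply: continuous_add; last exact: continuous_const.
  by apply: continuous_mul; [exact: continuous_const|move=> v; exact: cvg_id].
have H d : \forall v \near u, lform d (on_line c u) != 0 -> lform d (on_line c v) != 0 /\
    (0 < lform d (on_line c v)) = (0 < lform d (on_line c u)).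
  have [->|d0] := eqVneq (lform d (on_line c u)) 0.
    by near=> v.
  move: (d0); rewrite neq_lt => /orP[dn|dp].
    apply: filterS (near_lt0 (cl d) dn) => v dv _.
    by rewrite lt_eqF // (lt_gtF dn) (lt_gtF dv).
  by apply: filterS (near_gt0 (cl d) dp) => v dv _; rewrite gt_eqF // dp dv.
have nH := near_forall_fin (nbhs_filter u) H.
have [r /= r0 Hr] := (nbhs_ballP _ _).1 nH.
by exists r => // v vu; apply: Hr; rewrite -ball_normE /ball_ /= distrC.
Unshelve. all: by end_near.
Qed.

(** Induction on the number of lines crossed between [u] and [u']: the leftmost crossing is a double
    point, past which [double_point] carries the meridian. *)
Lemma line_edge_const c u u' : clean c u -> clean c u' -> u < u' ->
  doubles c u u' -> line_edge c u = line_edge c u'.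
Proof.
pose S u := [set d | (0 < lform d (on_line c u)) != (0 < lform d (on_line c u'))]%SET.
have [n] := ubnP #|S u|; elim: n u => // n IH u Sn cu cu' uu' dbl.
have [S0|[d0 d0S]] := set_0Vmem (S u).
  rewrite /line_edge; congr (edge c _); apply/setP => d; rewrite !inE.
  have : d \notin S u by rewrite S0 inE.
  by rewrite inE negbK => /eqP.
(* The abscissa at which [d] crosses [c]. *)
pose rt d := - (q c - q d) / (m c - m d).
have SP e : e \in S u -> [/\ e != c, m c - m e != 0 & u < rt e < u'].
  rewrite inE => eS; have ec : e != c.
    by apply: contraNneq eS => ->; rewrite !lform_on_line0.
  have := cu e ec; have := cu' e ec; move: eS; rewrite !lform_on_line => eS h1 h2.
  by have [] := affine_root uu' h2 h1 eS.
have Lrt e v : m c - m e != 0 -> lform e (on_line c v) = (m c - m e) * (v - rt e).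
  by move=> k0; rewrite lform_on_line mulrBr /rt mulrCA divff // mulr1 opprK.
have [d dS dmin] := @arg_minP _ R T d0 (mem (S u)) rt d0S.
have {}dS : d \in S u := dS.
have [dc kd /andP[ud du']] := SP d dS.
pose P := on_line c (rt d).
have dP : lform d P = 0 by rewrite /P (Lrt d) // subrr mulr0.
have cP : lform c P = 0 by exact: lform_on_line0.
have eP e : (lform e P == 0) = (e == c) || (e == d).
  apply/eqP/orP => [eP|[/eqP ->//|/eqP ->//]].
  have [->|ec] := eqVneq e c; [by left|right; apply/eqP].
  by apply: (dbl (rt d)) => //; rewrite ud du'.
have [Hc _ _] := double_point z x0 mq_inj (P := P) (c := c) (d := d) ltac:(by rewrite eq_sym) eP.
have [r r0 rP] := line_stable c (rt d).
(* [v] lies past the crossing with [d], so close to it that no other line changes side. *)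
have [v /andP[dv]] : exists2 v, rt d < v < Num.min u' (rt d + r) & forall e, v != rt e.
  by apply: avoid_finite; rewrite lt_min du' ltrDl.
rewrite lt_min => /andP[vu' vr] _.
have vd : `|v - rt d| < r by rewrite ger0_norm ?subr_ge0 ?(ltW dv) // ltrBlDl.
have off e : e != c -> e != d -> lform e P != 0 by move=> ec ed; rewrite eP negb_or ec.
have cv : clean c v.
  move=> e ec; have [->|ed] := eqVneq e d.
    by rewrite (Lrt d) // mulf_neq0 // subr_eq0 gt_eqF.
  by have [] := rP v vd e (off e ec ed).
(* Right of the crossing [c] is above [d] precisely when it has the larger slope. At [u] the cases
   are exchanged, and only for [d], as no line is crossed before it. *)
have above_v : above (on_line c v) = if 0 < m c - m d then d |: above P else above P.
  apply/setP => e; rewrite inE; have [->|ec] := eqVneq e c.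
    rewrite lform_on_line0 ltxx; case: ifP => _; rewrite !inE cP ltxx //.
    by rewrite eq_sym (negPf dc).
  have [->|ed] := eqVneq e d.
    rewrite (Lrt d) // pmulr_lgt0 ?subr_gt0 //.
    by case: ifP => kp; rewrite !inE ?eqxx // dP ltxx.
  have [_ ->] := rP v vd e (off e ec ed).
  by case: ifP => _; rewrite !inE ?(negPf ed).
have above_u : above (on_line c u) = if 0 < m c - m d then above P else d |: above P.
  apply/setP => e; rewrite inE; have [->|ec] := eqVneq e c.
    rewrite lform_on_line0 ltxx; case: ifP => _; rewrite !inE cP ltxx //.
    by rewrite eq_sym (negPf dc).
  have [->|ed] := eqVneq e d.
    rewrite (Lrt d) // nmulr_lgt0; last by rewrite subr_lt0.
    have [kp|kn] : 0 < m c - m d \/ m c - m d < 0.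
      by apply/orP; rewrite orbC -neq_lt.
      by rewrite kp inE dP ltxx (lt_gtF kp).
    by rewrite (lt_gtF kn) !inE eqxx kn.
  have -> : (0 < lform e (on_line c u)) = (0 < lform e P).
    apply/eqP; apply: contraT => diff.
    move: (off e ec ed) (cu e ec) diff; rewrite /P !lform_on_line => h1 h2 diff.
    have [_ /andP[_ rt_lt]] := affine_root ud h2 h1 diff.
    have [_ sg] := affine_rightward ud du' h2 h1 diff.
    have : e \in S u by rewrite inE !lform_on_line sg.
    by move=> /dmin; rewrite leNgt rt_lt.
  by case: ifP => _; rewrite !inE ?(negPf ed).
have -> : line_edge c u = line_edge c v.
  by rewrite /line_edge above_u above_v; case: ifP => _; rewrite Hc.
apply: IH => //; last first.
  by move=> w e f /andP[vw wu']; apply: dbl; rewrite wu' (lt_trans _ vw) // (lt_trans ud).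
rewrite -ltnS; apply: leq_trans Sn; rewrite ltnS (cardsD1 d (S u)) dS add1n ltnS.
apply: subset_leq_card; apply/fintype.subsetP => e eS.
have ec : e != c by apply: contraTneq eS => ->; rewrite inE !lform_on_line0 eqxx.
rewrite in_setD1; apply/andP; split.
  apply: contraTneq eS => ->; rewrite inE !(Lrt d) // negbK.
  move: kd; rewrite neq_lt => /orP[k0|k0]; last by rewrite !pmulr_rgt0 // !subr_gt0 dv du'.
  by rewrite !nmulr_rgt0 // !subr_lt0 (lt_gtF dv) (lt_gtF du').
move: eS (cv e ec) (cu' e ec); rewrite !inE !lform_on_line => eS h1 h2.
by rewrite (affine_leftward (lt_trans ud dv) vu' h1 h2 eS).
Qed.

End AlongLines.

Lemma exists_between (R : realType) (a b : R) : a < b -> exists2 u, a < u & u < b.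
Proof. by move=> ab; exists ((a + b) / 2); lra. Qed.

(** * Meridians next to a multiple point; generation by edges *)

Section LineEdges.
Variables (R : realType) (T : finType) (m q : T -> R).
Local Notation Z := (set_type (arrangement_space m q)).
Local Notation lform := (lform m q).
Local Notation genx := (genx m q).
Local Notation geny := (geny m).
Local Notation above := (above m q).
Local Notation realized := (realized m q).
Local Notation steeper := (steeper m).
Local Notation on_line := (on_line m q).
Local Notation clean := (clean m q).
Local Notation doubles := (doubles m q).
Implicit Types (P x y : R * R) (c d e : T) (B : {set T}) (s : seq T) (u v : R).
Variables (z : Z) (x0 : R * R).
Hypothesis mq_inj : forall c d, m c = m d -> q c = q d -> c = d.
Local Notation xmove := (xmove z x0).
Local Notation edge := (edge z x0).
Local Notation line_edge := (line_edge z x0).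

Lemma on_lineE c P : lform c P = 0 -> P = on_line c P.1.
Proof.
case: P => a b; rewrite /lform /on_line /= => e; congr (_, _).
by apply/eqP; rewrite -subr_eq0 -e; apply/eqP; ring.
Qed.

Section Pencil.
Variables (P : R * R) (s1 s2 : seq T) (c : T).
Hypothesis ps : pairwise steeper (s1 ++ c :: s2).
Hypothesis sP : forall d, (d \in s1 ++ c :: s2) = (lform d P == 0).

Lemma pencil_slopes d : d \in s1 ++ c :: s2 -> d != c ->
  m c - m d != 0 /\ (0 < m c - m d) = (d \in s1) /\ (m c - m d < 0) = (d \in s2).
Proof.
move: ps; rewrite pairwise_cat /= => /and3P[/allrelP s1c _ /andP[/allP cs2 _]].
have m1 e : e \in s1 -> m e < m c by move=> es; apply: s1c; rewrite ?mem_head.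
have m2 e : e \in s2 -> m c < m e by move=> es; apply: cs2.
rewrite mem_cat inE => ds dc; move: ds; rewrite (negPf dc) /= => /orP[d1|d2].
  have md := m1 d d1; rewrite gt_eqF ?subr_gt0 // md subr_lt0 (lt_gtF md) d1.
  by split=> //; split=> //; apply/esym/negbTE/negP => /m2; rewrite (lt_gtF md).
have md := m2 d d2; rewrite lt_eqF ?subr_lt0 // md subr_gt0 (lt_gtF md) d2.
by split=> //; split=> //; apply/esym/negbTE/negP => /m1; rewrite (lt_gtF md).
Qed.

Lemma pencil_line : P = on_line c P.1.
Proof. by apply: on_lineE; apply/eqP; rewrite -sP mem_cat mem_head orbT. Qed.

Lemma pencil_lform d u : d \in s1 ++ c :: s2 ->
  lform d (on_line c u) = (m c - m d) * (u - P.1).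
Proof.
rewrite sP pencil_line lform_on_line => /eqP h; rewrite lform_on_line /=.
by rewrite -[LHS]subr0 -h; ring.
Qed.

(** Just right of [P] the line [c] runs above the lines [s1] of smaller slope in its pencil; just
    left of [P], in [left_point], above the lines [s2] of larger slope. *)
Lemma right_point b : P.1 < b -> exists2 u, P.1 < u < b &
  clean c u /\ above (on_line c u) = above P :|: [set d in s1].
Proof.
move=> Pb; have [r r0 rP] := line_stable m q c P.1; rewrite -pencil_line in rP.
have [u Pu] : exists2 u, P.1 < u & u < Num.min b (P.1 + r).
  by apply: exists_between; rewrite lt_min Pb ltrDl.
rewrite lt_min => /andP[ub ur]; exists u; first by rewrite Pu.
have uP : `|u - P.1| < r by rewrite ger0_norm ?subr_ge0 ?(ltW Pu) // ltrBlDl.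
have uP0 : 0 < u - P.1 by rewrite subr_gt0.
split=> [d dc|].
  have [dP|dP] := boolP (d \in s1 ++ c :: s2).
    by rewrite pencil_lform // mulf_neq0 ?(gt_eqF uP0) //; case: (pencil_slopes dP dc).
  by have [] := rP u uP d; rewrite // -sP.
apply/setP => d; rewrite !inE; have [->|dc] := eqVneq d c.
  rewrite lform_on_line0 ltxx; have /eqP -> : lform c P == 0 by rewrite -sP mem_cat mem_head orbT.
  rewrite ltxx; apply/esym/negbTE; move: ps; rewrite pairwise_cat => /and3P[/allrelP h _ _].
  by apply/negP => /h /(_ (mem_head _ _)); rewrite /steeper /= ltxx.
have [dP|dP] := boolP (d \in s1 ++ c :: s2).
  rewrite pencil_lform // pmulr_lgt0 //; move: (dP); rewrite sP => /eqP ->; rewrite ltxx.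
  by case: (pencil_slopes dP dc) => _ [-> _].
have [_ ->] := rP u uP d ltac:(by rewrite -sP).
by move: dP; rewrite mem_cat negb_or => /andP[/negPf -> _]; rewrite orbF.
Qed.

Lemma left_point a : a < P.1 -> exists2 u, a < u < P.1 &
  clean c u /\ above (on_line c u) = above P :|: [set d in s2].
Proof.
move=> aP; have [r r0 rP] := line_stable m q c P.1; rewrite -pencil_line in rP.
have [u + uP] : exists2 u, Num.max a (P.1 - r) < u & u < P.1.
  by apply: exists_between; rewrite gt_max aP gtrBl.
rewrite gt_max => /andP[au ru]; exists u; first by rewrite uP au.
have uPr : `|u - P.1| < r.
  by rewrite distrC ger0_norm ?subr_ge0 ?(ltW uP) // ltrBlDl -ltrBlDr.
have uP0 : u - P.1 < 0 by rewrite subr_lt0.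
split=> [d dc|].
  have [dP|dP] := boolP (d \in s1 ++ c :: s2).
    by rewrite pencil_lform // mulf_neq0 ?(lt_eqF uP0) //; case: (pencil_slopes dP dc).
  by have [] := rP u uPr d; rewrite // -sP.
apply/setP => d; rewrite !inE; have [->|dc] := eqVneq d c.
  rewrite lform_on_line0 ltxx; have /eqP -> : lform c P == 0 by rewrite -sP mem_cat mem_head orbT.
  rewrite ltxx; apply/esym/negbTE; move: ps; rewrite pairwise_cat /=.
  by move=> /and3P[_ _ /andP[/allP h _]]; apply/negP => /h; rewrite /steeper /= ltxx.
have [dP|dP] := boolP (d \in s1 ++ c :: s2).
  rewrite pencil_lform // nmulr_lgt0 //; move: (dP); rewrite sP => /eqP ->; rewrite ltxx.
  by case: (pencil_slopes dP dc) => _ [_ ->].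
have [_ ->] := rP u uPr d ltac:(by rewrite -sP).
by move: dP; rewrite mem_cat inE !negb_or => /and3P[_ _ /negPf ->]; rewrite orbF.
Qed.

Lemma line_edge_right u : P.1 < u -> clean c u -> doubles c P.1 u ->
  line_edge c u = edge c (above P :|: [set d in s1]).
Proof.
move=> Pu cu dbl; have [v /andP[Pv vu] [cv av]] := right_point Pu.
rewrite -av; apply/esym; apply: line_edge_const => // w d e /andP[vw wu].
by apply: dbl; rewrite wu (lt_trans Pv).
Qed.

Lemma line_edge_left u : u < P.1 -> clean c u -> doubles c u P.1 ->
  line_edge c u = edge c (above P :|: [set d in s2]).
Proof.
move=> uP cu dbl; have [v /andP[uv vP] [cv av]] := left_point uP.
rewrite -av; apply: line_edge_const => // w d e /andP[uw wv].
by apply: dbl; rewrite uw (lt_trans wv).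
Qed.

End Pencil.

Lemma double_edges P c d b : c != d ->
  (forall e, (lform e P == 0) = (e == c) || (e == d)) -> P.1 < b ->
  exists u v, [/\ P.1 < u < b, P.1 < v < b, clean c u /\ clean d v
    & commute (line_edge c u) (line_edge d v)].
Proof.
wlog cd : c d / m c < m d => [H|] cnd eP Pb.
  have [cd|dc|cd] := ltgtP (m c) (m d); first exact: H.
    have [||u [v [Pu Pv [du cv] /commute_sym uv]]] := H d c dc _ _ Pb.
    - by rewrite eq_sym.
    - by move=> e; rewrite eP orbC.
    by exists v, u.
  have /eqP := eP c; have /eqP := eP d; rewrite !eqxx orbT /=.
  move=> /eqP/eqP dP /eqP/eqP cP; case/eqP: cnd; apply: mq_inj => //.
  by move: dP cP; rewrite /lform cd => dP cP; lra.
have ps : pairwise steeper [:: c; d] by rewrite /= /steeper /= cd.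
have sP e : (e \in [:: c; d]) = (lform e P == 0) by rewrite eP !inE.
have [u Pu [cu au]] := @right_point P [::] [:: d] c ps sP b Pb.
have [v Pv [dv av]] := @right_point P [:: c] [::] d ps sP b Pb.
have [_ H2 H3] := double_point z x0 mq_inj cnd eP.
exists u, v; split=> //; rewrite /line_edge au av.
have -> : above P :|: [set e in [::]] = above P by apply/setP => e; rewrite !inE orbF.
have -> : above P :|: [set e in [:: c]] = c |: above P by apply/setP => e; rewrite !inE orbC.
by rewrite -H2.
Qed.

Lemma realized_set0 : realized finset.set0.
Proof.
pose N := 1 + \sum_c `|q c|.
have qN c : `|q c| <= \sum_c `|q c|.
  by rewrite (bigD1 c) //= lerDl sumr_ge0.
have neg c : lform c (0, - N) < 0.
  rewrite /lform /= mulr0 subr0 /N; have := qN c; have := ler_norm (- q c).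
  by rewrite normrN; lra.
exists (0, - N); first by move=> c; rewrite lt_eqF.
by apply/setP => c; rewrite !inE lt_gtF.
Qed.

(** A vertical descent crosses the lines below [x] one at a time, each crossing contributing at most
    one edge; the induction is on the number of these lines. *)
Lemma xmove_edges y x : geny y -> genx x ->
  gen [set h | exists c u, clean c u /\ h = line_edge c u]
    (xmove y (sample m q x0 finset.set0) x).
Proof.
move=> gy; set S := [set h | _]; set xb := sample _ _ _ _.
have [gxb axb] : genx xb /\ above xb = finset.set0 := sampleP x0 realized_set0.
have [n] := ubnP #|above x|; elim: n x => // n IH x xn gx.
(* The abscissae of the crossings; when [u] avoids them, the vertical line at [u] meets the lines at
   distinct heights. *)
pose F (cd : T * T) := (q cd.2 - q cd.1) / (m cd.1 - m cd.2).
have H c : \forall v \near x.1, lform c (v, x.2) != 0 /\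
    (0 < lform c (v, x.2)) = (0 < lform c x).
  have cl : continuous (fun v => lform c (v, x.2)).
    apply: continuous_sub; last exact: continuous_const.
    apply: continuous_sub; first exact: continuous_const.
    by apply: continuous_mul; [exact: continuous_const|move=> v; exact: cvg_id].
  have lx : lform c x = lform c (x.1, x.2) by case: (x).
  move: (gx c); rewrite lx neq_lt => /orP[dn|dp].
    apply: filterS (near_lt0 cl dn) => v dv.
    by rewrite lt_eqF // (lt_gtF dn) (lt_gtF dv).
  by apply: filterS (near_gt0 cl dp) => v dv; rewrite gt_eqF // dp dv.
have nH := near_forall_fin (nbhs_filter x.1) H.
have [r /= r0 Hr] := (nbhs_ballP _ _).1 nH.
have [u /andP[xu ur] uF] := @avoid_finite R _ F x.1 (x.1 + r) ltac:(by rewrite ltrDl).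
have {}Hr c : lform c (u, x.2) != 0 /\ (0 < lform c (u, x.2)) = (0 < lform c x).
  apply: Hr; rewrite -ball_normE /ball_ /= distrC ger0_norm ?subr_ge0 ?(ltW xu) //.
  by rewrite ltrBlDl.
have gu : genx (u, x.2) by move=> c; case: (Hr c).
have au : above (u, x.2) = above x by apply/setP => c; rewrite !inE; case: (Hr c).
rewrite -(xmoveM _ _ _ (u, x.2) _ gy) (@xmove_same _ _ _ _ _ _ y (u, x.2) x) //; last first.
  by move=> c; rewrite au eqxx.
rewrite mulg1; have [ax0|[c0 c0x]] := set_0Vmem (above x).
  rewrite xmove_same //; first exact: gen1.
  by move=> c; rewrite au axb ax0 eqxx.
(* The highest line below [(u, x.2)], hence the first one met on the way down. *)
have [c cx cmax] := @arg_maxP _ R T c0 (mem (above x)) (fun c => m c * u + q c) c0x.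
have {}cx : c \in above x := cx.
have cu : clean c u.
  move=> d dc; rewrite lform_on_line; have [mcd|mcd] := eqVneq (m c) (m d).
    rewrite mcd subrr mul0r add0r subr_eq0; apply: contraNneq dc => qcd.
    by apply/eqP; apply: mq_inj.
  have := uF (c, d); rewrite /F /=; apply: contraNneq => e.
  have k0 : m c - m d != 0 by rewrite subr_eq0.
  by apply/eqP; apply: (mulIf k0); rewrite divfK //; apply/eqP; rewrite -subr_eq0 -e; apply/eqP; ring.
pose B := above (on_line c u).
have cB : c \notin B by rewrite inE lform_on_line0 ltxx.
have axB : above (u, x.2) = c |: B.
  have lu d : lform d (u, x.2) = x.2 - (m d * u + q d) by rewrite /lform /=; ring.
  have ld d : lform d (on_line c u) = (m c * u + q c) - (m d * u + q d).
    by rewrite lform_on_line; ring.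
  apply/setP => d; rewrite !inE ld; have [->|dc] := eqVneq d c.
    by move: cx; rewrite -au inE => ->.
  apply/idP/idP => [dx|/= cd].
    have /cmax : d \in above x by rewrite -au inE.
    move=> dle; rewrite subr_gt0 lt_neqAle; apply/andP; split; last exact: dle.
    by rewrite -subr_eq0 -oppr_eq0 opprB -ld cu.
  move: cx; rewrite -au inE !lu !subr_gt0 => cx; move: cd; rewrite subr_gt0 => cd.
  exact: lt_trans cd cx.
have rB : realized B.
  have [|x1 gx1 ax1] := @realized_near R T m q (on_line c u) (down R).
    by move=> d _; rewrite dform_down oppr_eq0 oner_eq0.
  exists x1 => //; rewrite ax1; apply/setP => d; rewrite !inE dform_down.
  by rewrite oppr_gt0 ltr10 andbF orbF.
have [gB aB] := sampleP x0 rB.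
rewrite -(xmoveM _ _ _ (sample m q x0 B) _ gy); apply: genM.
  apply: IH => //; rewrite aB -ltnS; apply: leq_trans xn.
  by rewrite ltnS -au axB cardsU1 cB.
rewrite (@xmove_cross _ _ _ _ _ _ y _ _ c) ?aB //; case: ifP => _; last exact: gen1.
by apply: sub_gen; exists c, u.
Qed.

Lemma edges_generate (g : pi1 R z) : gen [set h | exists c u, clean c u /\ h = line_edge c u] g.
Proof.
apply: (gen_sub _ (@xmove_generated R T m q z x0 g)) => _ [y [x [x' [gy gx gx' ->]]]].
rewrite -(xmoveM _ _ _ (sample m q x0 finset.set0) _ gy) xmoveV //.
by apply: genM; [apply: genV|]; exact: xmove_edges.
Qed.

End LineEdges.

(** * Recognizing the product *)

Section ProductDecomposition.
Variables (G : groupType) (t : nat) (k : 'I_t.+1 -> nat).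
Variables (x : forall i, 'I_(k i) -> G) (cc : 'I_t -> G).
Local Open Scope group_scope.
Hypothesis xx : forall i j (a : 'I_(k i)) (b : 'I_(k j)), i != j -> commute (x a) (x b).
Hypothesis cx : forall l i (a : 'I_(k i)), commute (cc l) (x a).
Hypothesis ccc : forall l l', commute (cc l) (cc l').
Hypothesis xcc_gen : forall g,
  gen [set h | (exists i (a : 'I_(k i)), h = x a) \/ (exists l, h = cc l)] g.
Variables (Phi : forall i, G -> free_group 'I_(k i)) (omega : 'I_t -> G -> Algebra.to_multiplicative int).
Hypothesis PhiM : forall i, {morph @Phi i : g h / g * h}.
Hypothesis Phi_x : forall i (a : 'I_(k i)), @Phi i (x a) = fgen a.
Hypothesis Phi_x1 : forall i j (a : 'I_(k i)), i != j -> @Phi j (x a) = 1.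
Hypothesis Phi_cc : forall i l, @Phi i (cc l) = 1.
Hypothesis omegaM : forall l, {morph omega l : g h / g * h}.
Hypothesis omega_x : forall l i (a : 'I_(k i)), omega l (x a) = 1.
Hypothesis omega_cc : forall l l', omega l (cc l') = (l == l')%:R%R :> int.

Local Notation H := (direct_product (fun i => free_group 'I_(k i)) * Zpow t)%type.

Lemma prodg_single (I : finType) (K : groupType) (F : I -> K) i :
  (forall j, j != i -> F j = 1) -> \prod_j F j = F i.
Proof.
move=> Fi; rewrite (eq_bigr (fun j => if j == i then F i else 1)).
  by rewrite -big_mkcond big_pred1_eq.
by move=> j _; case: eqVneq => [->//|/Fi].
Qed.

Lemma prodgM_distinct (I : eqType) (r : seq I) (F1 F2 : I -> G) : uniq r ->
  (forall i j, i != j -> commute (F1 i) (F2 j)) ->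
  \prod_(i <- r) (F1 i * F2 i) = (\prod_(i <- r) F1 i) * \prod_(i <- r) F2 i.
Proof.
move=> + F12; elim: r => [|i r IH] /=; first by rewrite !big_nil mulg1.
move=> /andP[ir ur]; rewrite !big_cons IH // -!mulgA; congr (_ * _).
rewrite !mulgA; congr (_ * _).
have : commute (F2 i) (\prod_(j <- r) F1 j).
  rewrite big_seq; apply: commute_prod => j jr; apply: commute_sym; apply: F12.
  by apply: contraNneq ir => <-.
by [].
Qed.

Lemma zpow_int (n : int) : zpow (1%R : Algebra.to_multiplicative int) n = n.
Proof.
have X (p : nat) : ((1%R : Algebra.to_multiplicative int) ^+ p) = p%:Z.
  elim: p => // p IH; rewrite expgS IH.
  by change (1 + p%:Z = p.+1%:Z)%R; rewrite -PoszD add1n.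
case: n => p /=; first exact: X.
by rewrite X; change (- p.+1%:Z = Negz p)%R; rewrite NegzE.
Qed.

Definition decomp (g : G) : H := (fun i => @Phi i g, \row_l omega l g).

Definition free_part (f : direct_product (fun i => free_group 'I_(k i))) : G :=
  \prod_i flift (@x i) (f i).

Definition central_part (v : Zpow t) : G := \prod_l zpow (cc l) ((v : 'rV[int]_t) 0%R l).

Definition recomp (u : H) : G := free_part u.1 * central_part u.2.

Lemma decompM : {morph decomp : g h / g * h}.
Proof.
move=> g h; congr pair; first by apply/functional_extensionality_dep => i; exact: PhiM.
by apply/rowP => l; rewrite !mxE omegaM.
Qed.

Lemma free_partM : {morph free_part : f g / f * g}.
Proof.
move=> f g; rewrite /free_part -prodgM_distinct ?index_enum_uniq //.
  by apply: eq_bigr => i _; rewrite -fliftM.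
move=> i j ij; apply: (gen_commute _ (flift_gen _) (flift_gen _)).
by move=> _ _ [a _ <-] [b _ <-]; exact: xx.
Qed.

Lemma central_partM : {morph central_part : v w / v * w}.
Proof.
move=> v w; rewrite /central_part -prodgM_distinct ?index_enum_uniq //.
  by apply: eq_bigr => l _; rewrite -zpowD; congr zpow; rewrite mxE.
by move=> l l' _; apply: zpow_commute; apply: commute_sym; apply: zpow_commute.
Qed.

Lemma free_central f v : commute (central_part v) (free_part f).
Proof.
apply: commute_prod => i _; apply: commute_sym; apply: commute_prod => l _.
apply: commute_sym; apply: zpow_commute.
apply: commute_sym; apply: (gen_commutel (A := range (@x i)) (B := [set cc l])) => //.
  by move=> _ _ [a _ <-] ->; apply: commute_sym.
exact: flift_gen.
Qed.

Lemma recompM : {morph recomp : u v / u * v}.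
Proof.
move=> u v; rewrite /recomp free_partM central_partM -!mulgA; congr (_ * _).
by rewrite !mulgA; congr (_ * _); exact: esym (free_central _ _).
Qed.

Lemma flift1 (T : choiceType) (f : T -> G) : flift f 1 = 1.
Proof. exact: morph1g (fliftM f). Qed.

Lemma decompK : cancel decomp recomp.
Proof.
move=> g; have cM : {morph (fun g => recomp (decomp g)) : g h / g * h}.
  by move=> a b; rewrite decompM recompM.
apply: (morph_eq_gen cM _ _ (xcc_gen g)) => //.
move=> _ [[i [a ->]]|[l ->]]; rewrite /recomp /free_part /central_part /=.
  rewrite (@prodg_single _ _ _ i) => [|j ji]; last by rewrite Phi_x1 1?eq_sym // flift1.
  rewrite Phi_x flift_fgen big1 ?mulg1 // => l _.
  by rewrite mxE omega_x.
rewrite big1 ?mul1g => [|i _]; last by rewrite Phi_cc flift1.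
rewrite (@prodg_single _ _ _ l) => [|l' l'l]; last by rewrite mxE omega_cc (negPf l'l).
by rewrite mxE omega_cc eqxx /= expg1.
Qed.

Lemma recompK : cancel recomp decomp.
Proof.
move=> [f v]; congr pair.
  apply/functional_extensionality_dep => i; rewrite /recomp PhiM /free_part /central_part /=.
  rewrite (morph_prodg (@PhiM i)) (morph_prodg (@PhiM i)).
  rewrite [X in _ * X]big1 ?mulg1 => [|l _]; last first.
    by rewrite (morph_zpow (@PhiM i)) Phi_cc; case: (_ 0%R l) => n /=; rewrite expg1n ?invg1.
  rewrite (@prodg_single _ _ _ i) => [|j ji].
    apply: (morph_eq_gen (f := fun g => @Phi i (flift (@x i) g)) (f' := fun g => g) _ _ _ (free_group_gen (f i))) => //.
      by move=> a b; rewrite fliftM PhiM.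
    by move=> _ [a _ <-]; rewrite flift_fgen Phi_x.
  apply: (morph_eq_gen (f := fun g => @Phi i (flift (@x j) g)) (f' := fun=> 1) _ _ _ (free_group_gen (f j))).
  - by move=> a b; rewrite fliftM PhiM.
  - by move=> a b; rewrite mulg1.
  - by move=> _ [a _ <-]; rewrite flift_fgen Phi_x1.
apply/rowP => l; rewrite mxE /recomp omegaM /free_part /central_part /=.
rewrite (morph_prodg (@omegaM l)) (morph_prodg (@omegaM l)) big1 ?mul1g => [|i _]; last first.
  apply: (morph_eq_gen (f := fun g => omega l (flift (@x i) g)) (f' := fun=> 1) _ _ _ (free_group_gen (f i))).
  - by move=> a b; rewrite fliftM omegaM.
  - by move=> a b; rewrite mulg1.
  - by move=> _ [a _ <-]; rewrite flift_fgen omega_x.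
rewrite (@prodg_single _ _ _ l) => [|l' l'l].
  by rewrite (morph_zpow (@omegaM l)) omega_cc eqxx zpow_int.
rewrite (morph_zpow (@omegaM l)) omega_cc eq_sym (negPf l'l).
by case: (_ 0%R l') => n /=; rewrite (expg1n (Algebra.to_multiplicative int)) ?invg1.
Qed.

HB.instance Definition _ := isMultiplicative.Build G H decomp decompM.

(** Commutation of the generators makes [recomp] a morphism, generation makes it a left inverse of
    [decomp], and the duality of [Phi] and [omega] with the generators makes it a right inverse. *)
Lemma decomp_isomorphic : isomorphic G H.
Proof. by exists decomp; exists recomp; [exact: decompK|exact: recompK]. Qed.

End ProductDecomposition.

(** * Conjugation and the central product in one pencil *)

Section PencilRelations.
Variables (G : groupType) (T : eqType) (Rt Lt : T -> G) (s : seq T).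
Local Open Scope group_scope.
Hypothesis pre : forall s1 s2, s = s1 ++ s2 ->
  \prod_(c <- s1) Rt c = \prod_(c <- rev s1) Lt c.
Hypothesis suf : forall s1 s2, s = s1 ++ s2 ->
  \prod_(c <- s2) Rt c = \prod_(c <- rev s2) Lt c.

(** The quotient of the prefix relations for [rcons s1 c] and for [s1]. *)
Lemma left_conj s1 c s2 : s = s1 ++ c :: s2 ->
  Lt c = (\prod_(d <- s1) Rt d) * Rt c * (\prod_(d <- s1) Rt d)^-1.
Proof.
move=> es; have := @pre (rcons s1 c) s2; rewrite cat_rcons => /(_ es).
by rewrite rev_rcons big_rcons /= big_cons -(pre es) => ->; rewrite mulgK.
Qed.

Lemma left_conj_suffix s1 c s2 : s = s1 ++ c :: s2 ->
  Lt c = (\prod_(d <- s2) Rt d)^-1 * Rt c * \prod_(d <- s2) Rt d.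
Proof.
move=> es; have es' : s = rcons s1 c ++ s2 by rewrite cat_rcons.
have := suf es; rewrite rev_cons big_rcons /= big_cons -(suf es') => h.
by rewrite -mulgA h mulKg.
Qed.

(** With [C = a * Rt d * b] the two conjugation formulas read [Lt d = a * Rt d * a^-1] and
    [Lt d = b^-1 * Rt d * b], so [C * Lt d] and [Lt d * C] are both [a * Rt d * Rt d * b]. The
    passage from [Lt] to [Rt] goes along [s]: the conjugator of [Lt d] is a product of earlier [Rt],
    already known to commute with [C]. *)
Lemma pencil_central c : c \in s -> commute (\prod_(d <- s) Rt d) (Rt c).
Proof.
move=> cs; set C := \prod_(d <- s) Rt d.
have CL s1 d s2 : s = s1 ++ d :: s2 -> commute C (Lt d).
  move=> es; have h1 := left_conj es; have h2 := left_conj_suffix es.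
  rewrite /C es big_cat big_cons /=; move: h1 h2.
  move: (\prod_(_ <- s1) _) (\prod_(_ <- s2) _) => a b h1 h2.
  have e1 : a * (Rt d * b) = Lt d * (a * b) by rewrite h1 !mulgA mulgVK.
  have e2 : a * (Rt d * b) = (a * b) * Lt d by rewrite h2 !mulgA mulgK.
  by rewrite /commute {1}e1 -mulgA -e2.
suff H s1 s2 : s = s1 ++ s2 -> forall d, d \in s1 -> commute C (Rt d).
  by apply: (H s [::]); rewrite ?cats0.
elim/last_ind: s1 s2 => [//|s1 d IH] s2; rewrite cat_rcons => es e.
rewrite mem_rcons inE => /orP[/eqP ->|]; last exact: IH es e.
have : commute C (\prod_(d <- s1) Rt d).
  rewrite big_seq; apply: commute_prod => f; exact: IH es f.
move/commuteJ; apply; rewrite -(left_conj es); exact: CL es.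
Qed.

End PencilRelations.

Section PencilsCommute.
Variables (R : realType) (G : groupType) (T I : finType) (pen : T -> I) (m : T -> R).
Variables (Rt Lt : T -> G).
Local Open Scope group_scope.
Hypothesis Lt_conj : forall c, exists2 w,
  gen [set h | exists d, [/\ pen d = pen c, (m d < m c)%R & h = Rt d]] w &
  Lt c = w * Rt c * w^-1.
Hypothesis crossing : forall c d, pen c != pen d -> exists b b' : bool,
  commute (if b then Rt c else Lt c) (if b' then Rt d else Lt d).

(* Induction on the slopes of [c] and [d]: one of the meridians [Rt c], [Lt c]
   commutes with one of [Rt d], [Lt d], and [Lt] is conjugate to [Rt] by meridians
   of smaller slope in the same pencil, which commute with the other line by
   induction. *)
Lemma pencils_commute c d : pen c != pen d -> commute (Rt c) (Rt d).
Proof.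
have [n] := ubnP #|[set e | (m e < m c)%R]%SET|; elim: n c d => // n IH c d cn.
have [k] := ubnP #|[set e | (m e < m d)%R]%SET|; elim: k d => // k IHd d dk cd.
have below (e f : T) : (m e < m f)%R ->
    (#|[set g | (m g < m e)%R]%SET| < #|[set g | (m g < m f)%R]%SET|)%N.
  move=> ef; apply: proper_card; apply/properP; split.
    by apply/fintype.subsetP => g; rewrite !inE => ge; exact: lt_trans ge ef.
  by exists e; rewrite !inE ?ltxx.
have Qc e f : (m e < m c)%R -> pen e != pen f -> commute (Rt e) (Rt f).
  by move=> ec; apply: IH; apply: leq_trans (below _ _ ec) _; rewrite -ltnS.
have Qd e : (m e < m d)%R -> pen e = pen d -> commute (Rt c) (Rt e).
  move=> ed pe; apply: IHd; last by rewrite pe.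
  by apply: leq_trans (below _ _ ed) _; rewrite -ltnS.
have [dc|cd'] := boolP (m d < m c)%R.
  by apply: commute_sym; apply: Qc; rewrite // eq_sym.
have [w wgen wL] := Lt_conj c; have [v vgen vL] := Lt_conj d.
have cv : commute (Rt c) v.
  apply: commute_sym; apply: (gen_commutel (B := [set Rt c])) vgen _ => //.
  move=> _ _ [e [pe me ->]] ->; apply: commute_sym; exact: Qd.
have wd e : pen e = pen d -> commute w (Rt e).
  move=> pe; apply: (gen_commutel (B := [set Rt e])) wgen _ => //.
  by move=> _ _ [f [pf mf ->]] ->; apply: Qc => //; rewrite pf pe.
have wv : commute w v.
  apply: commute_sym; apply: (gen_commutel (B := [set w])) vgen _ => //.
  by move=> _ _ [e [pe _ ->]] ->; apply: commute_sym; exact: wd.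
have [b [b' h]] := crossing cd.
have wY : commute (if b' then Rt d else Lt d) w.
  apply: commute_sym; case: (b'); first exact: wd.
  by rewrite vL; apply: commuteM; [apply: commuteM => //; exact: wd|exact: commuteV].
have : commute (Rt c) (if b' then Rt d else Lt d).
  apply: commute_sym; move/commute_sym: h; case: b => //.
  by rewrite wL; exact: commuteJ.
by case: (b') => //; rewrite vL; exact: commuteJ.
Qed.

End PencilsCommute.

(** * Cuts attached to a parallel class and to a pencil *)

Section LineCuts.
Variables (R : realType) (T : finType) (m q : T -> R).
Local Notation V := ((R * R) * (R * R))%type.
Local Notation O := (arrangement_space m q).
Local Notation Z := (set_type O).
Local Notation lform := (lform m q).
Local Notation dform := (dform m).
Local Notation genx := (genx m q).
Local Notation geny := (geny m).
Local Notation above := (above m q).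
Local Notation on_line := (on_line m q).
Local Notation clean := (clean m q).
Local Notation up := (up R).
Local Notation down := (down R).
Implicit Types (P x y : R * R) (c d : T) (A S : {set T}) (u : R).
Variables (z : Z) (x0 : R * R).
Local Notation xmove := (xmove z x0).
Local Notation line_edge := (line_edge z x0).
Variable G : groupType.

(** The samples in [edge] may lie anywhere in their chambers, while the cuts depend on coordinates;
    here both points have the abscissa [u]. *)
Lemma line_edge_cross c u : clean c u -> exists x x',
  [/\ genx x, genx x', x.1 = u & x'.1 = u] /\
  [/\ above x = above (on_line c u), above x' = c |: above (on_line c u) &
      line_edge c u = xmove up x x'].
Proof.
move=> cu.
have e0 d : (lform d (on_line c u) == 0) = (d == c).
  have [->|dc] := eqVneq d c; first by rewrite lform_on_line0 eqxx.
  exact/negbTE/cu.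
have [|e [ge ae]] := @above_near R T m q (on_line c u) down.
  by move=> d _; exact: geny_down.
have [|e' [ge' ae']] := @above_near R T m q (on_line c u) up.
  by move=> d _; exact: geny_up.
eexists; eexists; split; first split; [exact: ge|exact: ge'| | |].
- by rewrite /= mulr0 addr0.
- by rewrite /= mulr0 addr0.
have ax : above ((on_line c u).1 + e * down.1, (on_line c u).2 + e * down.2) = above (on_line c u).
  by rewrite ae; apply/setP => d; rewrite !inE dform_down oppr_gt0 ltr10 andbF orbF.
have ax' : above ((on_line c u).1 + e' * up.1, (on_line c u).2 + e' * up.2) = c |: above (on_line c u).
  by rewrite ae'; apply/setP => d; rewrite !inE dform_up ltr01 andbT e0 orbC.
split=> //; rewrite (@xmove_cross _ _ _ _ _ _ _ _ _ c) ?ax //; last first.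
- by rewrite inE lform_on_line0 ltxx.
- exact: geny_up.
by rewrite dform_up ltr01.
Qed.

(** Under [X2 - m0 * X1] the lines of [S] become real points of the complex line. The cut is the
    preimage of the real axis, and its pieces are the intervals between these points. *)
Lemma parallel_morphism S (m0 : R) (h : {set T} -> G) :
  (forall c, c \in S -> m c = m0) -> h finset.set0 = 1%g ->
  exists2 f : pi1 R z -> G, {morph f : g g' / (g * g')%g} &
  forall c u, clean c u -> f (line_edge c u) =
    ((h (above (on_line c u) :&: S))^-1 * h ((c |: above (on_line c u)) :&: S))%g.
Proof.
move=> Sm h0; have [c1 c2 c3 c4] := coordinates_continuous R.
pose s (a : V) : R := a.2.2 - m0 * a.2.1.
(* The value [-1] never vanishes and keeps the lines outside [S] out of every label. *)
pose phi c (a : V) : R := if c \in S then lform c a.1 else -1.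
have cs : continuous s.
  by apply: continuous_sub => //; apply: continuous_mul => //; exact: continuous_const.
have cphi c : continuous (phi c).
  rewrite /phi; case: (c \in S); last exact: continuous_const.
  exact: lform_continuous.
have sE c a : c \in S -> s a = dform c a.2 by move=> cS; rewrite /s /dform Sm.
have nz a : O a -> s a = 0 -> forall c, phi c a != 0.
  move=> Oa sa c; rewrite /phi; case: ifP => [cS|_]; last by rewrite oppr_eq0 oner_eq0.
  by have := Oa c; rewrite -(sE _ _ cS) sa eqxx orbF.
have lx x y : genx x -> s (x, y) = 0 -> cut_label phi (x, y) = above x :&: S.
  move=> gx _; apply/setP => c; rewrite !inE /phi andbC.
  by case: (c \in S) => //; rewrite oppr_gt0 ltr10.
have ly x y : geny y -> s (x, y) = 0 -> cut_label phi (x, y) = finset.set0.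
  move=> gy sy; apply/setP => c; rewrite !inE /phi; case: ifP => cS.
    by have := gy c; rewrite -(sE c (x, y) cS) sy eqxx.
  by rewrite oppr_gt0 ltr10.
have [f fM fE] := cut_morphism h cs cphi nz lx ly z x0.
exists f => // c u cu.
have [x [x' [[gx gx' _ _] [ax ax' ->]]]] := line_edge_cross cu.
rewrite fE //; last exact: geny_up.
have su w : (s (w, up) < 0) = false.
  by apply/negbTE; rewrite -leNgt /s /= mulr0 subr0 ler01.
have sd w : s (w, down) < 0 by rewrite /s /= mulr0 subr0 oppr_lt0 ltr01.
rewrite /cut_word /cut_weight !su !sd !h0 ax ax'.
by rewrite !(invg1, mulg1, mul1g).
Qed.

(** The slope of the line to [P] maps the complement to the projective line without the real points
    given by [S], with [b] in the role of infinity; the cut is the preimage of the remaining real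
    points. For [P.1 < u] the function [s] is positive at [up] and negative at [down]. *)
Lemma pencil_morphism P S b (h : {set T} -> G) :
  b \in S -> (forall c, c \in S -> lform c P = 0) -> h finset.set0 = 1%g ->
  let lab A := [set d in S | (d \in A) != (b \in A)]%SET in
  exists2 f : pi1 R z -> G, {morph f : g g' / (g * g')%g} &
  forall c u, clean c u -> P.1 < u -> f (line_edge c u) =
    ((h (lab (above (on_line c u))))^-1 * h (lab (c |: above (on_line c u))))%g.
Proof.
move=> bS SP h0 lab; have [c1 c2 c3 c4] := coordinates_continuous R.
(* The imaginary part of [conj (X1 - P.1) * (X2 - P.2)]: it vanishes where the slope is real or
   infinite. *)
pose s (a : V) : R := (a.1.1 - P.1) * a.2.2 - (a.1.2 - P.2) * a.2.1.
(* The real part of [L c * conj (L b)], where [L c] has real part [lform c] and imaginary part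
   [dform c]. On the cut [L c] is a real multiple of [L b], and the label collects the lines for
   which the factor is negative. *)
pose re c (a : V) : R := lform c a.1 * lform b a.1 + dform c a.2 * dform b a.2.
pose phi c (a : V) : R := if c \in S then - re c a else -1.
have cl c := @lform_continuous R T m q c.
have cd c := @dform_continuous R T m c.
have ck := @continuous_const R V.
have cs : continuous s.
  by apply: continuous_sub; apply: continuous_mul => //; apply: continuous_sub.
have cphi c : continuous (phi c).
  rewrite /phi; case: (c \in S) => //.
  have -> : (fun a => - re c a) = (fun a => 0 - re c a) by apply/funext => a; rewrite sub0r.
  by apply: continuous_sub => //; apply: continuous_add; apply: continuous_mul.
have det c a : c \in S -> s a = 0 -> lform c a.1 * dform b a.2 = dform c a.2 * lform b a.1.
  move=> cS sa; have l0 e : e \in S -> lform e a.1 = (a.1.2 - P.2) - m e * (a.1.1 - P.1).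
    by move=> /SP; rewrite /lform => eP; rewrite -[LHS]subr0 -eP; ring.
  apply/eqP; rewrite -subr_eq0 !l0 // /dform.
  have -> : (a.1.2 - P.2 - m c * (a.1.1 - P.1)) * (a.2.2 - m b * a.2.1) -
     (a.2.2 - m c * a.2.1) * (a.1.2 - P.2 - m b * (a.1.1 - P.1)) =
     (m b - m c) * s a by rewrite /s; ring.
  by rewrite sa mulr0.
(* Lagrange's identity with vanishing cross term; it shows that [re c] is nonzero on the cut. *)
have re_mul (A B C D : R) : A * D = B * C ->
    (A * C + B * D) ^+ 2 = (A ^+ 2 + B ^+ 2) * (C ^+ 2 + D ^+ 2).
  move=> e; transitivity ((A * C + B * D) ^+ 2 + (A * D - B * C) ^+ 2); last by ring.
  by rewrite e subrr expr0n addr0.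
have nz a : O a -> s a = 0 -> forall c, phi c a != 0.
  move=> Oa sa c; rewrite /phi; case: ifP => [cS|_]; last by rewrite oppr_eq0 oner_eq0.
  rewrite oppr_eq0 -sqrf_eq0 /re re_mul ?det // mulf_neq0 //.
    by rewrite paddr_eq0 ?sqr_ge0 // !sqrf_eq0 negb_and (Oa c).
  by rewrite paddr_eq0 ?sqr_ge0 // !sqrf_eq0 negb_and (Oa b).
have pos_sign (X Y : R) : 0 < X * Y -> (0 < X) = (0 < Y).
  by move=> XY; apply/idP/idP => h1; [rewrite -(pmulr_rgt0 _ h1)|rewrite -(pmulr_lgt0 _ h1)].
pose labx x : {set T} := [set c in S | lform c x * lform b x < 0]%SET.
pose laby y : {set T} := [set c in S | dform c y * dform b y < 0]%SET.
have sq0 (X : R) : X != 0 -> 0 < X ^+ 2 by move=> X0; rewrite lt_neqAle sqr_ge0 eq_sym sqrf_eq0 X0.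
have lx x y : genx x -> s (x, y) = 0 -> cut_label phi (x, y) = labx x.
  move=> gx sxy; apply/setP => c; rewrite !inE /phi; case: ifP => cS /=; last first.
    by rewrite oppr_gt0 ltr10.
  (* [re c] and the product of the two [lform] have the same sign: on the cut their product is a sum
     of two squares. *)
  rewrite -[RHS]oppr_gt0; apply: pos_sign; rewrite mulrNN /re /=.
  have e := det c (x, y) cS sxy; rewrite /= in e.
  have -> : (lform c x * lform b x + dform c y * dform b y) * (lform c x * lform b x) =
     (lform c x * lform b x) ^+ 2 + (lform c x * dform b y) ^+ 2.
    by rewrite [X in _ = _ + X]expr2 [X in _ = _ + _ * X]e; ring.
  by rewrite ltr_pwDl ?sqr_ge0 // sq0 // mulf_neq0.
have ly x y : geny y -> s (x, y) = 0 -> cut_label phi (x, y) = laby y.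
  move=> gy sxy; apply/setP => c; rewrite !inE /phi; case: ifP => cS /=; last first.
    by rewrite oppr_gt0 ltr10.
  rewrite -[RHS]oppr_gt0; apply: pos_sign; rewrite mulrNN /re /=.
  have e := det c (x, y) cS sxy; rewrite /= in e.
  have -> : (lform c x * lform b x + dform c y * dform b y) * (dform c y * dform b y) =
     (dform c y * dform b y) ^+ 2 + (lform c x * dform b y) ^+ 2.
    by rewrite [X in _ = _ + X]expr2 [X in _ = _ + _ * X]e; ring.
  by rewrite ltr_pwDl ?sqr_ge0 // sq0 // mulf_neq0.
have [f fM fE] := cut_morphism h cs cphi nz lx ly z x0.
exists f => // c u cu Pu.
have [x [x' [[gx gx' xu xu'] [ax ax' ->]]]] := line_edge_cross cu.
rewrite fE //; last exact: geny_up.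
have su w : w.1 = u -> (s (w, up) < 0) = false.
  move=> wu; apply/negbTE; rewrite -leNgt /s /= wu mulr0 subr0 mulr1.
  by rewrite subr_ge0 ltW.
have sd w : w.1 = u -> s (w, down) < 0.
  by move=> wu; rewrite /s /= wu mulr0 subr0 mulrN1 oppr_lt0 subr_gt0.
have ld : laby down = finset.set0.
  by apply/setP => d; rewrite !inE !dform_down mulrNN mulr1 ltNge ler01 andbF.
have labE w : genx w -> labx w = lab (above w).
  move=> gw; apply/setP => d; rewrite !inE; congr (_ && _).
  have := gw d; have := gw b; rewrite !neq_lt => /orP[b0|b0] /orP[d0|d0].
  - by rewrite (lt_gtF b0) (lt_gtF d0); apply/lt_gtF; rewrite nmulr_lgt0.
  - by rewrite (lt_gtF b0) d0 pmulr_rlt0.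
  - by rewrite (lt_gtF d0) b0 pmulr_llt0.
  - by rewrite b0 d0; apply/lt_gtF; rewrite mulr_gt0.
rewrite /cut_word /cut_weight !su // !sd // ld h0 !labE // ax ax'.
by rewrite !(invg1, mulg1, mul1g).
Qed.

End LineCuts.

(** * The fundamental group of the affine complement *)

Lemma pairwise_total (T : eqType) (r : rel T) (s : seq T) c d :
  pairwise r s -> c \in s -> d \in s -> c != d -> r c d || r d c.
Proof.
elim: s => // a s IH /= /andP[/allP as_ ps]; rewrite !inE.
move=> /orP[/eqP ->|cs] /orP[/eqP ->|ds] cd; first by rewrite eqxx in cd.
- by rewrite as_.
- by rewrite as_ // orbT.
- exact: IH.
Qed.

Section AffineArrangement.
Variables (R : realType) (T : finType) (m q : T -> R) (t : nat).
Variables (pen : T -> 'I_t.+1) (ln : 'I_t.+1 -> seq T) (P : 'I_t.+1 -> R * R).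
Variables (k : 'I_t.+1 -> nat) (m0 : R).
Local Notation Z := (set_type (arrangement_space m q)).
Local Notation lform := (lform m q).
Local Notation above := (above m q).
Local Notation steeper := (steeper m).
Local Notation on_line := (on_line m q).
Local Notation clean := (clean m q).
Local Notation doubles := (doubles m q).
Implicit Types (c d e : T) (u v a b : R) (i : 'I_t.+1) (s : seq T).
Hypothesis ln_mem : forall i c, (c \in ln i) = (pen c == i).
Hypothesis ln0 : pairwise [rel c d | q c < q d] (ln ord0).
Hypothesis lnS : forall i, i != ord0 -> pairwise steeper (ln i).
Hypothesis m0P : forall c, pen c = ord0 -> m c = m0.
Hypothesis PP : forall i c, i != ord0 -> (pen c == i) = (lform c (P i) == 0).
Hypothesis slopes : forall c d, pen c != pen d -> m c != m d.
Hypothesis dbl : forall c d e X, pen c != pen d ->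
  lform c X = 0 -> lform d X = 0 -> lform e X = 0 -> (e == c) || (e == d).
Hypothesis size0 : size (ln ord0) = k ord0.
Hypothesis sizeS : forall i, i != ord0 -> size (ln i) = (k i).+1.
Hypothesis k_gt0 : forall i, i != ord0 -> (0 < k i)%N.
Variables (z : Z) (x0 : R * R).
Local Notation edge := (edge z x0).
Local Notation line_edge := (line_edge z x0).
Local Notation Px c := (P (pen c)).1.

Lemma mq_inj c d : m c = m d -> q c = q d -> c = d.
Proof.
move=> mcd qcd; apply/eqP; apply: contraT => cd.
have [pcd|/slopes/eqP//] := eqVneq (pen c) (pen d).
have cl : c \in ln (pen d) by rewrite ln_mem pcd.
have dl : d \in ln (pen d) by rewrite ln_mem.
have [p0|p0] := eqVneq (pen d) ord0.
  rewrite p0 in cl dl; have := pairwise_total ln0 cl dl cd.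
  by rewrite /= qcd ltxx.
by have := pairwise_total (lnS p0) cl dl cd; rewrite /steeper /= mcd ltxx.
Qed.

Lemma clean_in c a b : a < b -> exists2 u, a < u < b & clean c u.
Proof.
move=> ab; have [u aub uF] := avoid_finite (fun d => (q d - q c) / (m c - m d)) ab.
exists u => // d dc; rewrite lform_on_line; have [mcd|mcd] := eqVneq (m c) (m d).
  rewrite mcd subrr mul0r add0r subr_eq0; apply: contraNneq dc => qcd.
  by apply/eqP; apply: mq_inj.
have k0 : m c - m d != 0 by rewrite subr_eq0.
apply: contraNneq (uF d) => e; apply/eqP; apply: (mulIf k0); rewrite divfK //.
by apply/eqP; rewrite -subr_eq0 -e; apply/eqP; ring.
Qed.

(** For the parallel pencil, where [P ord0] is an arbitrary point, the right and left edges agree by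
    [left_parallel]. *)
Definition right_pos c : R := xget 0 [set u | Px c < u /\ clean c u].
Definition left_pos c : R := xget 0 [set u | u < Px c /\ clean c u].
Definition right_edge c : pi1 R z := line_edge c (right_pos c).
Definition left_edge c : pi1 R z := line_edge c (left_pos c).

Lemma right_posP c : Px c < right_pos c /\ clean c (right_pos c).
Proof.
have [u /andP[u1 _] cu] := @clean_in c (Px c) (Px c + 1) ltac:(by rewrite ltrDl).
by rewrite /right_pos; case: xgetP => [_ -> []//|/(_ u)]; case.
Qed.

Lemma left_posP c : left_pos c < Px c /\ clean c (left_pos c).
Proof.
have [u /andP[_ u1] cu] := @clean_in c (Px c - 1) (Px c) ltac:(by rewrite gtrBl).
by rewrite /left_pos; case: xgetP => [_ -> []//|/(_ u)]; case.
Qed.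

Lemma pencil_vanish c d u : pen d = pen c -> pen c != ord0 ->
  lform d (on_line c u) = (m c - m d) * (u - Px c).
Proof.
move=> pdc p0; set X := P (pen c).
have hc : lform c X = 0 by apply/eqP; rewrite -PP.
have hd : lform d X = 0 by apply/eqP; rewrite -PP // pdc.
rewrite lform_on_line; apply/eqP; rewrite -subr_eq0; apply/eqP.
transitivity (lform d X - lform c X); last by rewrite hc hd subrr.
by rewrite /lform; ring.
Qed.

(** On a crossing with another pencil [dbl] allows no third line; lines of one pencil meet only at
    their multiple point, or nowhere if they are parallel. *)
Lemma doublesP c a b : (pen c != ord0 -> ~~ (a < Px c < b)) -> doubles c a b.
Proof.
move=> noP u d e aub dc ec d0 e0.
have [pdc|pdc] := eqVneq (pen d) (pen c); last first.
  have := @dbl c d e (on_line c u); rewrite eq_sym pdc lform_on_line0 => /(_ isT erefl d0 e0).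
  by rewrite (negPf ec) => /eqP.
have mcd : m c != m d.
  have [p0|p0] := eqVneq (pen c) ord0.
    apply: contraNneq dc => mcd; apply/eqP; apply: mq_inj => //.
    by move: d0; rewrite lform_on_line mcd subrr mul0r add0r => /eqP; rewrite subr_eq0 => /eqP.
  have cl : c \in ln (pen c) by rewrite ln_mem.
  have dl : d \in ln (pen c) by rewrite ln_mem pdc.
  have := pairwise_total (lnS p0) cl dl; rewrite eq_sym => /(_ dc).
  by rewrite /steeper /= -neq_lt.
have [p0|p0] := eqVneq (pen c) ord0.
  by move: mcd; rewrite (m0P p0) m0P ?eqxx // pdc.
move: d0; rewrite pencil_vanish // => /eqP; rewrite mulf_eq0 !subr_eq0 (negPf mcd) /=.
by move=> /eqP uP; move: (noP p0); rewrite -uP aub.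
Qed.

Lemma line_edge_eq c u v : clean c u -> clean c v ->
  doubles c (Num.min u v) (Num.max u v) -> line_edge c u = line_edge c v.
Proof.
move=> cu cv; case: (ltgtP u v) => [uv|vu|->//] dd.
  exact: (line_edge_const z x0 mq_inj cu cv uv dd).
exact/esym/(line_edge_const z x0 mq_inj cv cu vu dd).
Qed.

Lemma right_edgeE c u : Px c < u -> clean c u -> line_edge c u = right_edge c.
Proof.
move=> Pu cu; have [Pr cr] := right_posP c; apply: line_edge_eq => //.
by apply: doublesP => _; rewrite gt_min negb_and; apply/orP; left; rewrite negb_or -!leNgt !ltW.
Qed.

Lemma left_edgeE c u : u < Px c -> clean c u -> line_edge c u = left_edge c.
Proof.
move=> uP cu; have [lP cl] := left_posP c; apply: line_edge_eq => //.
by apply: doublesP => _; rewrite lt_max negb_and; apply/orP; right; rewrite negb_or -!leNgt !ltW.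
Qed.

Lemma edge_parallel c u : pen c = ord0 -> clean c u -> line_edge c u = right_edge c.
Proof.
move=> p0 cu; have [_ cr] := right_posP c; apply: line_edge_eq => //.
by apply: doublesP; rewrite p0 eqxx.
Qed.

Lemma left_parallel c : pen c = ord0 -> left_edge c = right_edge c.
Proof. by move=> p0; have [_ cl] := left_posP c; exact: edge_parallel. Qed.

Lemma line_edge_cases c u : clean c u ->
  line_edge c u = right_edge c \/ line_edge c u = left_edge c.
Proof.
move=> cu; have [uP|Pu|uP] := ltgtP u (Px c).
- by right; exact: left_edgeE.
- by left; exact: right_edgeE.
have [p0|p0] := eqVneq (pen c) ord0; first by left; exact: edge_parallel.
(* At the abscissa of the multiple point [c] cannot be clean: by [k_gt0] a second line of the pencil
   passes there. *)
have : has (fun d => d != c) (ln (pen c)).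
  apply: contraT; rewrite -all_predC => /allP h.
  have : (size (ln (pen c)) <= size [:: c])%N.
    apply: uniq_leq_size; last by move=> d /h /=; rewrite negbK inE.
    by apply: pairwise_uniq (lnS p0) => d; rewrite /steeper /= ltxx.
  by rewrite sizeS //= ltnNge k_gt0.
move=> /hasP[d]; rewrite ln_mem => /eqP pd dc.
by have := cu d dc; rewrite pencil_vanish // uP subrr mulr0 eqxx.
Qed.

Section Pencil.
Variable i : 'I_t.+1.
Hypothesis i0 : i != ord0.

Lemma pencil_memP c : (c \in ln i) = (lform c (P i) == 0).
Proof. by rewrite ln_mem PP. Qed.

Lemma right_edge_pencil s1 c s2 : ln i = s1 ++ c :: s2 ->
  right_edge c = edge c (above (P i) :|: [set d in s1]).
Proof.
move=> es; have [] := right_posP c.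
have pci : pen c = i by apply/eqP; rewrite -ln_mem es mem_cat mem_head orbT.
rewrite pci => Pr cr.
have ps := lnS i0; have sP := pencil_memP; rewrite es in ps sP.
rewrite -(line_edge_right z x0 mq_inj ps sP Pr cr) //.
apply: doublesP => _; rewrite negb_and -!leNgt.
by rewrite pci lexx.
Qed.

Lemma left_edge_pencil s1 c s2 : ln i = s1 ++ c :: s2 ->
  left_edge c = edge c (above (P i) :|: [set d in s2]).
Proof.
move=> es; have [] := left_posP c.
have pci : pen c = i by apply/eqP; rewrite -ln_mem es mem_cat mem_head orbT.
rewrite pci => lP cl.
have ps := lnS i0; have sP := pencil_memP; rewrite es in ps sP.
rewrite -(line_edge_left z x0 mq_inj ps sP lP cl) //.
apply: doublesP => _; rewrite negb_and -!leNgt.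
by rewrite pci lexx orbT.
Qed.

Lemma right_product s1 s2 s3 : ln i = s1 ++ s2 ++ s3 ->
  edge_prod z x0 predT (above (P i) :|: [set d in s1]) s2 = (\prod_(c <- s2) right_edge c)%g.
Proof.
elim: s2 s1 => [|c s2 IH] s1 es; first by rewrite big_nil.
rewrite big_cons /= (right_edge_pencil es) -(IH (rcons s1 c)); last first.
  by rewrite cat_rcons es.
congr (_ * edge_prod _ _ _ _ _)%g; apply/setP => d.
by rewrite !inE mem_rcons inE orbCA.
Qed.

Lemma left_product s1 s2 s3 : ln i = s1 ++ s2 ++ s3 ->
  edge_prod z x0 predT (above (P i) :|: [set d in s3]) (rev s2) = (\prod_(c <- rev s2) left_edge c)%g.
Proof.
elim/last_ind: s2 s3 => [|s2 c IH] s3 es; first by rewrite big_nil.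
have es' : ln i = (s1 ++ s2) ++ c :: s3 by rewrite es cat_rcons catA.
rewrite rev_rcons big_cons /= (left_edge_pencil es') -(IH (c :: s3)); last first.
  by rewrite es' catA.
congr (_ * edge_prod _ _ _ _ _)%g; apply/setP => d.
by rewrite !inE orbCA.
Qed.

Lemma pencil_prefix s1 s2 : ln i = s1 ++ s2 ->
  (\prod_(c <- s1) right_edge c)%g = (\prod_(c <- rev s1) left_edge c)%g.
Proof.
move=> es; rewrite -(@right_product [::] s1 s2) // -(@left_product [::] s1 s2) //.
rewrite -(vertex_prefix z x0 (lnS i0) pencil_memP es); congr edge_prod.
by apply/setP => d; rewrite !inE orbF.
Qed.

Lemma pencil_suffix s1 s2 : ln i = s1 ++ s2 ->
  (\prod_(c <- s2) right_edge c)%g = (\prod_(c <- rev s2) left_edge c)%g.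
Proof.
move=> es; rewrite -(@right_product s1 s2 [::]) ?cats0 // -(@left_product s1 s2 [::]) ?cats0 //.
rewrite (vertex_suffix z x0 (lnS i0) pencil_memP es); congr edge_prod.
by apply/setP => d; rewrite !inE orbF.
Qed.

End Pencil.

(** The conjugator is the product over the lines preceding [c] in its pencil; their smaller slopes
    drive the induction in [pencils_commute]. *)
Lemma left_edge_conj c : exists2 w,
  gen [set h | exists d, [/\ pen d = pen c, m d < m c & h = right_edge d]] w &
  left_edge c = (w * right_edge c * w^-1)%g.
Proof.
have [p0|p0] := eqVneq (pen c) ord0.
  by exists 1%g; [exact: gen1|rewrite left_parallel // mul1g invg1 mulg1].
have : c \in ln (pen c) by rewrite ln_mem.
case/splitPr es : _ / => [s1 s2].
exists (\prod_(d <- s1) right_edge d)%g; last first.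
  by apply: (left_conj (pencil_prefix p0)); exact: es.
rewrite big_seq; apply: gen_prod => d ds1; apply: sub_gen; exists d; split=> //.
  by apply/eqP; rewrite -ln_mem es mem_cat ds1.
have := lnS p0; rewrite es pairwise_cat => /and3P[/allrelP h _ _].
by apply: h; rewrite ?mem_head.
Qed.

(** The crossing may lie on either side of the multiple points of [c] and of [d], hence the two
    booleans. *)
Lemma crossing_commute c d : pen c != pen d -> exists b b' : bool,
  commute (if b then right_edge c else left_edge c) (if b' then right_edge d else left_edge d).
Proof.
move=> pcd; have mcd := slopes pcd.
have k0 : m c - m d != 0 by rewrite subr_eq0.
pose X := on_line c (- (q c - q d) / (m c - m d)).
have cX : lform c X = 0 by exact: lform_on_line0.
have dX : lform d X = 0.
  by rewrite /X lform_on_line mulrC divfK // addrC subrr.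
have eX e : (lform e X == 0) = (e == c) || (e == d).
  apply/eqP/orP => [eX|[/eqP ->//|/eqP ->//]]; apply/orP.
  exact: (dbl pcd cX dX eX).
have cd : c != d by apply: contraNneq pcd => ->.
have [u [v [_ _ [cu dv] uv]]] := double_edges z x0 mq_inj cd eX (ltac:(by rewrite ltrDl) : X.1 < X.1 + 1).
have [b ub] : exists b : bool, line_edge c u = if b then right_edge c else left_edge c.
  by have [->|->] := line_edge_cases cu; [exists true|exists false].
have [b' vb] : exists b : bool, line_edge d v = if b then right_edge d else left_edge d.
  by have [->|->] := line_edge_cases dv; [exists true|exists false].
by exists b, b'; rewrite -ub -vb.
Qed.

Lemma right_edges_commute c d : pen c != pen d -> commute (right_edge c) (right_edge d).
Proof. exact: (pencils_commute left_edge_conj crossing_commute). Qed.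

Lemma right_edges_generate g : gen (range right_edge) g.
Proof.
apply: (gen_sub _ (@edges_generate R T m q z x0 mq_inj g)) => _ [c [u [cu ->]]].
have rc d : gen (range right_edge) (right_edge d) by apply: sub_gen; exists d.
have [->//|->] := line_edge_cases cu.
have [w wg ->] := left_edge_conj c.
have {}wg : gen (range right_edge) w.
  by apply: (gen_sub _ wg) => _ [d [_ _ ->]].
by apply: genM; [apply: genM|exact: genV].
Qed.

Lemma ln_uniq i : uniq (ln i).
Proof.
have [->|i0] := eqVneq i ord0.
  by apply: pairwise_uniq ln0 => c /=; rewrite ltxx.
by apply: pairwise_uniq (lnS i0) => c; rewrite /steeper /= ltxx.
Qed.

Lemma ln_pen i c s1 s2 : ln i = s1 ++ c :: s2 -> pen c = i.
Proof. by move=> es; apply/eqP; rewrite -ln_mem es mem_cat mem_head orbT. Qed.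

Lemma split_nth (s : seq T) n : (n < size s)%N ->
  exists s1 c s2, s = s1 ++ c :: s2 /\ size s1 = n.
Proof.
move=> ns; case E : (drop n s) => [|c s2].
  by move/(congr1 size): E; rewrite size_drop /= => /eqP; rewrite subn_eq0 leqNgt ns.
by exists (take n s), c, s2; rewrite -E cat_take_drop size_takel // ltnW.
Qed.

Lemma ltn_size_ln i n : (n < k i)%N -> (n < size (ln i))%N.
Proof.
have [->|i0] := eqVneq i ord0; first by rewrite size0.
by rewrite (sizeS i0) => /ltnW.
Qed.

Lemma ln_last i : i != ord0 -> exists s0 (b : T), ln i = rcons s0 b /\ size s0 = k i.
Proof.
move=> i0; case/lastP E : (ln i) => [|s b]; first by have := sizeS i0; rewrite E.
by exists s, b; split=> //; have := sizeS i0; rewrite E size_rcons => -[].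
Qed.

(** The first [k i] lines are all those of the parallel pencil, and all but the steepest in an
    affine one. The default [1] is never reached. *)
Definition xgen i (a : 'I_(k i)) : pi1 R z := nth 1%g [seq right_edge c | c <- ln i] a.

Definition cgen (l : 'I_t) : pi1 R z := (\prod_(c <- ln (lift ord0 l)) right_edge c)%g.

Lemma xgenE i (a : 'I_(k i)) s1 c s2 : ln i = s1 ++ c :: s2 -> size s1 = a ->
  xgen a = right_edge c.
Proof.
by move=> es sa; rewrite /xgen es map_cat nth_cat size_map sa ltnn subnn.
Qed.

Lemma xgen_split i (a : 'I_(k i)) : exists s1 c s2,
  [/\ ln i = s1 ++ c :: s2, size s1 = a & xgen a = right_edge c].
Proof.
have [s1 [c [s2 [es sa]]]] := split_nth (ltn_size_ln (ltn_ord a)).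
by exists s1, c, s2; split=> //; exact: xgenE es sa.
Qed.

Lemma lift_neq0 (l : 'I_t) : lift ord0 l != ord0. Proof. by []. Qed.

Lemma cgen_right_edge l d : commute (cgen l) (right_edge d).
Proof.
have [pd|pd] := eqVneq (pen d) (lift ord0 l).
  apply: (pencil_central (pencil_prefix (lift_neq0 l)) (pencil_suffix (lift_neq0 l))).
  by rewrite ln_mem pd.
apply: commute_sym; rewrite /cgen big_seq; apply: commute_prod => c.
by rewrite ln_mem => /eqP pc; apply: right_edges_commute; rewrite pc.
Qed.

Lemma xgen_commute i j (a : 'I_(k i)) (b : 'I_(k j)) : i != j -> commute (xgen a) (xgen b).
Proof.
have [s1 [c [s2 [/ln_pen pc _ ->]]]] := xgen_split a.
have [s3 [d [s4 [/ln_pen pd _ ->]]]] := xgen_split b.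
by move=> ij; apply: right_edges_commute; rewrite pc pd.
Qed.

Lemma cgen_xgen l i (a : 'I_(k i)) : commute (cgen l) (xgen a).
Proof. by have [s1 [c [s2 [_ _ ->]]]] := xgen_split a; exact: cgen_right_edge. Qed.

Lemma cgen_commute l l' : commute (cgen l) (cgen l').
Proof. by apply: commute_prod => c _; exact: cgen_right_edge. Qed.

Lemma xgen_cgen_generate g :
  gen [set h | (exists i (a : 'I_(k i)), h = xgen a) \/ (exists l, h = cgen l)] g.
Proof.
set S := [set h | _].
have xS i s1 c s2 : ln i = s1 ++ c :: s2 -> (size s1 < k i)%N -> gen S (right_edge c).
  move=> es sk; apply: sub_gen; left; exists i, (Ordinal sk).
  by rewrite (@xgenE i (Ordinal sk) _ _ _ es).
apply: (gen_sub _ (right_edges_generate g)) => _ [c _ <-].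
have : c \in ln (pen c) by rewrite ln_mem.
case/splitPr es : _ / => [s1 s2]; have [sk|ks] := ltnP (size s1) (k (pen c)).
  exact: xS es sk.
(* What remains is the last line of an affine pencil; its meridian is obtained by dividing the
   central product by the meridians before it. *)
have p0 : pen c != ord0.
  apply: contraTneq ks => p0; move: (es); rewrite p0 => /(congr1 size).
  by rewrite size0 size_cat /= -ltnNge => ->; rewrite addnS ltnS leq_addr.
have [s1k s20] : size s1 = k (pen c) /\ s2 = [::].
  have /(congr1 size) := es; rewrite sizeS // size_cat /= addnS => -[e].
  have : size s2 = 0%N.
    by apply/eqP; rewrite -leqn0 -(leq_add2l (size s1)) addn0 -e.
  by move/size0nil => s20; split=> //; move: e; rewrite s20 /= addn0.
have [l pl] : exists l, pen c = lift ord0 l.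
  by case: (unliftP ord0 (pen c)) p0 => [l ->|->]; [exists l|rewrite eqxx].
have cE : cgen l = (\prod_(d <- s1) right_edge d * right_edge c)%g.
  by rewrite /cgen -pl es s20 big_cat big_seq1.
have -> : right_edge c = ((\prod_(d <- s1) right_edge d)^-1 * cgen l)%g by rewrite cE mulKg.
apply: genM; last by apply: sub_gen; right; exists l.
apply: genV; rewrite big_seq; apply: gen_prod => d /splitPr ds.
case: ds es s1k => s3 s4 es s34k; apply: (xS (pen c) s3 d (s4 ++ c :: s2)).
  by rewrite es -catA.
by rewrite -s34k size_cat /= addnS ltnS leq_addr.
Qed.

Lemma big_pencil (K : groupType) (e : T -> K) (A : {set T}) s1 c s2 :
  (forall d, d \in s1 -> d \in A) -> (forall d, d \in s2 -> d \notin A) ->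
  (\prod_(d <- s1 ++ c :: s2 | d \in A) e d =
   \prod_(d <- s1) e d * (if c \in A then e c else 1))%g.
Proof.
move=> A1 A2; rewrite big_cat big_cons /=.
have -> : (\prod_(d <- s2 | d \in A) e d)%g = 1%g.
  by rewrite big_seq_cond big_pred0 // => d; apply/negP => /andP[/A2/negPf ->].
have -> : (\prod_(d <- s1 | d \in A) e d)%g = (\prod_(d <- s1) e d)%g.
  by rewrite big_seq_cond [RHS]big_seq; apply: eq_bigl => d; apply/andb_idr; exact: A1.
by case: ifP => _; rewrite !mulg1.
Qed.

Section FreeProjection.
Variable i : 'I_t.+1.

Let letter c : free_group 'I_(k i) :=
  if (insub (index c (ln i)) : option 'I_(k i)) is Some a then fgen a else 1%g.

Let letterE s1 c s2 (a : 'I_(k i)) : ln i = s1 ++ c :: s2 -> size s1 = a -> letter c = fgen a.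
Proof.
move=> es sa; rewrite /letter.
have -> : index c (ln i) = a.
  have := ln_uniq i; rewrite es cat_uniq /= => /and3P[_ + _]; rewrite negb_or => /andP[cs1 _].
  by rewrite index_cat (negPf cs1) /= eqxx addn0.
by rewrite valK.
Qed.

(** [h] multiplies the letters of a label in the order of the pencil. At a line before the last one
    of an affine pencil, or at any parallel line, the labels before and after crossing are [s1] and
    [s1] with [c], so the quotient is the letter of [c]. The last line of an affine pencil is the
    reference [b] of the cut: crossing it empties the label, which leaves the inverse of the product
    of all letters. *)
Lemma projection_letters : exists2 f : pi1 R z -> free_group 'I_(k i),
  {morph f : g h / (g * h)%g} & forall c,
    (pen c != i -> f (right_edge c) = 1%g) /\
    (forall s1 s2, ln i = s1 ++ c :: s2 -> f (right_edge c) =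
      if (size s1 < k i)%N then letter c else ((\prod_(d <- s1) letter d)^-1)%g).
Proof.
pose h (A : {set T}) : free_group 'I_(k i) := (\prod_(c <- ln i | c \in A) letter c)%g.
have h0 : h finset.set0 = 1%g by rewrite /h big_pred0 // => c; rewrite inE.
pose S := [set c | pen c == i]%SET.
have [i0|i0] := eqVneq i ord0.
  have [c|f fM fE] := @parallel_morphism R T m q z x0 _ S m0 h _ h0.
    by rewrite inE i0 => /eqP /m0P.
  exists f => // c; have [_ cr] := right_posP c; rewrite /right_edge fE //; split.
    move=> pc; rewrite (_ : (c |: _) :&: S = above (on_line c (right_pos c)) :&: S) ?mulVg //.
    apply/setP => d; rewrite !inE; have [->|//] := eqVneq d c.
    by rewrite (negPf pc) !andbF.
  move=> s1 s2 es; have sk : (size s1 < k i)%N.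
    by rewrite i0 -size0 -i0 es size_cat /= addnS ltnS leq_addr.
  have := ln0; rewrite -i0 es pairwise_cat /= => /and3P[/allrelP s12 _ /andP[/allP cs2 _]].
  have BE d : pen d = i -> (d \in above (on_line c (right_pos c)) :&: S) = (q d < q c).
    move=> pd; rewrite !inE pd eqxx andbT lform_on_line !m0P ?subrr ?mul0r ?add0r ?subr_gt0 //.
      by rewrite pd i0.
    by rewrite (ln_pen es) i0.
  have penl d : d \in s1 ++ c :: s2 -> pen d = i by rewrite -es ln_mem => /eqP.
  have BE' d : pen d = i -> (d \in (c |: above (on_line c (right_pos c))) :&: S) = (d == c) || (q d < q c).
    by move=> pd; rewrite -BE // !inE pd eqxx !andbT.
  have p1 d : d \in s1 -> q d < q c by move=> ds; apply: s12; rewrite ?mem_head.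
  have p2 d : d \in s2 -> q c < q d by exact: cs2.
  have i1 d : d \in s1 -> pen d = i by move=> ds; apply: penl; rewrite mem_cat ds.
  have i2 d : d \in s2 -> pen d = i by move=> ds; apply: penl; rewrite mem_cat inE ds !orbT.
  have ic : pen c = i by exact: ln_pen es.
  rewrite sk /h es !big_pencil.
  - by rewrite BE // BE' // ltxx eqxx mulg1 mulKg.
  - by move=> d ds; rewrite BE' ?i1 // p1 // orbT.
  - move=> d ds; rewrite BE' ?i2 // negb_or -leNgt (ltW (p2 _ ds)) andbT.
    by apply: contraTneq (p2 _ ds) => ->; rewrite ltxx.
  - by move=> d ds; rewrite BE ?i1 // p1.
  - by move=> d ds; rewrite BE ?i2 // -leNgt ltW // p2.
have [s0 [b [eb sb]]] := ln_last i0.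
have bS : b \in S by rewrite inE -ln_mem eb mem_rcons mem_head.
have SP c : c \in S -> lform c (P i) = 0 by rewrite inE PP // => /eqP.
have [f fM fE] := pencil_morphism z x0 bS SP h0.
exists f => // c; split.
  (* [u] is taken right of both multiple points: that of [c] for [right_edgeE], that of the pencil
     [i] for the cut. *)
  move=> pc; have [u /andP[Mu _] cu] := @clean_in c (Num.max (Px c) (P i).1) (Num.max (Px c) (P i).1 + 1) ltac:(by rewrite ltrDl).
  move: Mu; rewrite gt_max => /andP[Pu Piu]; rewrite -(right_edgeE Pu cu) fE //.
  have bc : (b == c) = false.
    by apply/negbTE; apply: contraNneq pc => <-; move: bS; rewrite inE.
  rewrite [X in (h X)^-1%g](_ : _ = [set d in S | (d \in c |: above (on_line c u)) != (b \in c |: above (on_line c u))]%SET) ?mulVg //.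
  apply/setP => d; rewrite !inE bc; have [->|//] := eqVneq d c.
  by rewrite (negPf pc).
move=> s1 s2 es; have ic : pen c = i by exact: ln_pen es.
have [Pr cr] := right_posP c; rewrite ic in Pr.
rewrite /right_edge fE //.
have := lnS i0; rewrite es pairwise_cat /= => /and3P[/allrelP s12 _ /andP[/allP cs2 _]].
have penl d : d \in s1 ++ c :: s2 -> pen d = i by rewrite -es ln_mem => /eqP.
have i1 d : d \in s1 -> pen d = i by move=> ds; apply: penl; rewrite mem_cat ds.
have i2 d : d \in s2 -> pen d = i by move=> ds; apply: penl; rewrite mem_cat inE ds !orbT.
have BE d : pen d = i -> (d \in above (on_line c (right_pos c))) = (m d < m c).
  move=> pd; rewrite inE pencil_vanish ?ic ?pd //.
  by rewrite pmulr_lgt0 subr_gt0.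
have p1 d : d \in s1 -> m d < m c by move=> ds; apply: s12; rewrite ?mem_head.
have p2 d : d \in s2 -> m c < m d by exact: cs2.
have cB : c \in above (on_line c (right_pos c)) = false by rewrite inE lform_on_line0 ltxx.
(* Either [c] is the reference line [b] itself, or [b] ends the list of lines after [c]. *)
case/lastP: s2 es s12 penl cs2 i2 p2 => [|s2 b'] es s12 penl cs2 i2 p2.
  have [es1 ecb] : s1 = s0 /\ c = b.
    by move: eb; rewrite es cats1 => /rcons_inj[].
  have bB : (b \in above (on_line c (right_pos c))) = false by rewrite -ecb.
  have L1 d : pen d = i -> (d \in [set d in S | (d \in above (on_line c (right_pos c))) !=
      (b \in above (on_line c (right_pos c)))]%SET) = (m d < m c).
    by move=> pd; rewrite 2!inE pd eqxx bB BE //; case: (m d < m c).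
  have L2 d : pen d = i -> (d \in [set d in S | (d \in c |: above (on_line c (right_pos c))) !=
      (b \in c |: above (on_line c (right_pos c)))]%SET) = (d != c) && (m c <= m d).
    move=> pd; rewrite 2!inE pd eqxx !finset.in_setU1 -ecb eqxx cB BE //.
    by rewrite leNgt; case: (d == c); case: (m d < m c).
  rewrite es1 sb ltnn -es1 /h es big_pencil //.
  - rewrite L1 // ltxx mulg1 [X in (_ * X)%g]big1_seq ?mulg1 // => d /andP[+ ds].
    rewrite L2 ?penl //; move: ds; rewrite mem_cat mem_seq1 => /orP[/p1 ds|/eqP ->].
      by rewrite leNgt ds andbF.
    by rewrite eqxx.
  - by move=> d ds; rewrite L1 ?i1 // p1.
have bb' : b' = b.
  by move: eb; rewrite es -rcons_cons -rcons_cat => /rcons_inj[].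
have sk : (size s1 < k i)%N.
  by rewrite -ltnS -sizeS // es size_cat /= size_rcons !addnS ltnS ltnS leq_addr.
have bs2 : b \in rcons s2 b' by rewrite bb' mem_rcons mem_head.
have bB : (b \in above (on_line c (right_pos c))) = false.
  by rewrite BE ?i2 // lt_gtF // p2.
have bc : (b == c) = false.
  by apply/negbTE; apply: contraTneq (p2 _ bs2) => ->; rewrite ltxx.
have notc d : d \in rcons s2 b' -> (d == c) = false.
  by move=> ds; apply/negbTE; apply: contraTneq (p2 _ ds) => ->; rewrite ltxx.
have L1 d : pen d = i -> (d \in [set d in S | (d \in above (on_line c (right_pos c))) !=
    (b \in above (on_line c (right_pos c)))]%SET) = (m d < m c).
  by move=> pd; rewrite 2!inE pd eqxx bB BE //; case: (m d < m c).
have L2 d : pen d = i -> (d \in [set d in S | (d \in c |: above (on_line c (right_pos c))) !=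
    (b \in c |: above (on_line c (right_pos c)))]%SET) = (d == c) || (m d < m c).
  move=> pd; rewrite 2!inE pd eqxx !finset.in_setU1 bB bc BE //.
  by case: ((d == c) || (m d < m c)).
rewrite sk /h es !big_pencil.
- by rewrite L1 // L2 // ltxx eqxx mulg1 mulKg.
- by move=> d ds; rewrite L2 ?i1 // p1 // orbT.
- by move=> d ds; rewrite L2 ?i2 // notc //= -leNgt ltW // p2.
- by move=> d ds; rewrite L1 ?i1 // p1.
- by move=> d ds; rewrite L1 ?i2 // -leNgt ltW // p2.
Qed.

Lemma free_projection : exists f : pi1 R z -> free_group 'I_(k i),
  [/\ {morph f : g h / (g * h)%g}, forall a : 'I_(k i), f (xgen a) = fgen a,
      forall j (a : 'I_(k j)), j != i -> f (xgen a) = 1%g & forall l, f (cgen l) = 1%g].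
Proof.
have [f fM fE] := projection_letters; exists f; split=> // [a|j a ji|l].
- have [s1 [c [s2 [es sa ->]]]] := xgen_split a.
  by rewrite (proj2 (fE c) s1 s2 es) sa ltn_ord (letterE es sa).
- have [s1 [c [s2 [es sa ->]]]] := xgen_split a.
  by rewrite (proj1 (fE c)) // (ln_pen es).
have [li|li] := eqVneq (lift ord0 l) i; last first.
  rewrite /cgen (morph_prodg fM) big1_seq // => c /andP[_].
  by rewrite ln_mem => /eqP pc; apply: (proj1 (fE c)); rewrite pc.
have i0 : i != ord0 by rewrite -li.
have [s0 [b [eb sb]]] := ln_last i0.
rewrite /cgen li (morph_prodg fM) eb -cats1 big_cat big_seq1 /=.
rewrite (proj2 (fE b) s0 [::]) ?sb ?ltnn; last by rewrite eb cats1.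
rewrite [X in (X * _)%g](_ : _ = \prod_(d <- s0) letter d)%g ?mulgV //.
rewrite big_seq [RHS]big_seq; apply: eq_bigr => d /splitPr ds.
case: ds eb sb => s1 s2 eb sb.
rewrite (proj2 (fE d) s1 (rcons s2 b)) ?eb ?rcons_cat //.
have -> // : (size s1 < k i)%N.
by rewrite -sb size_cat /= addnS ltnS leq_addr.
Qed.

End FreeProjection.

(** The winding number around [b], from the parallel cut with [b] as its only line. *)
Lemma line_degree (b : T) : exists2 f : pi1 R z -> Algebra.to_multiplicative int,
  {morph f : g h / (g * h)%g} & forall c, f (right_edge c) = ((c == b)%:R : int).
Proof.
pose h (A : {set T}) : Algebra.to_multiplicative int := ((b \in A)%:R : int).
have [c||f fM fE] := @parallel_morphism R T m q z x0 _ [set b]%SET (m b) h _ _.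
  by rewrite inE => /eqP ->.
  by rewrite /h inE.
exists f => // c; have [_ cr] := right_posP c; rewrite /right_edge fE //.
change (((- (b \in above (on_line c (right_pos c)) :&: [set b]%SET)%:R) +
  (b \in (c |: above (on_line c (right_pos c))) :&: [set b]%SET)%:R : int) = (c == b)%:R).
rewrite !inE eqxx !andbT eq_sym; have [->|_] := eqVneq c b.
  by rewrite lform_on_line0 ltxx.
by rewrite orFb addNr.
Qed.

(** The winding number around the steepest line of the pencil, which is omitted from the [xgen] and
    occurs once in [cgen l]. *)
Lemma central_projection l : exists f : pi1 R z -> Algebra.to_multiplicative int,
  [/\ {morph f : g h / (g * h)%g}, forall i (a : 'I_(k i)), f (xgen a) = 1%g
    & forall l', f (cgen l') = ((l == l')%:R : int)].
Proof.
have [s0 [b [eb sb]]] := ln_last (lift_neq0 l).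
have [f fM fE] := line_degree b; exists f.
have bP : pen b = lift ord0 l by apply: (@ln_pen _ _ s0 [::]); rewrite eb cats1.
have us := ln_uniq (lift ord0 l); rewrite eb rcons_uniq in us; have /andP[bs us0] := us.
split=> // [i a|l'].
  have [s1 [c [s2 [es sa ->]]]] := xgen_split a; rewrite fE.
  suff -> : (c == b) = false by [].
  apply/negbTE; apply: contraTneq (ltn_ord a) => cb; rewrite -leqNgt -sa.
  have pc := ln_pen es; move: es; rewrite -pc cb bP eb -{1}cats1.
  have [s2n|s2n] := eqVneq s2 [::]; first by rewrite s2n !cats1 => /rcons_inj[<-]; rewrite sb.
  case/lastP: s2 s2n => // s2 e _; rewrite cats1 -rcons_cons -rcons_cat => /rcons_inj[es _].
  by rewrite es mem_cat mem_head orbT in bs.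
rewrite /cgen (morph_prodg fM).
under eq_bigr do rewrite fE.
have [<-|ll'] := eqVneq l l'.
  rewrite eb -cats1 big_cat big_seq1 eqxx big1_seq ?mul1g // => c /andP[_ cs].
  by suff -> : (c == b) = false by []; apply/negbTE; apply: contraNneq bs => <-.
rewrite big1_seq // => c /andP[_]; rewrite ln_mem => /eqP pc.
suff -> : (c == b) = false by [].
by apply/negbTE; apply: contraNneq ll' => cb; rewrite cb bP in pc; rewrite (lift_inj pc).
Qed.

Theorem affine_pi1 :
  isomorphic (pi1 R z) (direct_product (fun i => free_group 'I_(k i)) * Zpow t)%type.
Proof.
pose Phi i := projT1 (cid (free_projection i)).
have PhiP i := projT2 (cid (free_projection i)).
pose omega l := projT1 (cid (central_projection l)).
have omegaP l := projT2 (cid (central_projection l)).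
apply: (@decomp_isomorphic _ t k xgen cgen _ _ _ _ Phi omega).
- exact: xgen_commute.
- exact: cgen_xgen.
- exact: cgen_commute.
- exact: xgen_cgen_generate.
- by move=> i; case: (PhiP i).
- by move=> i; case: (PhiP i).
- by move=> i j a ij; case: (PhiP j) => _ _ + _; exact.
- by move=> i l; case: (PhiP i) => _ _ _ h; apply: h.
- by move=> l; case: (omegaP l) => h1 h2 h3 *; first [exact: h1|exact: h2|exact: h3].
- by move=> l; case: (omegaP l) => h1 h2 h3 *; first [exact: h1|exact: h2|exact: h3].
- by move=> l; case: (omegaP l) => h1 h2 h3 *; first [exact: h1|exact: h2|exact: h3].
Qed.

End AffineArrangement.

(** * Invariance under homeomorphism *)

Lemma isomorphic_trans (G H K : groupType) :
  isomorphic G H -> isomorphic H K -> isomorphic G K.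
Proof. by move=> [f bf] [g bg]; exists (g \o f); exact: bij_comp. Qed.

Section Pi1Functor.
Variables (R : realType) (X Y : topologicalType).
Local Notation I := (unit_itv R).
Variables (f : X -> Y) (x : X) (y : Y).
Hypotheses (cf : continuous f) (fx : f x = y).

Lemma comp_path_continuous (p : {path I from x to x}) : continuous (f \o p).
Proof. by move=> s; apply: continuous_comp; [exact: cts_fun|exact: cf]. Qed.

Definition map_path (p : {path I from x to x}) : {path I from y to y} :=
  @mk_path I Y y y _
    (@comp_path_continuous p)
    (etrans (congr1 f (@path_zero _ _ _ _ p)) fx)
    (etrans (congr1 f (@path_one _ _ _ _ p)) fx).

Lemma map_pathE p s : map_path p s = f (p s). Proof. by []. Qed.

Lemma map_path_homotopic p p' :
  path_homotopic p p' -> path_homotopic (map_path p) (map_path p').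
Proof.
move=> [H [cH H0 H1 Hx Hy]]; exists (f \o H); split=> [su|s|s|u|u] /=.
- by apply: continuous_comp; [exact: cH|exact: cf].
- by rewrite H0.
- by rewrite H1.
- by rewrite Hx.
- by rewrite Hy.
Qed.

Definition pi1_map (g : pi1 R x) : pi1 R y := \pi_(pi1 R y) (map_path (repr g)).

Lemma pi1_map_pi p : pi1_map (\pi_(pi1 R x) p) = \pi_(pi1 R y) (map_path p).
Proof. by apply: pi1_eq; apply: map_path_homotopic; exact: pi1_repr. Qed.

Lemma pi1_mapM : {morph pi1_map : g h / (g * h)%g}.
Proof.
move=> g h; rewrite -[g]reprK -[h]reprK pi1M !pi1_map_pi pi1M; congr (\pi_(pi1 R y) _).
apply/path_eqP => s; rewrite path_catE !map_pathE path_catE.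
by case: ifP.
Qed.

HB.instance Definition _ := isMultiplicative.Build (pi1 R x) (pi1 R y) pi1_map pi1_mapM.

End Pi1Functor.

Lemma homeomorphic_pi1 (R : realType) (X Y : topologicalType) (f : X -> Y) (g : Y -> X) (x : X) :
  continuous f -> continuous g -> cancel f g -> cancel g f ->
  isomorphic (pi1 R x) (pi1 R (f x)).
Proof.
move=> cf cg fK gK; exists (@pi1_map R X Y f x (f x) cf erefl).
have E1 := @pi1_map_pi R X Y f x (f x) cf erefl.
have E2 := @pi1_map_pi R Y X g (f x) x cg (fK x).
exists (@pi1_map R Y X g (f x) x cg (fK x)) => h; rewrite -[h]reprK.
- rewrite -[LHS]/(pi1_map cg (fK x) (pi1_map cf erefl (\pi_(pi1 R x) (repr h)))) E1 E2.
  by congr (\pi_(pi1 R _) _); apply/path_eqP => s; rewrite !map_pathE fK.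
- rewrite -[LHS]/(pi1_map cf erefl (pi1_map cg (fK x) (\pi_(pi1 R (f x)) (repr h)))) E2 E1.
  by congr (\pi_(pi1 R _) _); apply/path_eqP => s; rewrite !map_pathE gK.
Qed.

(** * Affine charts of the projective plane *)

Section ComplexContinuity.
Variable R : realType.
Local Notation C := (C R).
Local Notation toC := (real_complex R : R -> C).

Lemma norm_real_complex (a : R) : `|toC a| = toC `|a|.
Proof. by rewrite /= normc_def /= expr0n /= addr0 sqrtr_sqr. Qed.

Lemma real_complex_continuous : continuous toC.
Proof.
move=> a A /nbhs_ballP[/= e e0 eA].
have eR : e = toC (complex.Re e) by rewrite [RHS]RRe_real // gtr0_real.
have e0' : 0 < complex.Re e by move: e0; rewrite eR (ltcR 0).
apply/nbhs_ballP; exists (complex.Re e) => // b ab; apply: eA.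
have {}ab : `|a - b| < complex.Re e := ab; change (`|toC a - toC b| < e).
have -> : toC a - toC b = toC (a - b) by apply/eqP; rewrite eq_complex /= oppr0 addr0 !eqxx.
by rewrite norm_real_complex eR ltcR.
Qed.

Lemma Re_continuous : continuous (fun z : C => complex.Re z).
Proof.
move=> a A /nbhs_ballP[/= e e0 eA].
have e0' : 0 < toC e by rewrite (ltcR 0).
apply/nbhs_ballP; exists (toC e) => // b ab; apply: eA.
have {}ab : `|a - b| < toC e := ab.
change (`|complex.Re a - complex.Re b| < e); rewrite -ltcR; apply: le_lt_trans ab.
have -> : complex.Re a - complex.Re b = complex.Re (a - b) by case: a b => [? ?] [? ?].
exact: normc_ge_Re.
Qed.

Lemma Im_continuous : continuous (fun z : C => complex.Im z).
Proof.
have -> : (fun z : C => complex.Im z) = (fun z : C => complex.Re (- 'i%C * z : C)).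
  by apply/funext => -[a b] /=; rewrite oppr0 mul0r sub0r mulN1r opprK.
have h : continuous (fun z : C => - 'i%C * z : C) by exact: mulrl_continuous.
by move=> z; exact: (continuous_comp (h z) (@Re_continuous _)).
Qed.

End ComplexContinuity.

Lemma continuous_add3 (R : numFieldType) (Y : topologicalType) (V : normedModType R) (f g h : Y -> V) :
  continuous f -> continuous g -> continuous h -> continuous (fun y => f y + g y + h y).
Proof. by move=> cf cg ch y; apply: cvgD; [apply: cvgD; [exact: cf|exact: cg]|exact: ch]. Qed.

Section Coordinates.
Variables (R : realType) (B : 'M[R]_3).
Hypothesis uB : B \in unitmx.
Local Notation C := (C R).
Local Notation toC := (real_complex R).
Local Notation CP2 := (CP R 2).
Local Notation BC := (map_mx toC B : 'M[C]_3).
Local Notation V := ((R * R) * (R * R))%type.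
Local Notation PT := (set_type (@punctured R 2)).
Implicit Types (v : 'rV[C]_3) (a : 'rV[R]_3).

(* [phi j] are the coordinates in the basis of [C^3] formed by the rows of [B],
   and [cov a j] the coefficients of the linear form [a] in these coordinates. *)
Definition phi (j : 'I_3) v : C := (v *m invmx BC) 0 j.
Definition cov a (j : 'I_3) : R := (B *m a^T) j 0.

Lemma unitBC : BC \in unitmx. Proof. by rewrite map_unitmx. Qed.

Lemma phiD j v w : phi j (v + w) = phi j v + phi j w.
Proof. by rewrite /phi mulmxDl mxE. Qed.

Lemma phiZ j (c : C) v : phi j (c *: v) = c * phi j v.
Proof. by rewrite /phi -scalemxAl mxE. Qed.

Lemma phi_row j i : phi j (row i BC) = (i == j)%:R.
Proof. by rewrite /phi -row_mul mulmxV ?unitBC // !mxE eq_sym. Qed.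

Lemma phi_expand v : v = \sum_j phi j v *: row j BC.
Proof.
by rewrite -mulmx_sum_row mulmxKV // unitBC.
Qed.

Lemma phi_neq0 v : v != 0 -> exists j, phi j v != 0.
Proof.
move=> v0; apply/existsP; apply: contraR v0 => /existsPn h.
by rewrite [v]phi_expand big1 // => j _; have /negPn/eqP -> := h j; rewrite scale0r.
Qed.

Lemma phi_continuous j : continuous (phi j).
Proof.
have h i : continuous (fun v : 'rV[C]_3 => v 0 i * invmx BC i j).
  move=> v; exact: (continuous_comp (@matrix_normedtype.coord_continuous _ _ _ 0 i v) (@mulrr_continuous _ _ _)).
suff -> : phi j = (fun v => v 0 0 * invmx BC 0 j + v 0 1 * invmx BC 1 j + v 0 2 * invmx BC 2 j).
  exact: (@continuous_add3 C _ C^o _ _ _ (h 0) (h 1) (h 2)).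
apply/funext => w; rewrite /phi mxE !big_ord_recl big_ord0 addr0 addrA.
by do 2?[congr (_ + _)]; congr (w _ _ * invmx BC _ _); apply/val_inj.
Qed.

Lemma dot_phi a v : \sum_i (map_mx toC a) 0 i * v 0 i = \sum_j phi j v * toC (cov a j).
Proof.
transitivity ((v *m (map_mx toC a)^T) 0 0).
  by rewrite mxE; apply: eq_bigr => i _; rewrite !mxE mulrC.
rewrite -[v in LHS](mulmxKV unitBC) -(mulmxA (v *m _)) mxE; apply: eq_bigr => j _.
congr (_ * _); rewrite /cov !mxE (@rmorph_sum _ _ (real_complex R)); apply: eq_bigr => i _.
by rewrite !mxE rmorphM.
Qed.

Lemma ord3P (j : 'I_3) : [\/ j = 0, j = 1 | j = 2].
Proof.
by case: j => [[|[|[|//]]] h]; [apply: Or31|apply: Or32|apply: Or33]; apply/val_inj.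
Qed.

Lemma sum3 (G : nmodType) (F : 'I_3 -> G) : \sum_j F j = F 0 + F 1 + F 2.
Proof.
rewrite !big_ord_recl big_ord0 addr0 addrA.
by do 2?[congr (_ + _)]; congr (F _); apply/val_inj.
Qed.

Lemma hyperplane_pi (b : 'rV[C]_3) (v : PT) :
  hyperplane b (\pi_(CP R 2) v) <-> \sum_i b 0 i * (\val v) 0 i = 0.
Proof.
split=> [[w bw /eqmodP/asboolP[c c0 ->]]|bv]; last by exists v.
transitivity (c * \sum_i b 0 i * (\val w) 0 i); last by rewrite bw mulr0.
by rewrite mulr_sumr; apply: eq_bigr => i _; rewrite mxE mulrCA.
Qed.

Definition ppt v (v0 : v != 0) : PT := SigSub (mem_set (v0 : @punctured R 2 v)).

Lemma ppt_val (w : PT) : \val w != 0.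
Proof. by case: w => w /= /set_mem. Qed.

Lemma pi_eqP (v w : PT) :
  \pi_(CP R 2) v = \pi_(CP R 2) w <-> exists2 c : C, c != 0 & \val w = c *: \val v.
Proof. by split=> [/eqmodP/asboolP//|h]; apply/eqmodP/asboolP. Qed.

Definition avec (X Y : C) : 'rV[C]_3 := row 0 BC + X *: row 1 BC + Y *: row 2 BC.

Lemma phi_avec X Y : [/\ phi 0 (avec X Y) = 1, phi 1 (avec X Y) = X & phi 2 (avec X Y) = Y].
Proof.
by rewrite /avec; split; rewrite !phiD !phiZ !phi_row /= ?mulr0 ?mulr1 ?addr0 ?add0r.
Qed.

Lemma phi0_neq0 v : phi 0 v != 0 -> v != 0.
Proof. by apply: contraNneq => ->; rewrite /phi mul0mx mxE. Qed.

Lemma avec_neq0 X Y : avec X Y != 0.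
Proof. by apply: phi0_neq0; case: (phi_avec X Y) => -> _ _; exact: oner_neq0. Qed.

Definition affine_point (u : V) : CP2 :=
  \pi_(CP R 2) (ppt (avec_neq0 (Complex u.1.1 u.2.1) (Complex u.1.2 u.2.2))).

Definition finite_point (p : CP2) : Prop := phi 0 (\val (repr p)) != 0.

Definition quot j v : C := phi j v / phi 0 v.

Definition chart (p : CP2) : V :=
  let v := \val (repr p) in
  ((complex.Re (quot 1 v), complex.Re (quot 2 v)),
   (complex.Im (quot 1 v), complex.Im (quot 2 v))).

Lemma quotZ j (c : C) v : c != 0 -> quot j (c *: v) = quot j v.
Proof. by move=> c0; rewrite /quot !phiZ -mulf_div divff // mul1r. Qed.

Lemma repr_pi (v : PT) : exists2 c : C, c != 0 &
  \val (repr (\pi_(CP R 2) v)) = c *: \val v.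
Proof. by apply/pi_eqP; rewrite reprK. Qed.

Lemma finite_point_pi (v : PT) : finite_point (\pi_(CP R 2) v) <-> phi 0 (\val v) != 0.
Proof.
rewrite /finite_point; have [c c0 ->] := repr_pi v.
by rewrite phiZ mulf_eq0 negb_or c0.
Qed.

Lemma quot_repr_pi j (v : PT) :
  quot j (\val (repr (\pi_(CP R 2) v))) = quot j (\val v).
Proof. by have [c c0 ->] := repr_pi v; rewrite quotZ. Qed.

Lemma finite_affine_point u : finite_point (affine_point u).
Proof.
apply/finite_point_pi => /=.
by case: (phi_avec (Complex u.1.1 u.2.1) (Complex u.1.2 u.2.2)) => -> _ _; exact: oner_neq0.
Qed.

Lemma affine_pointK : cancel affine_point chart.
Proof.
move=> u; rewrite /chart !quot_repr_pi /quot /=.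
have [-> -> ->] := phi_avec (Complex u.1.1 u.2.1) (Complex u.1.2 u.2.2).
by rewrite !divr1; case: u => [[? ?] [? ?]].
Qed.

Lemma chartK p : finite_point p -> affine_point (chart p) = p.
Proof.
move=> fp; rewrite -[RHS]reprK; apply/pi_eqP; exists (phi 0 (\val (repr p))) => //=.
have CE (a : C) : Complex (complex.Re a) (complex.Im a) = a by case: a.
rewrite !CE /avec {1}[\val (repr p)]phi_expand sum3 !scalerDr !scalerA.
by rewrite /quot ![phi 0 _ * (_ / _)]mulrCA divff // !mulr1.
Qed.

Lemma hyperplane_affine_point a u : hyperplane (map_mx toC a) (affine_point u) <->
  cov a 0 + cov a 1 * u.1.1 + cov a 2 * u.1.2 = 0 /\ cov a 1 * u.2.1 + cov a 2 * u.2.2 = 0.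
Proof.
rewrite hyperplane_pi /= dot_phi sum3.
have [-> -> ->] := phi_avec (Complex u.1.1 u.2.1) (Complex u.1.2 u.2.2).
have -> : 1 * (cov a 0)%:C%C + Complex u.1.1 u.2.1 * (cov a 1)%:C%C +
    Complex u.1.2 u.2.2 * (cov a 2)%:C%C =
  Complex (cov a 0 + cov a 1 * u.1.1 + cov a 2 * u.1.2) (cov a 1 * u.2.1 + cov a 2 * u.2.2) :> C.
  by apply/eqP; rewrite eq_complex /=; apply/andP; split; apply/eqP; ring.
by split=> [[-> ->]//|[-> ->]].
Qed.

Lemma infinity_vec_neq0 (r : C) : row 1 BC + r *: row 2 BC != 0.
Proof.
apply: contraTneq (oner_neq0 C) => /(congr1 (phi 1)).
by rewrite phiD phiZ !phi_row /= mulr0 addr0 /phi mul0mx mxE negbK => h; apply/eqP; exact: h.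
Qed.

(** The common point at infinity of the affine lines of slope [r]. *)
Definition infinity_point (r : R) : CP2 := \pi_(CP R 2) (ppt (infinity_vec_neq0 (toC r))).

Lemma hyperplane_infinity_point a r : hyperplane (map_mx toC a) (infinity_point r) <->
  cov a 1 + cov a 2 * r = 0.
Proof.
rewrite hyperplane_pi /= dot_phi sum3 !phiD !phiZ !phi_row /=.
have -> : (0 + toC r * 0) * (cov a 0)%:C%C + (1 + toC r * 0) * (cov a 1)%:C%C +
    (0 + toC r * 1) * (cov a 2)%:C%C = toC (cov a 1 + cov a 2 * r) :> C.
  by rewrite rmorphD rmorphM /=; ring.
by split=> [[]//|->].
Qed.

End Coordinates.

Section Chart.
Variables (R : realType) (B : 'M[R]_3).
Hypothesis uB : B \in unitmx.
Local Notation C := (C R).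
Local Notation CP2 := (CP R 2).
Local Notation V := ((R * R) * (R * R))%type.
Local Notation PT := (set_type (@punctured R 2)).
Local Notation affine_point := (affine_point uB).

Lemma continuous_complex (Y : topologicalType) (f g : Y -> R) :
  continuous f -> continuous g -> continuous (fun y => Complex (f y) (g y) : C).
Proof.
move=> cf cg.
have -> : (fun y => Complex (f y) (g y) : C) =
    (fun y => real_complex R (f y) + 'i%C * real_complex R (g y) : C).
  by apply/funext => y; rewrite [LHS]complexE.
move=> y; apply: (@cvgD C C^o).
  exact: (continuous_comp (cf y) (@real_complex_continuous R _)).
have h := continuous_comp (cg y) (@real_complex_continuous R _).
exact: (continuous_comp h (@mulrl_continuous C 'i%C _)).
Qed.

Lemma affine_point_continuous : continuous affine_point.
Proof.
have [c1 c2 c3 c4] := coordinates_continuous R.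
have h : continuous (fun u : V => ppt (avec_neq0 uB (Complex u.1.1 u.2.1) (Complex u.1.2 u.2.2))).
  apply: set_type_continuous; rewrite /= /avec.
  apply: (@continuous_add3 C _ 'rV[C]_3).
  - by move=> u; exact: cvg_cst.
  - move=> u; exact: (continuous_comp (continuous_complex c1 c3 (x := u)) (@scalel_continuous C _ _ _)).
  - move=> u; exact: (continuous_comp (continuous_complex c2 c4 (x := u)) (@scalel_continuous C _ _ _)).
move=> u; exact: (continuous_comp (h u) (@pi_continuous _ _ _)).
Qed.

Lemma quot_continuous j v : phi B 0 v != 0 -> {for v, continuous (quot B j)}.
Proof.
move=> v0; apply: (@cvgM C _ _ (nbhs_filter v)); first exact: phi_continuous.
by apply: cvgV => //; exact: phi_continuous.
Qed.

Definition vchart (w : PT) : V :=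
  ((complex.Re (quot B 1 (\val w)), complex.Re (quot B 2 (\val w))),
   (complex.Im (quot B 1 (\val w)), complex.Im (quot B 2 (\val w)))).

Lemma chart_pi w : chart B (\pi_(CP R 2) w) = vchart w.
Proof. by rewrite /chart !quot_repr_pi. Qed.

Lemma vchart_continuous (w : PT) : phi B 0 (\val w) != 0 -> {for w, continuous vchart}.
Proof.
move=> w0.
have q j : {for w, continuous (fun w : PT => quot B j (\val w))}.
  by apply: continuous_comp; [exact: val_continuous|exact: quot_continuous].
have r j := continuous_comp (q j) (@Re_continuous R _).
have i j := continuous_comp (q j) (@Im_continuous R _).
exact: (cvg_pair (cvg_pair (r 1) (r 2)) (cvg_pair (i 1) (i 2))).
Qed.

(** [chart] goes through [repr], for which no continuity is available; openness in the quotient is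
    therefore tested on the preimage among nonzero vectors, where quotients of coordinates are
    continuous. *)
Lemma chart_continuous p : finite_point B p -> {for p, continuous (chart B)}.
Proof.
move=> fp A; rewrite nbhsE => -[O [oO Op] OA].
pose W := [set p | finite_point B p /\ O (chart B p)].
have oW : open W.
  suff : open (\pi_(CP R 2) @^-1` W : set PT) by [].
  rewrite openE => w [/finite_point_pi w0]; rewrite chart_pi => Ow.
  have n1 : \forall w' \near w, O (vchart w').
    by apply: (vchart_continuous w0); exact: open_nbhs_nbhs.
  have n2 : \forall w' \near w, phi B 0 (\val w') != 0.
    have cw : {for w, continuous (fun w : PT => phi B 0 (\val w))}.
      by apply: continuous_comp; [exact: val_continuous|exact: phi_continuous].
    by apply: (cvgr_neq0 _ cw w0).
  apply: (filterS2 _ _ n1 n2) => w' Ow' w'0; split; last by rewrite chart_pi.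
  exact/finite_point_pi.
by apply: (filterS (P := W)); [move=> p' [_ /OA]|apply: open_nbhs_nbhs].
Qed.

Lemma chart_isomorphic (U : set CP2) (O : set V) (x : set_type U) :
  (forall p, U p -> finite_point B p) -> (forall u, U (affine_point u) <-> O u) ->
  exists z : set_type O, isomorphic (pi1 R x) (pi1 R z).
Proof.
move=> fU UO.
have fP (a : set_type U) : finite_point B (\val a) by apply: fU; exact: set_type_valP.
have fO (a : set_type U) : O (chart B (\val a)).
  by apply/UO; rewrite chartK //; exact: set_type_valP.
pose f (a : set_type U) : set_type O := pt (fO a).
have gU (b : set_type O) : U (affine_point (\val b)) by apply/UO; exact: set_type_valP.
pose g (b : set_type O) : set_type U := pt (gU b).
exists (f x); apply: (@homeomorphic_pi1 R _ _ f g).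
- apply: set_type_continuous => a /=.
  by apply: (@continuous_comp _ _ _ (fun a : set_type U => \val a)); [exact: val_continuous|exact: chart_continuous].
- apply: set_type_continuous => b /=.
  by apply: (@continuous_comp _ _ _ (fun b : set_type O => \val b)); [exact: val_continuous|exact: affine_point_continuous].
- by move=> a; apply/val_inj; apply: chartK; exact: fP.
- by move=> b; apply/val_inj; exact: affine_pointK.
Qed.

End Chart.

(** * Choice of projective coordinates *)

Section Frame.
Variable R : realType.
Implicit Types (a : 'rV[R]_3) (B : 'M[R]_3).

Lemma covZ B c a j : cov B (c *: a) j = c * cov B a j.
Proof. by rewrite /cov linearZ /= -scalemxAr mxE. Qed.

Lemma cov_inj B a b : B \in unitmx -> (forall j, cov B a j = cov B b j) -> a = b.
Proof.
move=> uB ab; apply: trmx_inj; apply: (can_inj (mulKmx uB)).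
by apply/matrixP => j i; rewrite ord1; exact: ab.
Qed.

Lemma frame_at a : a != 0 -> exists2 B, B \in unitmx & forall j, cov B a j = (j == 0)%:R.
Proof.
move=> a0; pose A := a^T; pose r := row_ebase A 0 0.
have rk : \rank A = 1%N by rewrite mxrank_tr rank_rV a0.
have rE : row_ebase A = r%:M by apply/matrixP => i j; rewrite !ord1 !mxE.
have r0 : r != 0.
  by have := row_ebase_unit A; rewrite unitmxE rE det_scalar1 unitfE.
(* A column of rank one is [col_ebase A] applied to [r] times the first basis vector. *)
exists (r^-1 *: invmx (col_ebase A)).
  by rewrite unitmxZ ?unitfE ?invr_eq0 // unitmx_inv col_ebase_unit.
move=> j; have AE := mulmx_ebase A; rewrite rk rE in AE.
rewrite /cov -/A -[X in _ *m X]AE !mulmxA -2!scalemxAl mulVmx ?col_ebase_unit //.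
rewrite mul1mx -scalemxAl mul_mx_scalar scalerA mulVf // scale1r mxE.
by case: j => [[|j] h].
Qed.

(** In the frame of [frame_at] a covector whose last two coefficients vanish is a multiple of [a].
    For any other one the shear by [u], which adds [u] times coefficient 1 to coefficient 2, makes
    the latter nonzero for all but at most one [u]. *)
Lemma projective_frame (T : finType) (alpha : T -> 'rV[R]_3) a : a != 0 ->
  (forall c r, alpha c != r *: a) ->
  exists B, [/\ B \in unitmx, forall j, cov B a j = (j == 0)%:R
    & forall c, cov B (alpha c) 2 != 0].
Proof.
move=> a0 aP; have [B0 uB0 B0a] := frame_at a0.
have [u _ uF] := avoid_finite (fun c => - cov B0 (alpha c) 2 / cov B0 (alpha c) 1) (ltr01 : 0 < 1 :> R).
pose E v : 'M[R]_3 := 1%:M + v *: delta_mx 2 1.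
have EE v w : E v *m E w = E (v + w).
  rewrite /E mulmxDl !mulmxDr !mul1mx mulmx1 -scalemxAl -scalemxAr mul_delta_mx_0 //.
  by rewrite !scaler0 addr0 -addrA scalerDl [w *: _ + _]addrC.
have uE v : E v \in unitmx.
  by apply: (proj1 (@mulmx1_unit _ _ _ (E (- v)) _)); rewrite EE subrr /E scale0r addr0.
have covE b j : cov (E u *m B0) b j = cov B0 b j + (j == 2)%:R * (u * cov B0 b 1).
  rewrite /cov -mulmxA mulmxDl mul1mx mxE -scalemxAl mxE; congr (_ + _).
  rewrite [RHS]mulrCA mxE; congr (_ * _).
  rewrite mxE (bigD1 1) //= [delta_mx _ _ _ _]mxE eqxx andbT big1 ?addr0 // => i i1.
  by rewrite mxE (negPf i1) andbF mul0r.
exists (E u *m B0); split.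
- by rewrite unitmx_mul uE.
- by move=> j; rewrite covE !B0a /= !mulr0 addr0.
move=> c; rewrite covE eqxx mul1r.
have [w1|w1] := eqVneq (cov B0 (alpha c) 1) 0.
  rewrite w1 mulr0 addr0; apply: contraNneq (aP c (cov B0 (alpha c) 0)) => w2.
  apply/eqP; apply: (cov_inj uB0) => j; rewrite covZ B0a.
  by case: (ord3P j) => -> /=; rewrite ?mulr1 ?mulr0.
apply: contraNneq (uF c) => e; apply/eqP; apply: (mulIf w1); rewrite divfK //.
by apply/eqP; rewrite -subr_eq0 opprK addrC e.
Qed.

End Frame.

(** * From the projective to the affine arrangement *)

Lemma sort_strict (R : realDomainType) (T : eqType) (f : T -> R) (s : seq T) :
  uniq s -> {in s &, injective f} ->
  pairwise [rel c d | f c < f d] (sort [rel c d | f c <= f d] s).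
Proof.
move=> us fI; have us' : uniq (map f s) by rewrite map_inj_in_uniq.
have := sort_le_sorted (map f s).
rewrite sort_map => sle.
have : sorted <%R (map f (sort [rel c d | f c <= f d] s)).
  by rewrite lt_sorted_uniq_le sle andbT -sort_map sort_uniq.
by rewrite lt_sorted_pairwise pairwise_map.
Qed.

Lemma hyperplane_scale (R : realType) (r : R) (a : 'rV[R]_3) : r != 0 ->
  hyperplane (map_mx (real_complex R) (r *: a)) = hyperplane (map_mx (real_complex R) a) :> set (CP R 2).
Proof.
move=> r0; apply/seteqP; split=> p; rewrite -[p]reprK !hyperplane_pi.
  have -> : \sum_i (map_mx (real_complex R) (r *: a)) 0 i * (\val (repr p)) 0 i =
     real_complex R r * \sum_i (map_mx (real_complex R) a) 0 i * (\val (repr p)) 0 i.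
    by rewrite mulr_sumr; apply: eq_bigr => i _; rewrite !mxE rmorphM mulrA.
  move/eqP; rewrite mulf_eq0 => /orP[/eqP/(@complexI _) r1|/eqP//].
  by rewrite r1 eqxx in r0.
move=> h; transitivity (real_complex R r * \sum_i (map_mx (real_complex R) a) 0 i * (\val (repr p)) 0 i).
  by rewrite mulr_sumr; apply: eq_bigr => i _; rewrite !mxE rmorphM mulrA.
by rewrite h mulr0.
Qed.

Section Reduction.
Variables (R : realType) (L : {fset set (CP R 2)}) (t : nat).
Local Notation CP2 := (CP R 2).
Variables (P : 'I_t.+1 -> CP2) (k : 'I_t.+1 -> nat) (S : 'I_t.+1 -> {fset set CP2}).
Hypothesis mpP : forall p, multiple_point L p <-> exists i, p = P i.
Hypothesis oneP : forall l, l \in L -> forall i j, l (P i) -> l (P j) -> i = j.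
Hypothesis SL : forall l, (l \in L) = [exists i, l \in S i].
Hypothesis SP : forall i l, l \in S i -> l (P i).
Hypothesis hk : forall i, multiplicity L (P i) = (k i + 1)%N.

Lemma S_sub i l : l \in S i -> l \in L.
Proof. by move=> lS; rewrite SL; apply/existsP; exists i. Qed.

Lemma S_through l i : l \in L -> l (P i) -> l \in S i.
Proof.
move=> lL lP; have := lL; rewrite SL => /existsP[j lS].
by rewrite (oneP lL lP (SP lS)).
Qed.

Lemma card_S i : #|` S i| = (k i).+1.
Proof.
rewrite -[RHS]addn1 -hk /multiplicity; congr #|` _|; apply/fsetP => l; rewrite !inE /=.
by apply/idP/andP => [lS|[lL]]; rewrite in_setE;
  [split; [exact: S_sub lS|exact: SP]|exact: S_through].
Qed.

Lemma k_gt1 i : (1 < k i)%N.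
Proof.
have : multiple_point L (P i) by apply/mpP; exists i.
by rewrite /multiple_point hk addn1.
Qed.

Lemma common_point (A : {fset set CP2}) p : (2 < #|` A|)%N ->
  (forall l, l \in A -> l \in L /\ l p) -> exists i, p = P i.
Proof.
move=> A2 Ap; apply/mpP; apply: leq_trans A2 _; apply: fsubset_leq_card.
by apply/fsubsetP => l /Ap[lL lp]; rewrite !inE /= lL in_setE.
Qed.

(** The form in which non-collinearity enters: three lines make [p] a multiple point, and all lines
    through [P i] lie in the block [S i]. *)
Lemma triple_point l1 l2 l3 p : l1 != l2 -> l1 != l3 -> l2 != l3 ->
  l1 \in L -> l2 \in L -> l3 \in L -> l1 p -> l2 p -> l3 p ->
  exists i, [/\ p = P i, l1 \in S i & l2 \in S i].
Proof.
move=> n12 n13 n23 L1 L2 L3 p1 p2 p3.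
have [|l|i pi] := @common_point (l1 |` (l2 |` [fset l3]))%fset p.
- by rewrite !cardfsU1 !inE cardfs1 negb_or n12 n13 n23.
- by rewrite !inE => /or3P[] /eqP ->.
by exists i; split=> //; apply: S_through => //; rewrite -pi.
Qed.

Variables (alpha : set CP2 -> 'rV[R]_3) (linf : set CP2).
Hypothesis alphaE : forall l, l \in L -> l = hyperplane (map_mx (real_complex R) (alpha l)).
Hypothesis linfS : linf \in S ord0.
Local Notation T := (L `\ linf)%fset.
Implicit Types (c d e : T).
Variable B : 'M[R]_3.
Hypothesis uB : B \in unitmx.
Hypothesis Binf : forall j, cov B (alpha linf) j = (j == 0)%:R.
Hypothesis B2 : forall c, cov B (alpha (val c)) 2 != 0.
Local Notation affine_point := (affine_point uB).
Local Notation infinity_point := (infinity_point uB).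
Local Notation finite_point := (finite_point B).

(* In the coordinates of [B] the line at infinity is [phi 0 = 0], and [B2] says
   that no other line is vertical. *)
Definition slope c : R := - cov B (alpha (val c)) 1 / cov B (alpha (val c)) 2.
Definition intercept c : R := - cov B (alpha (val c)) 0 / cov B (alpha (val c)) 2.
Local Notation lform := (lform slope intercept).
Local Notation dform := (dform slope).

Lemma val_L c : val c \in L.
Proof. by have := valP c; rewrite !inE => /andP[]. Qed.

Lemma val_neq_inf c : val c != linf.
Proof. by have := valP c; rewrite !inE => /andP[]. Qed.

Lemma linfL : linf \in L. Proof. exact: S_sub linfS. Qed.

Lemma line_affine c u : val c (affine_point u) <-> lform c u.1 = 0 /\ dform c u.2 = 0.
Proof.
rewrite [X in X (affine_point u) <-> _](alphaE (val_L c)) hyperplane_affine_point.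
set A := cov B _; have A2 : A 2 != 0 := B2 c.
have -> : A 0 + A 1 * u.1.1 + A 2 * u.1.2 = A 2 * lform c u.1.
  by rewrite /lform /slope /intercept -/A; field.
have -> : A 1 * u.2.1 + A 2 * u.2.2 = A 2 * dform c u.2.
  by rewrite /dform /slope -/A; field.
by split=> -[/eqP h1 /eqP h2]; split; apply/eqP; move: h1 h2; rewrite !mulf_eq0 (negPf A2).
Qed.

Lemma line_real c X : val c (affine_point (X, 0)) <-> lform c X = 0.
Proof.
rewrite line_affine /=; split=> [[]//|h]; split=> //.
by rewrite /dform /= mulr0 subr0.
Qed.

Lemma line_infinity c r : val c (infinity_point r) <-> r = slope c.
Proof.
rewrite [X in X (infinity_point r) <-> _](alphaE (val_L c)) hyperplane_infinity_point /slope.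
set A := cov B _; have A2 : A 2 != 0 := B2 c.
split=> [h|->]; last by field.
apply: (mulfI A2); rewrite mulrCA divff // mulr1.
by apply/eqP; rewrite -subr_eq0 opprK addrC h.
Qed.

Lemma linf_infinity r : linf (infinity_point r).
Proof. by rewrite (alphaE linfL) hyperplane_infinity_point !Binf /= mul0r addr0. Qed.

Lemma linf_finite p : linf p <-> ~ finite_point p.
Proof.
rewrite (alphaE linfL) -[p]reprK hyperplane_pi (dot_phi uB) sum3 !Binf /= finite_point_pi.
rewrite !mulr0 !addr0 mulr1.
by split=> [->|/negP/negPn/eqP//]; rewrite eqxx.
Qed.

Definition pencil c : 'I_t.+1 := odflt ord0 [pick i | val c \in S i].

Lemma pencilP c i : (val c \in S i) = (pencil c == i).
Proof.
rewrite /pencil; case: pickP => [j cj|h] /=; last first.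
  by have := val_L c; rewrite SL => /existsP[j]; rewrite h.
apply/idP/eqP => [ci|<-//]; exact: (oneP (val_L c) (SP cj) (SP ci)).
Qed.

(** Equal slopes and intercepts make the covectors proportional, hence the hyperplanes equal. *)
Lemma slope_intercept_inj c d : slope c = slope d -> intercept c = intercept d -> c = d.
Proof.
rewrite /slope /intercept => s i; apply/val_inj.
rewrite (alphaE (val_L c)) (alphaE (val_L d)).
pose r := cov B (alpha (val c)) 2 / cov B (alpha (val d)) 2.
have r0 : r != 0 by rewrite mulf_neq0 ?invr_eq0.
suff -> : alpha (val c) = r *: alpha (val d) by exact: hyperplane_scale.
apply: (cov_inj uB) => j; rewrite covZ /r.
have E (a b : R) : - a / cov B (alpha (val c)) 2 = - b / cov B (alpha (val d)) 2 ->
  a = cov B (alpha (val c)) 2 / cov B (alpha (val d)) 2 * b.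
  move=> /(congr1 (fun x => - (cov B (alpha (val c)) 2 * x))).
  rewrite mulrCA divff // mulr1 opprK => ->; by field.
by case: (ord3P j) => ->; [exact: E|exact: E|rewrite divfK].
Qed.

Definition real_point i : R * R := (chart B (P i)).1.

Lemma P_finite i : i != ord0 -> finite_point (P i).
Proof.
move=> i0; apply: contrapT => /linf_finite h.
by have /eqP := oneP linfL h (SP linfS); rewrite (negPf i0).
Qed.

Lemma line_real_point i c : i != ord0 -> val c (P i) -> lform c (real_point i) = 0.
Proof.
by move=> i0; rewrite -[P i](chartK uB (P_finite i0)) => /line_affine[].
Qed.

Lemma notin_S0 i l : i != ord0 -> l \in S i -> l != linf.
Proof.
move=> i0 li; apply: contraNneq i0 => ll; apply/eqP.
by apply: (oneP linfL (SP _) (SP linfS)); rewrite -ll.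
Qed.

Lemma lift_T l : l \in L -> l != linf -> exists c, val c = l.
Proof.
move=> lL ll; have lT : l \in T by rewrite !inE ll.
by exists [` lT]%fset.
Qed.

(** The multiple points are not assumed real. The lines are, so those through [P i] also pass
    through its real part; being at least three they make it some [P j], and a common line forces
    [j = i]. *)
Lemma real_pointE i : i != ord0 -> affine_point (real_point i, 0) = P i.
Proof.
move=> i0; have S2 : (2 < #|` S i|)%N by rewrite card_S ltnS k_gt1.
have through l : l \in S i -> l \in L /\ l (affine_point (real_point i, 0)).
  move=> li; split; first exact: S_sub li.
  have [c cl] := lift_T (S_sub li) (notin_S0 i0 li).
  by rewrite -cl; apply/line_real; apply: line_real_point => //; rewrite cl; exact: SP.
have [j pj] := common_point S2 through.
have /fset0Pn[l li] : S i != fset0 by rewrite -cardfs_gt0; apply: leq_ltn_trans S2.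
have [lL] := through l li; rewrite pj => lj.
by rewrite (oneP lL (SP li) lj).
Qed.

Lemma pencil_real_point i c : i != ord0 -> (pencil c == i) = (lform c (real_point i) == 0).
Proof.
move=> i0; rewrite -pencilP; apply/idP/eqP => [ci|/line_real].
  by apply: line_real_point => //; exact: SP.
by rewrite real_pointE //; apply: S_through; exact: val_L.
Qed.

(** Two lines of equal slope meet at infinity, where [linf] is a third line through their common
    point. *)
Lemma slopes_differ c d : pencil c != pencil d -> slope c != slope d.
Proof.
move=> cd; apply: contraNneq cd => mcd.
have [->//|ncd] := eqVneq c d.
have [||||||||//|i [_]] := @triple_point (val c) (val d) linf (infinity_point (slope c)).
- by rewrite (inj_eq val_inj).
- exact: val_neq_inf.
- exact: val_neq_inf.
- exact: val_L.
- exact: val_L.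
- exact: linfL.
- exact/line_infinity.
- exact/line_infinity.
- exact: linf_infinity.
by rewrite !pencilP => /eqP -> /eqP ->.
Qed.

Lemma pencil_double c d e X : pencil c != pencil d ->
  lform c X = 0 -> lform d X = 0 -> lform e X = 0 -> (e == c) || (e == d).
Proof.
move=> cd cX dX eX; apply: contraNT cd; rewrite negb_or => /andP[ec ed].
have [->//|ncd] := eqVneq c d.
have [||||||||//|i [_]] := @triple_point (val c) (val d) (val e) (affine_point (X, 0)).
- by rewrite (inj_eq val_inj).
- by rewrite (inj_eq val_inj) eq_sym.
- by rewrite (inj_eq val_inj) eq_sym.
- exact: val_L.
- exact: val_L.
- exact: val_L.
- exact/line_real.
- exact/line_real.
- exact/line_real.
by rewrite !pencilP => /eqP -> /eqP ->.
Qed.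

Lemma parallel_slope : exists m0, forall c, pencil c = ord0 -> slope c = m0.
Proof.
pose v := \val (repr (P ord0)).
have v0 : phi B 0 v = 0.
  by have /linf_finite/negP/negPn/eqP := SP linfS.
(* [P ord0] is the point at infinity in the direction of slope [phi 2 / phi 1]; the real part is
   taken because this quotient is seen to be real only once a line through the point is given. *)
exists (complex.Re (phi B 2 v / phi B 1 v)) => c /eqP; rewrite -pencilP => /SP.
rewrite [X in X (P ord0) -> _](alphaE (val_L c)) -[P ord0]reprK hyperplane_pi (dot_phi uB) sum3 -/v.
rewrite v0 mul0r add0r /slope => e.
have A2 : (cov B (alpha (val c)) 2)%:C%C != 0 by rewrite fmorph_eq0.
(* Otherwise the line [c], which is not vertical, would force all coordinates of [v] to vanish. *)
have p1 : phi B 1 v != 0.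
  apply: contraPneq (ppt_val (repr (P ord0))) => p1.
  rewrite p1 mul0r add0r in e; move/eqP: e; rewrite mulf_eq0 (negPf A2) orbF => /eqP p2.
  by apply/negP/negPn; rewrite -/v [v](phi_expand uB) sum3 v0 p1 p2 !scale0r !addr0.
have -> : phi B 2 v / phi B 1 v =
    (- cov B (alpha (val c)) 1 / cov B (alpha (val c)) 2)%:C%C.
  rewrite rmorphM rmorphN fmorphV; apply/eqP; rewrite eqr_div // -subr_eq0.
  by rewrite mulNr opprK addrC [_%:C%C * _]mulrC e.
by [].
Qed.

Definition lines i : seq T := pmap insub (S i).

Lemma mem_lines i c : (c \in lines i) = (pencil c == i).
Proof. by rewrite mem_pmap_sub pencilP. Qed.

Lemma uniq_lines i : uniq (lines i).
Proof. by apply: pmap_sub_uniq; exact: fset_uniq. Qed.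

(** The block [S ord0] has [(k ord0).+1] lines, one of which is [linf]. *)
Lemma size_lines0 : size (lines ord0) = k ord0.
Proof.
rewrite size_pmap_sub; apply/eqP.
have := count_predC (pred1 linf) (S ord0).
rewrite count_uniq_mem ?fset_uniq // linfS add1n -[size _]/(#|` S ord0|) card_S => -[<-].
apply/eqP/eq_in_count => l lS /=.
by rewrite !inE (S_sub lS) andbT.
Qed.

Lemma size_lines i : i != ord0 -> size (lines i) = (k i).+1.
Proof.
move=> i0; rewrite size_pmap_sub -card_S; apply/eqP; rewrite -all_count.
by apply/allP => l lS; rewrite /= !inE (S_sub lS) (notin_S0 i0 lS).
Qed.

Definition pencil_lines i : seq T :=
  if i == ord0 then sort [rel c d | intercept c <= intercept d] (lines i)
  else sort [rel c d | slope c <= slope d] (lines i).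

Lemma complement_affine u :
  arrangement_complement L (affine_point u) <-> arrangement_space slope intercept u.
Proof.
split=> [h c|h [l lL]].
  apply: contrapT => /negP; rewrite negb_or !negbK => /andP[/eqP h1 /eqP h2].
  by apply: h; exists (val c); [exact: val_L|apply/line_affine].
have [->|ll] := eqVneq l linf; first by move/linf_finite; apply; exact: finite_affine_point.
have [c <-] := lift_T lL ll; move/line_affine => [h1 h2].
by have := h c; rewrite h1 h2 eqxx.
Qed.

Lemma complement_pi1 (x : arrangement_complement L) :
  isomorphic (pi1 R x) (direct_product (fun i => free_group 'I_(k i)) * Zpow t)%type.
Proof.
have [p Up|z xz] := @chart_isomorphic R B uB _ _ x _ complement_affine.
  apply: contrapT => /linf_finite h; apply: Up; exists linf => //; exact: linfL.
apply: isomorphic_trans xz _.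
have [m0 m0P] := parallel_slope.
apply: (@affine_pi1 R _ slope intercept t pencil pencil_lines real_point k m0) => //.
- by move=> i c; rewrite /pencil_lines; case: ifP; rewrite mem_sort mem_lines.
- rewrite /pencil_lines eqxx; apply: sort_strict; first exact: uniq_lines.
  move=> c d; rewrite !mem_lines => /eqP /m0P c0 /eqP /m0P d0.
  by apply: slope_intercept_inj; rewrite c0.
- move=> i i0; rewrite /pencil_lines (negPf i0); apply: sort_strict; first exact: uniq_lines.
  move=> c d; rewrite !mem_lines !pencil_real_point // => /eqP c0 /eqP d0 mcd.
  apply: slope_intercept_inj => //; move: c0; rewrite -d0 /lform mcd.
  by move/addrI/oppr_inj.
- exact: pencil_real_point.
- exact: slopes_differ.
- exact: pencil_double.
- by rewrite /pencil_lines eqxx size_sort size_lines0.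
- by move=> i i0; rewrite /pencil_lines (negPf i0) size_sort size_lines.
- by move=> i _; apply: ltnW; exact: k_gt1.
Qed.

End Reduction.

Theorem theorem3p2p1 (R : realType) (L : {fset set (CP R 2)}) (t : nat)
    (P : 'I_t -> CP R 2) (k : 'I_t -> nat)
    (hL : real_line_arrangement L) (ht : (1 <= t)%N)
    (hP : noncollinear_multiple_points L P)
    (hk : forall i, multiplicity L (P i) = (k i + 1)%N)
    (x : arrangement_complement L) :
  isomorphic (pi1 R x)
    (direct_product (fun i => free_group 'I_(k i)) * Zpow (t - 1))%type.
Proof.
(* From here on [t] counts the affine pencils; the block of [ord0] provides the line at infinity. *)
case: t ht P k hP hk => // t _ P k [_ mpP oneP [S [SL _ SP]]] hk; rewrite subn1 /=.
pose alpha l := xget 0 [set a : 'rV[R]_3 | a != 0 /\ l = hyperplane (map_mx (real_complex R) a)].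
have alphaP l : l \in L -> alpha l != 0 /\ l = hyperplane (map_mx (real_complex R) (alpha l)).
  by move=> /hL[a a0 la]; rewrite /alpha; case: xgetP => [b _ []|/(_ a)[]].
have /fset0Pn[linf linfS] : S ord0 != fset0 by rewrite -cardfs_gt0 (card_S oneP SL SP hk).
have linfL := S_sub SL linfS.
have [|c r|B [uB Binf B2]] := @projective_frame R (L `\ linf)%fset (fun c => alpha (val c)) (alpha linf).
- exact: (alphaP _ linfL).1.
(* A covector proportional to that of [linf] would define [linf] again. *)
- move: (val c) (valP c) => l; rewrite !inE => /andP[ll lL]; apply: contraNneq ll => e.
  have [a0 ->] := alphaP _ lL; have [_ ->] := alphaP _ linfL.
  rewrite e hyperplane_scale //; apply: contraNneq a0 => r0.
  by rewrite e r0 scale0r.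
exact: (complement_pi1 mpP oneP SL SP hk (fun l lL => (alphaP l lL).2) linfS uB Binf B2 x).
Qed.
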